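(* Let $0\le\rho<R<\infty$, let $s\ge 1$ be an integer and let $\psi:[0,\infty)\to[0,\infty)$, $\psi(t)=t^2$. Let $\mu$ be a pseudo-positive signed measure with support in $A_{\rho,R}$ satisfying $$\sum_{k=0}^{\infty}\sum_{l=1}^{a_k}\int_{\mathbb{R}^d}Y_{k,l}\Big(\frac{x}{|x|}\Big)\,d\mu(x)<\infty ,$$ and let $\sigma^{(s)}$ be the polyharmonic Gauß–Jacobi measure of order $s$ for $\mu$. For $f\in C(A_{\rho,R})$ put $E_s(f):=\int f\,d\mu-\int f\,d\sigma^{(s)}$. If $f\in C^{2s}(A_{\rho,R}^{\circ})\cap C(A_{\rho,R})$, then $$|E_s(f)|\le\frac{1}{(2s)!}\sum_{k=0}^{\infty}\sum_{l=1}^{a_k}\ \sup_{\rho^2<\xi<R^2}\left|\frac{d^{2s}}{dt^{2s}}\Big[f_{k,l}(\sqrt t)\,t^{-\frac12 k}\Big](\xi)\right|\int_{\rho^2}^{R^2}\big|Q_{k,l}^s(t)\big|^2\,d\mu_{k,l}^\psi(t).$$ Here $f_{k,l}$ are the Laplace–Fourier coefficients of $f$, and $Q_{k,l}^s$ is the orthogonal polynomial of degree $s$ with respect to the measure $\mu_{k,l}^\psi$, normalized so that its leading coefficient is $1$; if the support of $\mu_{k,l}$ has fewer than $s$ points, $Q_{k,l}^s$ is defined to be $0$.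
   Context: Fix an integer $d\ge 2$. $|x|$ is the Euclidean norm, $\Delta$ the Laplace operator on $\mathbb{R}^d$, $A_{\rho,R}=\{x\in\mathbb{R}^d:\rho\le|x|\le R\}$ with interior $A_{\rho,R}^\circ$, and $\mathbb{S}^{d-1}$ the unit sphere with surface measure $d\theta$. $C(X)$ is the space of continuous complex-valued functions on $X$. For each $k\in\mathbb{N}_0=\{0,1,2,\dots\}$, $Y_{k,1},\dots,Y_{k,a_k}:\mathbb{R}^d\to\mathbb{R}$ is a fixed basis of the space of harmonic homogeneous polynomials of degree $k$, orthonormal with respect to $\langle f,g\rangle=\int_{\mathbb{S}^{d-1}}f(\theta)\overline{g(\theta)}\,d\theta$. At $x=0$, $Y_{k,l}(x/|x|)$ is read as $0$ for $k\ge1$ and as the constant value of $Y_{0,1}$ for $k=0$. Laplace–Fourier coefficients: $f_{k,l}(r)=\int_{\mathbb{S}^{d-1}}f(r\theta)Y_{k,l}(\theta)\,d\theta$. Convention: $\infty\cdot0=0$. A signed measure on $\mathbb{R}^d$ is a real-valued $\sigma$-additive set function on the Borel sets. It is pseudo-positive if $\int_{\mathbb{R}^d}h(|x|)Y_{k,l}(x)\,d\mu(x)\ge0$ for every continuous compactly supported $h:[0,\infty)\to[0,\infty)$ and all $k,l$. The component measures of a compactly supported pseudo-positive measure $\mu$ are the unique non-negative measures $\mu_{k,l}$ on $[0,\infty)$ such that $\int_0^\infty h\,d\mu_{k,l}=\int_{\mathbb{R}^d}h(|x|)Y_{k,l}(x)\,d\mu(x)$ for all continuous polynomially bounded $h:[0,\infty)\to\mathbb{C}$.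 $\nu^\psi(B)=\nu(\psi^{-1}(B))$ is the image measure. The orthogonal polynomial of degree $s$ with leading coefficient 1 for $\nu$ is the monic polynomial of degree $s$ orthogonal in $L^2(\nu)$ to all polynomials of degree $<s$. For $\mu$ as in the claim, the polyharmonic Gauß–Jacobi measure of order $s$ is the (existing and unique) pseudo-positive signed measure $\sigma^{(s)}$ with support in $A_{\rho,R}$ such that (i) each component measure $\sigma^{(s)}_{k,l}$ has support of cardinality $\le s$, and (ii) $\int P\,d\mu=\int P\,d\sigma^{(s)}$ for all polynomials $P$ with $\Delta^{2s}P=0$. *)

(* Defs.v *)
(* Written on top of MathComp, MathComp-Analysis, real-closed (for R[i]) and
   multinomials.  mpoly has to be imported before the analysis library. *)
From HB Require Import structures.
From mathcomp Require Import all_boot all_order all_algebra.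
From mathcomp Require Import mpoly complex.
From mathcomp Require Import all_classical all_reals all_analysis.

Set Implicit Arguments.
Unset Strict Implicit.
Unset Printing Implicit Defensive.

Import Order.TTheory GRing.Theory Num.Theory.
Import numFieldNormedType.Exports.

Local Open Scope classical_set_scope.
Local Open Scope ring_scope.

Local Notation Re := (@complex.Re _).
Local Notation Im := (@complex.Im _).

(* R^d with its Borel sigma-algebra; as a type it is convertible to 'rV[R]_d. *)
Notation borel_rV R d := (g_sigma_algebraType (@open 'rV[R]_d)).

Section complex_valued.
Context {R : realType}.

Definition cmod (z : R[i]) : R := ComplexField.Normc.normc z.

Definition ccontinuous_on {T : topologicalType} (A : set T) (g : T -> R[i]) :=
  {within A, continuous (Re \o g)} /\
  {within A, continuous (Im \o g)}.

Definition cderive1n (n : nat) (g : R -> R[i]) : R -> R[i] := fun t =>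
  Complex (derive1n n (Re \o g) t) (derive1n n (Im \o g) t).

Definition cintegral {disp} {T : measurableType disp} (m : set T -> \bar R)
    (D : set T) (g : T -> R[i]) : R[i] :=
  Complex (fine (\int[m]_(x in D) (Re (g x))%:E)%E)
          (fine (\int[m]_(x in D) (Im (g x))%:E)%E).

End complex_valued.

Section signed_measure.
Context {disp} {T : measurableType disp} {R : realType}.
Implicit Types mu : {charge set T -> \bar R}.

Lemma hahn_ex mu : exists PN : set T * set T, hahn_decomposition mu PN.1 PN.2.
Proof. by have [P [N PN]] := Hahn_decomposition mu; exists (P, N). Qed.

(* The Jordan parts do not depend on the chosen Hahn decomposition. *)
Definition hahn mu := svalP (cid (hahn_ex mu)).

Definition charge_pos mu : set T -> \bar R := jordan_pos (hahn mu).
Definition charge_neg mu : set T -> \bar R := jordan_neg (hahn mu).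
Definition charge_abs mu : set T -> \bar R := charge_variation (hahn mu).

Definition charge_integral mu (D : set T) (g : T -> R) : R :=
  fine (\int[charge_pos mu]_(x in D) (g x)%:E)%E -
  fine (\int[charge_neg mu]_(x in D) (g x)%:E)%E.

Definition charge_cintegral mu (D : set T) (g : T -> R[i]) : R[i] :=
  cintegral (charge_pos mu) D g - cintegral (charge_neg mu) D g.

End signed_measure.

Definition msupport {T : topologicalType} {R : realType} (m : set T -> \bar R) :
  set T := [set x | forall U, open U -> U x -> (0 < m U)%E].

Section euclidean.
Context {R : realType} {d : nat}.
Implicit Types x : 'rV[R]_d.

(* The library norm on 'rV[R]_d is the maximum norm; it induces the same
   topology. *)
Definition enorm x : R := Num.sqrt (\sum_(i < d) x 0 i ^+ 2).

Definition annulus (rho r : R) : set 'rV[R]_d :=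
  [set x | rho <= enorm x <= r].

Definition usphere : set 'rV[R]_d := [set x | enorm x = 1].

(* x / |x|; since 0^-1 = 0 this is 0 at x = 0, where a homogeneous polynomial
   of degree k vanishes if k >= 1 and takes its constant value if k = 0. *)
Definition direction x : 'rV[R]_d := (enorm x)^-1 *: x.

(* C^n on an open set U, for real-valued g. *)
Fixpoint Cn_on (n : nat) (U : set 'rV[R]_d) (g : 'rV[R]_d -> R) : Prop :=
  (forall x, U x -> {for x, continuous g}) /\
  if n is m.+1 then
    forall i : 'I_d, (forall x, U x -> derivable g x (delta_mx 0 i)) /\
      Cn_on m U (fun x => 'D_(delta_mx 0 i) g x)
  else True.

Definition cCn_on (n : nat) (U : set 'rV[R]_d) (g : 'rV[R]_d -> R[i]) : Prop :=
  Cn_on n U (Re \o g) /\ Cn_on n U (Im \o g).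

End euclidean.

(* d-dimensional Lebesgue measure on Borel sets, by integrating the measures of
   the sections over the first coordinate. *)
Fixpoint lebesgue_rV (R : realType) (d : nat) : set 'rV[R]_d -> \bar R :=
  if d is d'.+1 return set 'rV[R]_d -> \bar R then fun A =>
    (\int[lebesgue_measure]_t
      lebesgue_rV [set y : 'rV[R]_d' | A (row_mx (const_mx t : 'rV[R]_1) y)])%E
  else fun A => (\1_A 0)%:E.

(* The surface measure of the unit sphere, extended by 0 to R^d: the measure of
   B is d times the volume of the cone {r theta | 0 < r <= 1, theta in B}. *)
Definition surface_measure (R : realType) (d : nat)
    (B : set (borel_rV R d)) : \bar R :=
  (d%:R%:E *
   lebesgue_rV [set x : 'rV[R]_d | (0 < enorm x <= 1)%R /\ B (direction x)])%E.

Section polynomials.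
Context {d : nat}.

Definition laplacian {K : comNzRingType} (p : {mpoly K[d]}) : {mpoly K[d]} :=
  \sum_(i < d) mderiv i (mderiv i p).

Context {R : realType}.

Definition rpeval (p : {mpoly R[d]}) (x : 'rV[R]_d) : R := p.@[fun i => x 0 i].

Definition cpeval (p : {mpoly R[i][d]}) (x : 'rV[R]_d) : R[i] :=
  p.@[fun i => (x 0 i)%:C%C].

Implicit Types mu sigma : {charge set (borel_rV R d) -> \bar R}.

Context (a : nat -> nat) (Y : forall k, 'I_(a k) -> {mpoly R[d]}).

Definition harmonic_basis : Prop := forall k,
  [/\ forall l : 'I_(a k), laplacian (Y l) = 0 /\ Y l \is k.-homog,
      forall l l' : 'I_(a k),
        fine (\int[@surface_measure R d]_(x in usphere)
                (rpeval (Y l) x * rpeval (Y l') x)%:E)%E = (l == l')%:R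
    & forall p : {mpoly R[d]}, laplacian p = 0 -> p \is k.-homog ->
        exists! c : 'rV[R]_(a k), p = \sum_(l < a k) c 0 l *: Y l].

(* f_{k,l}(r) *)
Definition lf_coeff (f : 'rV[R]_d -> R[i]) k (l : 'I_(a k)) (r : R) : R[i] :=
  cintegral (@surface_measure R d) usphere
    (fun x => f (r *: x) * (rpeval (Y l) x)%:C%C).

(* t |-> f_{k,l}(sqrt t) t^(-k/2), for t > 0 *)
Definition lf_profile (f : 'rV[R]_d -> R[i]) k (l : 'I_(a k)) (t : R) : R[i] :=
  lf_coeff f l (Num.sqrt t) * (t `^ (- (k%:R / 2)))%:C%C.

Definition halfline : set R := [set` `[0, +oo[].

Definition pseudo_positive mu : Prop :=
  forall h : R -> R,
    {within halfline, continuous h} ->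
    (forall r, 0 <= r -> 0 <= h r) ->
    (exists M, forall r, M < r -> h r = 0) ->
    forall k (l : 'I_(a k)),
      0 <= charge_integral mu setT (fun x => h (enorm x) * rpeval (Y l) x).

Definition poly_bounded (h : R -> R[i]) : Prop :=
  exists (c : R) (n : nat), forall r, 0 <= r -> cmod (h r) <= c * (1 + r) ^+ n.

(* nu is the component measure mu_{k,l}; measures on [0, oo[ are encoded as
   measures on R that vanish on ]-oo, 0[. *)
Definition component_measure mu k (l : 'I_(a k)) (nu : {measure set R -> \bar R}) : Prop :=
  nu `]-oo, 0[%classic = 0%E /\
  forall h : R -> R[i],
    ccontinuous_on halfline h -> poly_bounded h ->
    [/\ nu.-integrable halfline (fun r => (Re (h r))%:E),
        nu.-integrable halfline (fun r => (Im (h r))%:E)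
      & cintegral nu halfline h =
        charge_cintegral mu setT
          (fun x => h (enorm x) * (rpeval (Y l) x)%:C%C)].

Definition gauss_jacobi (rho r : R) (s : nat) mu sigma : Prop :=
  [/\ pseudo_positive sigma,
      msupport (charge_abs sigma) `<=` annulus rho r,
      forall k (l : 'I_(a k)), exists2 nu : {measure set R -> \bar R},
        component_measure sigma l nu & (msupport nu #<= `I_s)%card
    & forall P : {mpoly R[i][d]}, iter (2 * s) laplacian P = 0 ->
        charge_cintegral mu setT (cpeval P) =
        charge_cintegral sigma setT (cpeval P)].

End polynomials.

Section orthogonal_polynomials.
Context {R : realType}.

Definition sq_map (t : R) : R := t ^+ 2.

Definition image_sq (nu : set R -> \bar R) : set R -> \bar R :=
  pushforward nu sq_map.

Definition monic_orthogonal (nu : set R -> \bar R) (s : nat) (Q : {poly R}) :=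
  [/\ Q \is monic, size Q = s.+1
    & forall p : {poly R}, (size p <= s)%N ->
        (\int[nu]_t (Q.[t] * p.[t])%:E)%E = 0%E].

(* Q is Q_{k,l}^s when nu is mu_{k,l}. *)
Definition gauss_polynomial (nu : set R -> \bar R) (s : nat) (Q : {poly R}) :=
  ((`I_s #<= msupport nu)%card -> monic_orthogonal (image_sq nu) s Q) /\
  (~ (`I_s #<= msupport nu)%card -> Q = 0).

End orthogonal_polynomials.

(* Main.v *)
Require Import Defs.
From HB Require Import structures.
From mathcomp Require Import all_boot all_order all_algebra.
From mathcomp Require Import mpoly complex ring lra.
From mathcomp Require Import all_classical all_reals all_analysis measurable_realfun.

Import Order.TTheory GRing.Theory Num.Theory.
Import numFieldNormedType.Exports.

Local Open Scope classical_set_scope.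
Local Open Scope ring_scope.

(** Since Y_{k,l}(x/|x|) = |x|^(-k) Y_{k,l}(x), the Laplace-Fourier expansion of a function g,
    continuous on the annulus, turns the integral of g against mu into the sum over k, l of the
    integrals of g_{k,l}(t) t^(-k) against mu_{k,l}. The same holds for sigma, so the error is a sum
    of one-dimensional quadrature errors, one for each component.

    One component. The map t -> t^2 carries mu_{k,l} and sigma_{k,l} to measures on [rho^2, r^2].
    The polynomials |x|^(2j) Y_{k,l} with j < 2s are annihilated by the 2s-th power of the Laplacian
    ([iter_laplacian_sqnormX]), so the two images agree on polynomials of degree < 2s
    ([image_sq_exact]), and the second one lives on at most s points: it is a Gauss quadrature for
    the first. Subtracting the Hermite interpolant at the nodes leaves F^(2s)(xi) / (2s)! times the
    squared node polynomial ([hermite_error]), whose integral is that of the squared orthogonal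
    polynomial ([nodal_sq_monic_orthogonal]). If that integral is 0, both measures live on the nodes
    and there is no error ([quadrature_degenerate]). The result is [component_error].

    Convergence of the expansion ([lf_sum_cvg]) is an argument of Banach-Steinhaus type. On a
    polynomial the partial sums are eventually exact, by the Gauss decomposition into terms |x|^(2i)
    h with h harmonic ([homog_gauss_span]) and the orthogonality of harmonics
    ([sphere_int_harmonic]). The partial sums are bounded in the sup norm, uniformly in n, by a
    multiple of the sum of the integrals of t^(-k) against mu_{k,l}, which is the series of the
    hypothesis ([component_weight]). Polynomials are dense in the continuous functions on the
    annulus ([continuous_approximable]). For sigma the bound is inherited from mu: the even
    derivatives of t^(-k/2) are nonnegative, so the quadrature underestimates its integral
    ([component_weight_le]).

    Orthogonality of harmonics of different degrees rests on the rotation invariance of the surface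
    measure, which is reduced to the invariance of Lebesgue measure under shears: the infinitesimal
    rotations are then antisymmetric, and the sum of their squares has an eigenvalue on harmonics of
    degree k that determines k.

    A complex error is reduced to a real one by pairing its real and imaginary parts with the unit
    vector in its own direction. *)

Definition image_measure {d1 d2 : measure_display} {T1 : measurableType d1}
    {T2 : measurableType d2} {R : realType} (m : {measure set T1 -> \bar R})
    {f : T1 -> T2} (mf : measurable_fun setT f) : {measure set T2 -> \bar R} :=
  measure_function_pushforward__canonical__measure_function_Measure m mf.

Lemma image_measureE {d1 d2 : measure_display} {T1 : measurableType d1}
    {T2 : measurableType d2} {R : realType} (m : {measure set T1 -> \bar R})
    {f : T1 -> T2} (mf : measurable_fun setT f) A :
  image_measure m mf A = m (f @^-1` A).
Proof. by []. Qed.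

(** * Finite measures concentrated on a set *)

Section concentrated_measure.
Context {disp : measure_display} {T : measurableType disp} {R : realType}.
Variables (m : {measure set T -> \bar R}) (A : set T).
Implicit Types F G : T -> R.

(** Finite mass is included so that a function bounded on [A] is integrable; what the function does
    off [A] is then irrelevant, and the lemmas below only ask for bounds and equalities on [A]. *)
Definition concentrated := [/\ (m setT < +oo)%E, measurable A & m (~` A) = 0%E].

Hypothesis mA : concentrated.

Lemma measurable_patch F : measurable A -> measurable_fun setT F ->
  measurable_fun setT (F \_ A).
Proof.
by move=> mesA mF; apply/(measurable_restrictT _ _).1 => //; exact: measurable_funTS.
Qed.

Lemma concentrated_ae (P : T -> Prop) :
  (forall x, A x -> P x) -> {ae m, forall x, P x}.
Proof.
have [_ mesA A0] := mA.
move=> AP; exists (~` A); split => //; first exact: measurableC.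
by move=> x /= nP Ax; apply/nP/AP.
Qed.

Lemma bounded_integrable F B : measurable_fun setT F ->
  (forall x, A x -> `|F x| <= B) -> m.-integrable setT (EFin \o F).
Proof.
have [mfin mesA A0] := mA.
move=> mF FB; apply/integrableP; split; first exact/measurable_EFinP.
rewrite (@ae_eq_integral _ _ _ m _ ((fun x => `|(F x)%:E|%E) \_ A)) //.
- rewrite -integral_mkcond.
  apply: (@le_lt_trans _ _ (\int[m]_(x in A) B%:E)%E).
    apply: ge0_le_integral => //.
    by apply: measurableT_comp => //; apply/measurable_EFinP; exact: measurable_funTS.
  rewrite integral_cst // muleC.
  have : (m A < +oo)%E.
    by rewrite (le_lt_trans _ mfin) // le_measure ?inE.
  rewrite -ge0_fin_numE // => /fineK <-; by rewrite -EFinM ltry.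
- by apply: measurableT_comp => //; exact/measurable_EFinP.
- apply/(measurable_restrictT _ _).1 => //; apply: measurableT_comp => //.
  by apply/measurable_EFinP; exact: measurable_funTS.
- by apply: concentrated_ae => x Ax _; rewrite patchE mem_set.
Qed.

Lemma eq_Rintegral_concentrated F G : measurable_fun setT F ->
  measurable_fun setT G -> (forall x, A x -> F x = G x) ->
  \int[m]_x F x = \int[m]_x G x.
Proof.
move=> mF mG FG; congr fine; apply: ae_eq_integral => //; try exact/measurable_EFinP.
by apply: concentrated_ae => x Ax _; rewrite FG.
Qed.

Lemma eq_integrable_concentrated F G : measurable_fun setT F ->
  (forall x, A x -> F x = G x) -> m.-integrable setT (EFin \o G) ->
  m.-integrable setT (EFin \o F).
Proof.
move=> mF FG /integrableP[mG iG]; apply/integrableP; split.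
  exact/measurable_EFinP.
apply: le_lt_trans iG; rewrite le_eqVlt; apply/orP; left; apply/eqP.
apply: ae_eq_integral => //.
- by apply: measurableT_comp => //; exact/measurable_EFinP.
- exact: measurableT_comp.
- by apply: concentrated_ae => x Ax _; rewrite /= FG.
Qed.

Lemma le_integrable_concentrated F G : measurable_fun setT F ->
  (forall x, A x -> `|F x| <= G x) -> m.-integrable setT (EFin \o G) ->
  m.-integrable setT (EFin \o F).
Proof.
have [_ mesA _] := mA.
move=> mF FG iG.
have /measurable_EFinP mG : measurable_fun setT (EFin \o G) by case/integrableP: iG.
apply: (eq_integrable_concentrated _ (F \_ A)) => //.
  by move=> x Ax; rewrite patchE mem_set.
apply: le_integrable (iG) => //.
  by apply/measurable_EFinP/measurable_patch.
move=> x _ /=; rewrite lee_fin patchE; case: ifPn => [/set_mem Ax|_].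
  by rewrite (le_trans (FG x Ax)) // ler_norm.
by rewrite normr0.
Qed.

Lemma le_Rintegral_concentrated F G : m.-integrable setT (EFin \o F) ->
  m.-integrable setT (EFin \o G) -> (forall x, A x -> F x <= G x) ->
  \int[m]_x F x <= \int[m]_x G x.
Proof.
have [_ mesA _] := mA.
move=> iF iG FG.
have mF : measurable_fun setT F by apply/measurable_EFinP; case/integrableP: iF.
have mG : measurable_fun setT G by apply/measurable_EFinP; case/integrableP: iG.
have mp (H : T -> R) : measurable_fun setT H -> measurable_fun setT (H \_ A).
  exact: measurable_patch.
have ep (H : T -> R) x : A x -> H x = (H \_ A) x by move=> Ax; rewrite patchE mem_set.
rewrite (eq_Rintegral_concentrated F (F \_ A) mF (mp _ mF) (ep F)).
rewrite (eq_Rintegral_concentrated G (G \_ A) mG (mp _ mG) (ep G)).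
apply: le_Rintegral => //.
- apply: (eq_integrable_concentrated _ F) => //; first exact: mp.
  by move=> x /(ep F) ->.
- apply: (eq_integrable_concentrated _ G) => //; first exact: mp.
  by move=> x /(ep G) ->.
- by move=> x _; rewrite !patchE; case: ifPn => // /set_mem /FG.
Qed.

Lemma normr_Rintegral_concentrated F G : measurable_fun setT F ->
  m.-integrable setT (EFin \o G) -> (forall x, A x -> `|F x| <= G x) ->
  `|\int[m]_x F x| <= \int[m]_x G x.
Proof.
move=> mF iG FG; have iF := le_integrable_concentrated F G mF FG iG.
apply: (le_trans (le_normr_Rintegral measurableT iF)).
apply: le_Rintegral_concentrated => //.
exact: integrable_norm.
Qed.

Lemma integrable_cst_concentrated B : m.-integrable setT (EFin \o (fun _ : T => B)).
Proof. by apply: (bounded_integrable _ `|B|) => // *; exact: measurable_cst. Qed.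

Lemma normr_Rintegral_le_bound F B : measurable_fun setT F ->
  (forall x, A x -> `|F x| <= B) -> `|\int[m]_x F x| <= B * fine (m setT).
Proof.
move=> mF FB; rewrite -Rintegral_cst //.
exact: normr_Rintegral_concentrated (integrable_cst_concentrated B) FB.
Qed.

Lemma Rintegral_eq0_concentrated F : m.-integrable setT (EFin \o F) ->
  (forall x, A x -> 0 <= F x) -> \int[m]_x F x = 0 -> m [set x | A x /\ F x <> 0] = 0%E.
Proof.
have [_ mesA _] := mA.
move=> iF F0 i0.
have mF : measurable_fun setT F by apply/measurable_EFinP; case/integrableP: iF.
have mFA : measurable_fun setT (F \_ A).
  exact: measurable_patch.
have e x : A x -> F x = (F \_ A) x by move=> Ax; rewrite patchE mem_set.
have iFA : m.-integrable setT (EFin \o (F \_ A)).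
  by apply: (eq_integrable_concentrated _ F) => // x /e ->.
have : (\int[m]_x `|(EFin \o (F \_ A)) x| = 0)%E.
  rewrite (eq_Rintegral_concentrated F (F \_ A) mF mFA e) in i0.
  rewrite (eq_integral (EFin \o (F \_ A))); last first.
    move=> x _ /=; congr EFin; rewrite patchE; case: ifPn; last by rewrite normr0.
    by move=> /set_mem /F0 /ger0_norm.
  have := integrable_fin_num measurableT iFA => /fineK <-.
  by congr EFin.
move=> /ae_eq_integral_abs[] // /=; first exact/measurable_EFinP.
move=> N [mN N0 NN]; apply/eqP; rewrite -measure_le0 -N0.
rewrite le_measure ?inE //.
  rewrite (_ : [set x | _] = A `&` ~` (F @^-1` [set 0])); last by apply/seteqP; split.
  apply: measurableI => //.
  by apply: measurableC; rewrite -[X in measurable X]setTI; exact: mF.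
move=> x [Ax Fx]; apply: NN => /= /(_ I).
by rewrite patchE mem_set // => -[].
Qed.

End concentrated_measure.

(** * Harmonic polynomials: Gauss decomposition and infinitesimal rotations *)

Section harmonic_algebra.
Context {d : nat} {K : numFieldType}.
Implicit Types p q h : {mpoly K[d]}.

Definition sqnorm : {mpoly K[d]} := \sum_(i < d) 'X_i ^+ 2.

Definition euler p : {mpoly K[d]} := \sum_(i < d) 'X_i * p^`M(i).

Lemma mderiv_sum (I : Type) (r : seq I) (P : pred I) (F : I -> {mpoly K[d]}) i :
  (\sum_(j <- r | P j) F j)^`M(i) = \sum_(j <- r | P j) (F j)^`M(i).
Proof. exact: raddf_sum. Qed.

Lemma laplacianD p q : laplacian (p + q) = laplacian p + laplacian q.
Proof.
by rewrite /laplacian -big_split; apply: eq_bigr => i _; rewrite !mderivD.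
Qed.

Lemma laplacianZ c p : laplacian (c *: p) = c *: laplacian p.
Proof.
by rewrite /laplacian scaler_sumr; apply: eq_bigr => i _; rewrite !mderivZ.
Qed.

Lemma laplacian0 : laplacian (0 : {mpoly K[d]}) = 0.
Proof. by have := laplacianZ 0 0; rewrite !scale0r. Qed.

Lemma laplacianB p q : laplacian (p - q) = laplacian p - laplacian q.
Proof. by rewrite -scaleN1r laplacianD laplacianZ scaleN1r. Qed.

Lemma euler_homog k p : p \is k.-homog -> euler p = p *+ k.
Proof.
move=> hp; rewrite /euler.
rewrite {2}(mpolyE p) -sumrMnl.
under eq_bigr => i _.
  rewrite {1}(mpolyE p) mderiv_sum mulr_sumr.
  over.
rewrite exchange_big /= big_seq [RHS]big_seq; apply: eq_bigr => m mp.
under eq_bigr => i _.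
  rewrite mderivZ mderivX -!scalerAr -mpolyXD.
  over.
have -> : \sum_(i < d) p@_m *: ((m i)%:R *: 'X_[U_(i) + (m - U_(i))]) =
   \sum_(i < d) (p@_m *: 'X_[K, m]) *+ m i.
  apply: eq_bigr => i _.
  case: (posnP (m i)) => [->|mi]; first by rewrite scale0r scaler0.
  rewrite addmC submK ?lep1mP -?lt0n // scaler_nat.
  by rewrite -scalerMnr.
by rewrite sumrMnr -mdegE; move/dhomogP: hp => /(_ m mp) ->.
Qed.

Lemma mderiv_homog i k p : p \is k.+1.-homog -> p^`M(i) \is k.-homog.
Proof.
move/dhomogP => hp; apply/dhomogP => m.
rewrite mcoeff_msupp mcoeff_mderiv => nz.
have : (m + U_(i))%MM \in msupp p.
  by rewrite mcoeff_msupp; apply: contraNneq nz => ->; rewrite mul0rn.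
by move/hp => /=; rewrite mdegD mdeg1 addn1 => -[].
Qed.

Lemma mderiv_homog0 i p : p \is 0.-homog -> p^`M(i) = 0.
Proof.
move/dhomogP => hp; apply/mpolyP => m; rewrite mcoeff0 mcoeff_mderiv.
case: (eqVneq (p@_(m + U_(i))%MM) 0) => [->|]; first by rewrite mul0rn.
by rewrite -mcoeff_msupp => /hp /=; rewrite mdegD mdeg1 addn1.
Qed.

Lemma laplacian_homog k p : p \is k.+2.-homog -> laplacian p \is k.-homog.
Proof.
by move=> hp; apply: rpred_sum => i _; apply/mderiv_homog/mderiv_homog.
Qed.

Lemma laplacian_homog_lt2 k p : (k < 2)%N -> p \is k.-homog -> laplacian p = 0.
Proof.
case: k => [|[|//]] _ hp; apply: big1 => i _.
  by rewrite (mderiv_homog0 _ _ hp) mderiv0.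
by rewrite mderiv_homog0 //; apply: mderiv_homog.
Qed.

Lemma sqnorm_homog : sqnorm \is 2.-homog.
Proof.
apply: rpred_sum => i _; rewrite mpolyXn dhomogX /=.
by rewrite mdegMn mdeg1.
Qed.

Lemma sqnormX_homog i k h : h \is k.-homog ->
  sqnorm ^+ i * h \is (2 * i + k).-homog.
Proof. by move=> hh; apply: dhomogM => //; apply: dhomogMn sqnorm_homog. Qed.

Lemma mderiv_sqnorm i : sqnorm^`M(i) = 'X_i *+ 2.
Proof.
rewrite mderiv_sum (bigD1 i) //= big1 ?addr0 => [|j ji].
  rewrite expr2 mderivM mderivX mnmE eqxx scale1r.
  rewrite (_ : (U_(i) - U_(i))%MM = 0%MM) ?mpolyX0; first by rewrite mul1r mulr1 mulr2n.
  by apply/mnmP => l; rewrite !mnmE subnn.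
by rewrite expr2 mderivM mderivX mnmE (negbTE ji) scale0r mul0r mulr0 addr0.
Qed.

(** Product rule: the Laplacian of |x|^2 contributes 2d, and the mixed term is 4 times the Euler
    operator, hence 4k on degree k. *)
Lemma laplacian_sqnormM k q : q \is k.-homog ->
  laplacian (sqnorm * q) = q *+ (2 * d + 4 * k) + sqnorm * laplacian q.
Proof.
move=> /euler_homog eq.
rewrite /laplacian.
under eq_bigr => i _.
  rewrite mderivM mderiv_sqnorm mderivD !mderivM mderiv_sqnorm mderivMn.
  rewrite mderivX mnmE eqxx scale1r.
  rewrite (_ : (U_(i) - U_(i))%MM = 0%MM) ?mpolyX0; last first.
    by apply/mnmP => l; rewrite !mnmE subnn.
  rewrite (_ : _ + _ = q *+ 2 + ('X_i * q^`M(i)) *+ 4 + sqnorm * q^`M(i)^`M(i)); last by ring.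
  over.
rewrite !big_split /= -mulr_sumr -/(euler q) eq sumr_const card_ord.
ring.
Qed.

(** Only the positivity of the constants matters later: it makes division by them possible in
    [gauss_span_laplacian]. *)
Lemma laplacian_sqnormX k h : h \is k.-homog -> laplacian h = 0 -> (0 < d)%N ->
  exists c : nat -> nat, forall i, (0 < c i)%N /\
    laplacian (sqnorm ^+ i.+1 * h) = (sqnorm ^+ i * h) *+ c i.
Proof.
move=> hk h0 d0.
(* Going from one exponent to the next adds the factor 2d + 4(2i + k) that [laplacian_sqnormM]
   produces on degree 2i + k. *)
pose c := fix c i := if i is j.+1 then 2 * d + 4 * (2 * i + k) + c j else 2 * d + 4 * k.
exists c; elim => [|i [ci IH]].
  split; first by rewrite addn_gt0 muln_gt0 d0.
  by rewrite expr1 expr0 mul1r (laplacian_sqnormM k) // h0 mulr0 addr0.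
split; first by rewrite /= addn_gt0 ci orbT.
rewrite exprS -mulrA (laplacian_sqnormM (2 * i.+1 + k)); last exact: sqnormX_homog.
by rewrite IH mulrnAr mulrA -exprS -mulrnDr.
Qed.

(** Each Laplacian lowers the power of |x|^2 by one and the last one meets the harmonic [h]. With
    [j] = 2s this puts |x|^(2i) Y_{k,l}, i < 2s, among the polynomials that the Gauss-Jacobi measure
    integrates exactly. *)
Lemma iter_laplacian_sqnormX k h i j : h \is k.-homog -> laplacian h = 0 ->
  (0 < d)%N -> (i < j)%N -> iter j laplacian (sqnorm ^+ i * h) = 0.
Proof.
move=> hk h0 d0; have [c hc] := laplacian_sqnormX k h hk h0 d0.
have L0 n : iter n laplacian (0 : {mpoly K[d]}) = 0.
  by elim: n => //= n ->; rewrite laplacian0.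
have LM n m p : iter n laplacian (p *+ m) = iter n laplacian p *+ m.
  by elim: n => //= n ->; rewrite -[_ *+ m]scaler_nat laplacianZ scaler_nat.
elim: i j => [|i IH] [//|j] ij; rewrite iterSr.
  by rewrite expr0 mul1r h0 L0.
by rewrite (hc i).2 LM IH ?mul0rn.
Qed.

(** Finite sums of terms |x|^(2i) h with h harmonic and of total degree m. Written as an inductive
    predicate so that the preimage under the Laplacian can be built term by term. *)
Inductive gauss_span : nat -> {mpoly K[d]} -> Prop :=
| gauss_span0 m : gauss_span m 0
| gauss_spanD m i k h p : (2 * i + k = m)%N -> h \is k.-homog ->
    laplacian h = 0 -> gauss_span m p -> gauss_span m (sqnorm ^+ i * h + p).

Lemma gauss_span_homog m p : gauss_span m p -> p \is m.-homog.
Proof.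
elim=> [n|n i k h q <- hk h0 _ hq]; first exact: dhomog0.
by apply: dhomogD => //; apply: sqnormX_homog.
Qed.

(** The Laplacian is onto here: |x|^(2i) h is the image of |x|^(2i+2) h divided by its nonzero
    constant. *)
Lemma gauss_span_laplacian m q : (0 < d)%N -> gauss_span m q ->
  exists2 p, gauss_span m.+2 p & laplacian p = q.
Proof.
move=> d0; elim=> [n|n i k h p nE hk h0 _ [p' sp' p'E]].
  by exists 0; [exact: gauss_span0|exact: laplacian0].
have [c /(_ i)[ci hc]] := laplacian_sqnormX k h hk h0 d0.
exists (sqnorm ^+ i.+1 * ((c i)%:R^-1 *: h) + p').
  apply: (@gauss_spanD _ _ k) => //; last by rewrite laplacianZ h0 scaler0.
    by rewrite mulnS -addnA nE.
  exact: dhomogZ.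
rewrite laplacianD p'E -scalerAr laplacianZ hc -scalerMnr scalerMnl.
rewrite -[_^-1 *+ _]mulr_natr mulVf ?scale1r //.
by rewrite pnatr_eq0 -lt0n.
Qed.

(** Strong induction on the degree: the Laplacian of p is decomposed by induction and lifted to some
    p' in the span with the same Laplacian, and p - p' is harmonic. *)
Lemma homog_gauss_span m p : (0 < d)%N -> p \is m.-homog -> gauss_span m p.
Proof.
move=> d0; elim/ltn_ind: m p => -[|[|m]] IH p hp.
- rewrite -[p]addr0 -[p]mul1r -(expr0 sqnorm).
  apply: (@gauss_spanD _ _ 0) => //; last exact: gauss_span0.
  exact: (laplacian_homog_lt2 0).
- rewrite -[p]addr0 -[p]mul1r -(expr0 sqnorm).
  apply: (@gauss_spanD _ _ 1) => //; last exact: gauss_span0.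
  exact: (laplacian_homog_lt2 1).
have [|p' sp' p'E] := gauss_span_laplacian m (laplacian p) d0.
  by apply: IH => //; apply: laplacian_homog.
rewrite -[p in gauss_span _ p](subrK p') -[p - p']mul1r -(expr0 sqnorm).
apply: (@gauss_spanD _ _ m.+2) => //; last by rewrite laplacianB p'E subrr.
by apply: rpredB => //; apply: gauss_span_homog.
Qed.

Lemma gauss_ind (P : {mpoly K[d]} -> Prop) : (0 < d)%N ->
  P 0 -> (forall p q, P p -> P q -> P (p + q)) ->
  (forall i k h, h \is k.-homog -> laplacian h = 0 -> P (sqnorm ^+ i * h)) ->
  forall p, P p.
Proof.
move=> d0 P0 PD Ph p.
rewrite (@pihomog_partitionE _ _ mdeg (msize p) p) //.
apply: (big_ind P) => // i _.
elim: (homog_gauss_span _ _ d0 (pihomogP mdeg i p)) => // m j k h q _ hk h0 _ Pq.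
by apply: PD => //; apply: (Ph _ k).
Qed.

(** The infinitesimal rotation in the plane of coordinates i and j, a derivation of the polynomial
    ring. *)
Definition rotd i j p : {mpoly K[d]} := 'X_i * p^`M(j) - 'X_j * p^`M(i).

Lemma rotdM i j p q : rotd i j (p * q) = rotd i j p * q + p * rotd i j q.
Proof. by rewrite /rotd !mderivM; ring. Qed.

Lemma mderivXE i j : ('X_j : {mpoly K[d]})^`M(i) = (i == j)%:R.
Proof.
rewrite mderivX mnmE eq_sym; case: eqP => [->|_]; last by rewrite scale0r.
rewrite (_ : (U_(j) - U_(j))%MM = 0%MM) ?mpolyX0 ?scale1r //.
by apply/mnmP => l; rewrite !mnmE subnn.
Qed.

Lemma euler_euler p : \sum_i \sum_j 'X_i * 'X_j * p^`M(i)^`M(j) =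
  euler (euler p) - euler p.
Proof.
rewrite /euler -sumrB; apply: eq_bigr => i _.
rewrite mderiv_sum mulr_sumr.
rewrite (_ : 'X_i * p^`M(i) = \sum_j 'X_i * ((i == j)%:R * p^`M(j))); last first.
  rewrite (bigD1 i) //= eqxx mul1r big1 ?addr0 // => j /negbTE ij.
  by rewrite eq_sym ij mul0r mulr0.
rewrite -sumrB; apply: eq_bigr => j _.
by rewrite mderivM mderivXE (mderiv_comm i j); ring.
Qed.

(** The Casimir identity: |x|^2 times the Laplacian minus E^2 + (d - 2) E, where E is the Euler
    operator. The outer factor 2 comes from summing over ordered pairs. *)
Lemma sum_rotd2 p : \sum_i \sum_j rotd i j (rotd i j p) =
  (sqnorm * laplacian p + euler p *+ 2 - euler p *+ d - euler (euler p)) *+ 2.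
Proof.
have A : \sum_i \sum_j 'X_i * ('X_i * p^`M(j))^`M(j) = euler p + sqnorm * laplacian p.
  rewrite /euler /sqnorm mulr_suml -big_split; apply: eq_bigr => i _ /=.
  rewrite /laplacian [_ ^+ 2 * _]mulr_sumr.
  have E j : 'X_i * ('X_i * p^`M(j))^`M(j) =
      (j == i)%:R * ('X_i * p^`M(j)) + 'X_i ^+ 2 * p^`M(j)^`M(j).
    by rewrite mderivM mderivXE; ring.
  under eq_bigr => j _ do rewrite E.
  rewrite big_split /=; congr (_ + _).
  rewrite (bigD1 i) //= eqxx mul1r big1 ?addr0 // => j /negbTE ij.
  by rewrite ij mul0r.
have B : \sum_i \sum_j 'X_i * ('X_j * p^`M(i))^`M(j) =
    euler p *+ d + (euler (euler p) - euler p).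
  rewrite -euler_euler /euler -sumrMnl -big_split; apply: eq_bigr => i _ /=.
  under eq_bigr => j _ do rewrite mderivM mderivXE eqxx mul1r mulrDr mulrA.
  by rewrite big_split /= sumr_const card_ord.
transitivity (\sum_i \sum_j (
    ('X_i * ('X_i * p^`M(j))^`M(j) + 'X_j * ('X_j * p^`M(i))^`M(i))
    - ('X_i * ('X_j * p^`M(i))^`M(j) + 'X_j * ('X_i * p^`M(j))^`M(i)))).
  by apply: eq_bigr => i _; apply: eq_bigr => j _; rewrite /rotd !mderivB; ring.
under eq_bigr => i _ do rewrite sumrB !big_split /=.
rewrite sumrB !big_split /= A B.
rewrite [X in _ + X - _]exchange_big /= A.
rewrite [X in _ - (_ + X)]exchange_big /= B.
ring.
Qed.

Lemma sum_rotd2_harmonic k p : (2 <= d)%N -> p \is k.-homog -> laplacian p = 0 ->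
  \sum_i \sum_j rotd i j (rotd i j p) = - (p *+ (2 * k * (k + d - 2))).
Proof.
move=> d2 hk h0; rewrite sum_rotd2 h0 (euler_homog _ _ hk).
have -> : euler (p *+ k) = p *+ k *+ k.
  by rewrite (euler_homog k) //; rewrite -scaler_nat; apply: dhomogZ.
rewrite mulr0 add0r -addnBA //.
have -> : p *+ k *+ d = p *+ k *+ (d - 2 + 2) by rewrite subnK.
move: (d - 2)%N => e; ring.
Qed.

End harmonic_algebra.

(** * Borel measurability in coordinates *)

Section borel_row_vectors.
Context {R : realType}.

(** Open cubes with rational centre and radius 1/(m+1): a countable base of the topology. *)
Definition rat_ball {n} (z : 'rV[rat]_n * nat) : set 'rV[R]_n :=
  [set y | forall i, `|ratr (z.1 0 i) - y 0 i| < z.2.+1%:R^-1].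

Lemma open_rat_ball n (U : set 'rV[R]_n) x : open U -> U x ->
  exists2 z, rat_ball z x & rat_ball z `<=` U.
Proof.
rewrite openE => /(_ x) /[apply] /nbhs_ballP[e /= e0 eU].
pose k := Num.truncn (2 / e).
have ke : k.+1%:R^-1 < e / 2.
  rewrite invf_plt ?posrE ?divr_gt0 // invf_div.
  by have /andP[] := truncn_itv (ltW (divr_gt0 (ltr0n _ 2) e0)).
have xk i : x 0 i - k.+1%:R^-1 < x 0 i + k.+1%:R^-1.
  by rewrite ltrBlDr -addrA ltrDl addr_gt0 // invr_gt0.
pose q i : rat := sval (cid (rat_in_itvoo (xk i))).
have hq i : `|ratr (q i) - x 0 i| < k.+1%:R^-1.
  rewrite /q; case: (cid _) => r /=; rewrite in_itv /= ltr_norml => /andP[a b].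
  by rewrite ltrBrDr addrC a /= ltrBlDl.
exists (\row_i q i, k); first by move=> i; rewrite mxE.
move=> y hy; apply: eU; split => // i j; rewrite ord1.
have := hy j; rewrite /= mxE /ball /= => hyj.
rewrite (splitr e) -(subrK (ratr (q j)) (x 0 j)) -addrA.
rewrite (le_lt_trans (ler_normD _ _)) // ltrD //.
  by rewrite distrC (lt_trans (hq j)).
exact: lt_trans hyj ke.
Qed.

Lemma measurable_rat_ball {disp} {T : measurableType disp} n
    (f : T -> 'rV[R]_n) z : (forall i, measurable_fun setT (fun x => f x 0 i)) ->
  measurable (f @^-1` rat_ball z).
Proof.
move=> mf.
rewrite (_ : _ @^-1` _ = \bigcap_(i in [set: 'I_n])
   ((fun x => f x 0 i) @^-1` (ball (ratr (z.1 0 i) : R) z.2.+1%:R^-1))); last first.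
  by apply/seteqP; split=> x /= h i; [move=> _; exact: h|exact: (h i I)].
apply: fin_bigcap_measurable => [|i _]; first exact: finite_finset.
rewrite -[X in measurable X]setTI; apply: mf => //.
exact: measurable_ball.
Qed.

(** The Borel sets are generated by the open sets, and each open set is a countable union of
    rational cubes, whose preimages are cut out by the coordinates. *)
Lemma measurable_rV {disp} {T : measurableType disp} n (f : T -> borel_rV R n) :
  (forall i, measurable_fun setT (fun x => (f x : 'rV[R]_n) 0 i)) ->
  measurable_fun setT f.
Proof.
move=> mf; apply: (@measurability _ _ T (borel_rV R n) setT f (@open 'rV[R]_n)) => //.
move=> _ [U oU <-]; rewrite setTI.
rewrite (_ : f @^-1` U = \bigcup_z (if pselect (rat_ball z `<=` U) then
    f @^-1` rat_ball z else set0)); last first.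
  apply/seteqP; split=> [x /= Ux|x [z _]].
    have [z zx zU] := open_rat_ball n U (f x) oU Ux.
    by exists z => //; case: pselect.
  by case: pselect => // zU; exact: zU.
apply: countable_bigcupT_measurable => [|z]; first exact: countableP.
by case: (pselect _) => [zU|_] /=; [exact: measurable_rat_ball|exact: measurable0].
Qed.

Lemma measurable_open_rV n (U : set 'rV[R]_n) : open U ->
  measurable (U : set (borel_rV R n)).
Proof. by move=> oU; apply: sub_sigma_algebra. Qed.

Lemma measurable_closed_rV n (U : set 'rV[R]_n) : closed U ->
  measurable (U : set (borel_rV R n)).
Proof.
by move=> /closed_openC /(measurable_open_rV n) /measurableC; rewrite setCK.
Qed.

Lemma continuous_measurable_rV n (g : 'rV[R]_n -> R) : continuous g ->
  measurable_fun setT (g : borel_rV R n -> R).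
Proof.
move=> /continuousP cg.
apply: (@measurability _ _ (borel_rV R n) R setT g (@RGenOpens.G R)).
  exact: RGenOpens.measurableE.
move=> _ [_ [a [b ->]] <-]; rewrite setTI; apply: measurable_open_rV; apply: cg.
exact: interval_open.
Qed.

Lemma measurable_coord n (i : 'I_n) :
  measurable_fun setT (fun x : borel_rV R n => (x : 'rV[R]_n) 0 i).
Proof. apply: continuous_measurable_rV; exact: coord_continuous. Qed.

End borel_row_vectors.

(** * Lebesgue measure on row vectors *)

(** An alias of [m] that carries a proof of sigma-finiteness, so that the sigma-finite structure can
    be inferred for a measure known only through an existence statement. *)
Definition sigma_finite_of {disp : measure_display} {T : measurableType disp}
  {R : realType} (m : {measure set T -> \bar R}) (sm : sigma_finite setT m) :
  set T -> \bar R := m.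

Section sigma_finite_of.
Context {disp : measure_display} {T : measurableType disp} {R : realType}.
Variables (m : {measure set T -> \bar R}) (sm : sigma_finite setT m).
HB.instance Definition _ := Measure.copy (sigma_finite_of m sm) (Measure.sort m).
HB.instance Definition _ :=
  Measure_isSigmaFinite.Build _ _ _ (sigma_finite_of m sm) sm.
End sigma_finite_of.

Section lebesgue_row_vectors.
Context {R : realType}.

Definition rvcons {n} (t : R) (y : 'rV[R]_n) : 'rV[R]_n.+1 :=
  row_mx (const_mx t : 'rV[R]_1) y.

Lemma rvcons0 n t (y : 'rV[R]_n) : rvcons t y 0 ord0 = t.
Proof.
rewrite /rvcons mxE; case: splitP => j; first by rewrite mxE.
by move=> /eqP; rewrite -[_ == _]/(0 == 1 + j)%N.
Qed.

Lemma rvconsS n t (y : 'rV[R]_n) i : rvcons t y 0 (lift ord0 i) = y 0 i.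
Proof.
rewrite /rvcons mxE; case: splitP => j.
  by case: j => -[].
by rewrite lift0 add1n => -[/val_inj <-].
Qed.

Lemma rvcons_eta n (x : 'rV[R]_n.+1) :
  rvcons (x 0 ord0) (\row_i x 0 (lift ord0 i)) = x.
Proof.
apply/rowP => i; case: (unliftP ord0 i) => [j ->|->].
  by rewrite rvconsS mxE.
by rewrite rvcons0.
Qed.

Lemma measurable_rvcons n : measurable_fun setT
  (fun p : measurableTypeR R * borel_rV R n => rvcons p.1 p.2 : borel_rV R n.+1).
Proof.
apply: measurable_rV => i; case: (unliftP ord0 i) => [j ->|->].
  rewrite (_ : (fun _ => _) = (fun x : borel_rV R n => (x : 'rV[R]_n) 0 j) \o snd).
    by apply: measurableT_comp; [exact: measurable_coord|exact: measurable_snd].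
  by apply/funext => p /=; rewrite rvconsS.
rewrite (_ : (fun _ => _) = fst); first exact: measurable_fst.
by apply/funext => p /=; rewrite rvcons0.
Qed.

Lemma measurable_rvuncons n : measurable_fun setT
  (fun x : borel_rV R n.+1 => ((x : 'rV[R]_n.+1) 0 ord0,
     \row_i (x : 'rV[R]_n.+1) 0 (lift ord0 i)) : measurableTypeR R * borel_rV R n).
Proof.
apply/measurable_fun_pairP; split; first exact: measurable_coord.
apply: measurable_rV => i.
rewrite (_ : (fun _ => _) = (fun x : borel_rV R n.+1 => (x : 'rV[R]_n.+1) 0 (lift ord0 i))).
  exact: measurable_coord.
by apply/funext => x /=; rewrite mxE.
Qed.

Lemma lebesgue_rV_product n (L : set (borel_rV R n) -> \bar R) A :
  (forall B, L B = lebesgue_rV B) ->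
  lebesgue_rV A = (@lebesgue_measure R \x L)%E
    ((fun p : measurableTypeR R * borel_rV R n => rvcons p.1 p.2) @^-1` A).
Proof.
move=> LE; apply: eq_integral => t _ /=; rewrite LE; congr lebesgue_rV.
by apply/seteqP; split=> y /=; rewrite /xsection /= inE.
Qed.

(** By induction on the dimension: the defining integral over sections is the image of a product
    measure under [rvcons]. Sigma-finiteness travels along the inverse map, which splits off the
    first coordinate. *)
Lemma lebesgue_rV_measure n :
  exists L : {sigma_finite_measure set (borel_rV R n) -> \bar R},
    forall A, L A = lebesgue_rV A.
Proof.
elim: n => [|n [L LE]].
  by exists (dirac (0 : borel_rV R 0)).
pose f (p : measurableTypeR R * borel_rV R n) : borel_rV R n.+1 := rvcons p.1 p.2.
have mf : measurable_fun setT f := measurable_rvcons n.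
pose l1 : {sigma_finite_measure set (measurableTypeR R) -> \bar R} := @lebesgue_measure R.
pose P : {measure set (measurableTypeR R * borel_rV R n)%type -> \bar R} :=
  [the {measure set _ -> \bar R} of product_measure1 l1 L].
have [F FT hF] : sigma_finite setT P.
  have /sigma_finiteP[F [TF ndF Foo]] := sigma_finiteT l1.
  have /sigma_finiteP[G [TG ndG Goo]] := sigma_finiteT L.
  exists (fun k => F k `*` G k).
    rewrite -setXTT TF TG predeqE => -[x y]; split.
      move=> [/= [k _ Fnx] [l _ Gky]]; exists (maxn k l) => //; split.
      - by move: x Fnx; exact/subsetPset/ndF/leq_maxl.
      - by move: y Gky; exact/subsetPset/ndG/leq_maxr.
    by move=> [k _ []/= ? ?]; split; exists k.
  move=> k; have [? ?] := Foo k; have [? ?] := Goo k.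
  split; first exact: measurableX.
  by rewrite /P /= product_measure1E // lte_mul_pinfty // ge0_fin_numE.
have [M ME] : exists M : {measure set (borel_rV R n.+1) -> \bar R},
    forall A, M A = P (f @^-1` A) by exists (image_measure P mf).
have sM : sigma_finite setT M.
  exists (fun k => (fun x : borel_rV R n.+1 => ((x : 'rV[R]_n.+1) 0 ord0,
     \row_i (x : 'rV[R]_n.+1) 0 (lift ord0 i)) : measurableTypeR R * borel_rV R n) @^-1` F k).
    by rewrite -preimage_bigcup -FT preimage_setT.
  move=> k; have [mFk Fk] := hF k; split.
    by rewrite -[X in measurable X]setTI; exact: measurable_rvuncons.
  rewrite ME -comp_preimage.
  rewrite (_ : _ \o f = id) ?preimage_id //.
  apply/funext => -[t y]; rewrite /f /= rvcons0; congr pair.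
  by apply/rowP => i; rewrite mxE rvconsS.
exists (sigma_finite_of M sM) => A.
by rewrite (lebesgue_rV_product n L) // -ME.
Qed.

End lebesgue_row_vectors.

(** * Invariance of Lebesgue measure under translations and shears *)

Section lebesgue_invariance.
Context {R : realType}.

Lemma measurable_translation (v : R) :
  measurable_fun setT (fun t : measurableTypeR R => t + v : measurableTypeR R).
Proof. by apply: measurable_funD => //; exact: measurable_cst. Qed.

Lemma lebesgue_translation (v : R) (A : set (measurableTypeR R)) : measurable A ->
  lebesgue_measure [set t | A (t + v)] = lebesgue_measure A.
Proof.
move=> mA; rewrite -[LHS]/(image_measure lebesgue_measure (measurable_translation v) A).
apply/esym/lebesgue_measure_unique => // _ [[a b]] _ <-.
rewrite image_measureE /=.
rewrite (_ : _ @^-1` _ = `]a - v, b - v]%classic); last first.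
  by apply/seteqP; split=> x /=; rewrite !in_itv /= ltrBlDr lerBrDr.
rewrite !lebesgue_measure_itv /= !lte_fin ltrD2r -!EFinB; case: ifP => // _; congr EFin; ring.
Qed.

Lemma ge0_integral_translation (v : R) (f : measurableTypeR R -> \bar R) :
  measurable_fun setT f -> (forall t, (0 <= f t)%E) ->
  (\int[lebesgue_measure]_t f (t + v)%R = \int[lebesgue_measure]_t f t)%E.
Proof.
move=> mf f0.
have := @ge0_integral_pushforward _ _ _ _ R _ (measurable_translation v)
  lebesgue_measure setT f measurableT mf (fun t _ => f0 t).
rewrite preimage_setT => <-.
rewrite -[LHS]/(\int[image_measure lebesgue_measure (measurable_translation v)]_y f y)%E.
by apply: eq_measure_integral => A mA _; exact: lebesgue_translation.
Qed.

Lemma measurable_rvconsr n (t : R) : measurable_fun setT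
  (fun y : borel_rV R n => rvcons t y : borel_rV R n.+1).
Proof.
apply: measurable_rV => i; case: (unliftP ord0 i) => [j ->|->].
  by under eq_fun do rewrite rvconsS; exact: measurable_coord.
by under eq_fun do rewrite rvcons0; exact: measurable_cst.
Qed.

Lemma measurable_rvconsl n (y : 'rV[R]_n) : measurable_fun setT
  (fun t : measurableTypeR R => rvcons t y : borel_rV R n.+1).
Proof.
apply: measurable_rV => i; case: (unliftP ord0 i) => [j ->|->].
  by under eq_fun do rewrite rvconsS; exact: measurable_cst.
by under eq_fun do rewrite rvcons0; exact: measurable_id.
Qed.

Lemma measurable_preimage {d1 d2 : measure_display} {T1 : measurableType d1}
    {T2 : measurableType d2} (f : T1 -> T2) A : measurable_fun setT f ->
  measurable A -> measurable (f @^-1` A).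
Proof. by move=> mf mA; rewrite -[X in measurable X]setTI; exact: mf. Qed.

Lemma measurable_lebesgue_section n (A : set (borel_rV R n.+1)) : measurable A ->
  measurable_fun setT (fun t : measurableTypeR R =>
    @lebesgue_rV R n [set y | A (rvcons t y)]).
Proof.
move=> mA; have [L LE] := @lebesgue_rV_measure R n.
have := measurable_fun_xsection L (measurable_preimage _ _ (measurable_rvcons n) mA).
congr measurable_fun; apply/funext => t /=; rewrite LE; congr lebesgue_rV.
by apply/seteqP; split=> y /=; rewrite /xsection /= inE.
Qed.

Lemma lebesgue_rV_ge0 n (A : set (borel_rV R n)) : (0 <= lebesgue_rV A)%E.
Proof. by have [L LE] := @lebesgue_rV_measure R n; rewrite -LE. Qed.

Lemma rvconsD n t u (y z : 'rV[R]_n) : rvcons t y + rvcons u z = rvcons (t + u) (y + z).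
Proof.
apply/rowP => i; rewrite mxE; case: (unliftP ord0 i) => [j ->|->].
  by rewrite !rvconsS mxE.
by rewrite !rvcons0.
Qed.

Lemma lebesgue_rV_translation n (v : 'rV[R]_n) (A : set (borel_rV R n)) :
  measurable A -> lebesgue_rV [set x : 'rV[R]_n | A (x + v)] = lebesgue_rV A.
Proof.
elim: n v A => [|n IH] v A mA.
  congr lebesgue_rV; apply/seteqP.
  by split=> x /=; rewrite (_ : x + v = x) //; apply/rowP => -[].
rewrite -[v]rvcons_eta; set v0 := v 0 ord0; set v' := \row_i _.
transitivity (\int[lebesgue_measure]_t
    (fun t => lebesgue_rV [set y : 'rV[R]_n | A (rvcons t y)]) (t + v0)%R)%E.
  apply: eq_integral => t _ /=.
  rewrite -(IH v'); last exact: measurable_preimage (measurable_rvconsr n _) mA.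
  congr lebesgue_rV; apply/seteqP; split=> y /=.
    by rewrite -/(rvcons t y) rvconsD.
  by rewrite -/(rvcons t y) rvconsD.
apply: ge0_integral_translation; first exact: measurable_lebesgue_section.
by move=> t; exact: lebesgue_rV_ge0.
Qed.

Definition shear {n} (i j : 'I_n) (a : R) (x : 'rV[R]_n) : 'rV[R]_n :=
  x + (a * x 0 j) *: delta_mx 0 i.

Lemma shearE n (i j : 'I_n) a x l :
  shear i j a x 0 l = x 0 l + (a * x 0 j) * (l == i)%:R.
Proof. by rewrite /shear !mxE eqxx. Qed.

Lemma measurable_shear n (i j : 'I_n) a : measurable_fun setT
  (shear i j a : borel_rV R n -> borel_rV R n).
Proof.
apply: measurable_rV => l.
under eq_fun do rewrite shearE.
apply: measurable_funD; first exact: measurable_coord.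
apply: measurable_funM; last exact: measurable_cst.
by apply: measurable_funM; [exact: measurable_cst|exact: measurable_coord].
Qed.

(** The definition singles out the first coordinate, hence the cases. If neither i nor j is the
    first one, the shear acts on each section and induction applies. If j is the first one, each
    section is translated by a fixed vector. If i is the first one, the order of integration is
    exchanged, and for fixed y the shear is a translation of the line. *)
Lemma lebesgue_rV_shear n (i j : 'I_n) a (A : set (borel_rV R n)) : i != j ->
  measurable A -> lebesgue_rV [set x | A (shear i j a x)] = lebesgue_rV A.
Proof.
elim: n i j A => [[]//|n IH] i j A ij mA.
have [L LE] := @lebesgue_rV_measure R n.
case: (unliftP ord0 i) ij => [i' ->|->]; case: (unliftP ord0 j) => [j' ->|->] ij.
- have ij' : i' != j' by apply: contraNneq ij => ->.
  apply: eq_integral => t _ /=.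
  have mt : measurable [set y : borel_rV R n | A (rvcons t y)].
    exact: measurable_preimage (measurable_rvconsr n _) mA.
  rewrite -[RHS](IH i' j' [set y | A (rvcons t y)] ij' mt).
  have e y : shear (lift ord0 i') (lift ord0 j') a (rvcons t y) =
      rvcons t (shear i' j' a y).
    apply/rowP => l; rewrite shearE; case: (unliftP ord0 l) => [m ->|->].
      by rewrite !rvconsS shearE (inj_eq lift_inj).
    by rewrite !rvcons0 mulr0 addr0.
  by congr lebesgue_rV; apply/seteqP; split=> y /=; rewrite -/(rvcons t y) e.
- apply: eq_integral => t _ /=.
  rewrite -[RHS](lebesgue_rV_translation n ((a * t) *: delta_mx 0 i')
     [set y | A (rvcons t y)]); last first.
    exact: measurable_preimage (measurable_rvconsr n _) mA.
  have e y : shear (lift ord0 i') ord0 a (rvcons t y) =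
      rvcons t (y + (a * t) *: delta_mx 0 i').
    apply/rowP => l; rewrite shearE; case: (unliftP ord0 l) => [m ->|->].
      by rewrite !rvconsS rvcons0 !mxE eqxx (inj_eq lift_inj).
    by rewrite !rvcons0 mulr0 addr0.
  by congr lebesgue_rV; apply/seteqP; split=> y /=; rewrite -/(rvcons t y) e.
- pose l1 : {sigma_finite_measure set (measurableTypeR R) -> \bar R} :=
    @lebesgue_measure R.
  pose m2 : {measure set (measurableTypeR R * borel_rV R n)%type -> \bar R} :=
    [the {measure set _ -> \bar R} of product_measure2 l1 L].
  (* Uniqueness of the product measure, that is, the exchange of the two integrations. *)
  have E B : measurable B -> (l1 \x L)%E B = (l1 \x^ L)%E B.
    move=> mB; apply: (@product_measure_unique _ _ _ _ R l1 L m2) => // C D mC mD.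
    exact: product_measure2E.
  have mS : measurable [set x : borel_rV R n.+1 | A (shear ord0 (lift ord0 j') a x)].
    exact: measurable_preimage (measurable_shear n.+1 _ _ _) mA.
  rewrite !(lebesgue_rV_product n L) // E; last first.
    exact: measurable_preimage (measurable_rvcons n) mS.
  rewrite E; last exact: measurable_preimage (measurable_rvcons n) mA.
  apply: eq_integral => y _ /=.
  have mAy : measurable [set t : measurableTypeR R | A (rvcons t y)].
    exact: measurable_preimage (measurable_rvconsl n y) mA.
  have e t : shear ord0 (lift ord0 j') a (rvcons t y) =
      rvcons (t + a * (y : 'rV[R]_n) 0 j') y.
    apply/rowP => l; rewrite shearE; case: (unliftP ord0 l) => [m ->|->].
      by rewrite !rvconsS mulr0 addr0.
    by rewrite !rvcons0 !rvconsS mulr1.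
  transitivity (lebesgue_measure [set t | [set t | A (rvcons t y)]
      (t + a * (y : 'rV[R]_n) 0 j')]).
    congr lebesgue_measure; apply/seteqP.
    by split=> t /=; rewrite /ysection /= inE /= e.
  rewrite lebesgue_translation //; congr lebesgue_measure; apply/seteqP.
  by split=> t /=; rewrite /ysection /= inE.
- by rewrite eqxx in ij.
Qed.

End lebesgue_invariance.

(** * Polynomial functions: continuity, bounds, first-order Taylor expansion *)

Section polynomial_functions.
Context {R : realType} {d : nat}.
Implicit Types (p q : {mpoly R[d]}) (x h : 'rV[R]_d).

Lemma mpoly_ring_ind (P : {mpoly R[d]} -> Prop) : P 1 ->
  (forall p q, P p -> P q -> P (p + q)) -> (forall c p, P p -> P (c *: p)) ->
  (forall i p, P p -> P ('X_i * p)) -> forall p, P p.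
Proof.
move=> P1 PD PZ PX p; rewrite (mpolyE p).
have P0 : P 0 by rewrite -(scale0r 1); exact: PZ.
apply: (big_ind P) => // m _; apply: PZ.
rewrite -['X_[m]]mulr1 mpolyXE_id.
have : forall q, P q -> P ((\prod_(i < d) 'X_i ^+ m i) * q).
  apply: (big_ind (fun r => forall q, P q -> P (r * q))).
  - by move=> q; rewrite mul1r.
  - by move=> r1 r2 h1 h2 q /h2 /h1; rewrite mulrA.
  - move=> i _; elim: (m i) => [|k IH] q hq; first by rewrite expr0 mul1r.
    by rewrite exprS -mulrA; apply/PX/IH.
exact.
Qed.

Lemma rpevalD p q x : rpeval (p + q) x = rpeval p x + rpeval q x.
Proof. exact: mevalD. Qed.

Lemma rpevalM p q x : rpeval (p * q) x = rpeval p x * rpeval q x.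
Proof. exact: mevalM. Qed.

Lemma rpevalZ c p x : rpeval (c *: p) x = c * rpeval p x.
Proof. exact: mevalZ. Qed.

Lemma rpeval0 x : rpeval 0 x = 0.
Proof. exact: meval0. Qed.

Lemma rpeval1 x : rpeval 1 x = 1.
Proof. exact: meval1. Qed.

Lemma rpevalX i x : rpeval 'X_i x = x 0 i.
Proof. exact: mevalXU. Qed.

Lemma rpevalB p q x : rpeval (p - q) x = rpeval p x - rpeval q x.
Proof. exact: mevalB. Qed.

Lemma rpeval_sum (I : Type) (r : seq I) (P : pred I) (F : I -> {mpoly R[d]}) x :
  rpeval (\sum_(i <- r | P i) F i) x = \sum_(i <- r | P i) rpeval (F i) x.
Proof. by elim/big_rec2: _ => [|i y p _ <-]; [exact: rpeval0|exact: rpevalD]. Qed.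

Lemma continuous_rpeval p : continuous (rpeval p).
Proof.
elim/mpoly_ring_ind: p => [|p q hp hq|c p hp|i p hp] x.
- by rewrite (_ : rpeval 1 = cst 1); [exact: cst_continuous|apply/funext => y; exact: rpeval1].
- rewrite (_ : rpeval (p + q) = fun y => rpeval p y + rpeval q y).
    exact: cvgD (hp x) (hq x).
  by apply/funext => y; exact: rpevalD.
- rewrite (_ : rpeval (c *: p) = fun y => c * rpeval p y).
    by apply: cvgM (hp x); exact: cvg_cst.
  by apply/funext => y; exact: rpevalZ.
- rewrite (_ : rpeval ('X_i * p) = fun y => y 0 i * rpeval p y).
    by apply: cvgM (hp x); exact: coord_continuous.
  by apply/funext => y; rewrite rpevalM rpevalX.
Qed.

Lemma measurable_rpeval p : measurable_fun setT (rpeval p : borel_rV R d -> R).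
Proof. by apply: continuous_measurable_rV; exact: continuous_rpeval. Qed.

Lemma rpeval_bounded M p : exists2 B, 0 <= B &
  forall x, (forall i, `|x 0 i| <= M) -> `|rpeval p x| <= B.
Proof.
elim/mpoly_ring_ind: p => [|p q [B B0 hB] [C C0 hC]|c p [B B0 hB]|i p [B B0 hB]].
- by exists 1 => // x _; rewrite rpeval1 normr1.
- exists (B + C); first exact: addr_ge0.
  move=> x hx; rewrite rpevalD (le_trans (ler_normD _ _)) // lerD //.
    exact: hB.
  exact: hC.
- exists (`|c| * B); first exact: mulr_ge0.
  by move=> x hx; rewrite rpevalZ normrM ler_wpM2l // hB.
- exists (`|M| * B); first exact: mulr_ge0.
  move=> x hx; rewrite rpevalM rpevalX normrM ler_pM //; last exact: hB.
  exact: le_trans (hx i) (ler_norm _).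
Qed.

(** Uniform over the unit cube, which contains the sphere. The bound 4 on the increments is what a
    rotation with parameter t <= 1 requires in [sphere_int_rotd]. *)
Lemma rpeval_taylor p : exists2 C, 0 <= C & forall x h, (forall i, `|x 0 i| <= 1) ->
  (forall i, `|h 0 i| <= 4) ->
  `|rpeval p (x + h) - rpeval p x - \sum_i h 0 i * rpeval (mderiv i p) x|
    <= C * (\sum_i `|h 0 i|) ^+ 2.
Proof.
elim/mpoly_ring_ind: p => [|p q [B B0 hB] [C C0 hC]|c p [B B0 hB]|i p [B B0 hB]].
- exists 0 => [|x h _ _]; first exact: lexx.
  rewrite !rpeval1 subrr sub0r normrN big1 ?normr0 ?mul0r //.
  by move=> i _; rewrite (mderivC i 1) rpeval0 mulr0.
- exists (B + C) => [|x h hx hh]; first exact: addr_ge0.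
  rewrite mulrDl (le_trans _ (lerD (hB x h hx hh) (hC x h hx hh))) //.
  rewrite (le_trans _ (ler_normD _ _)) // !rpevalD.
  under eq_bigr do rewrite mderivD rpevalD mulrDr.
  rewrite big_split /= le_eqVlt; apply/orP; left; apply/eqP; congr (`|_|); ring.
- exists (`|c| * B) => [|x h hx hh]; first exact: mulr_ge0.
  rewrite -mulrA (le_trans _ (ler_wpM2l (normr_ge0 c) (hB x h hx hh))) //.
  rewrite -normrM !rpevalZ.
  under eq_bigr do rewrite mderivZ rpevalZ mulrCA.
  by rewrite -mulr_sumr !mulrBr.
- have /fin_all_exists2[D D0 hD] l := rpeval_bounded 1 (mderiv l p).
  (* The remainder for X_i p is (x_i + h_i) times the remainder for p, where |x_i + h_i| <= 1 + 4,
     plus h_i times the linear term of p, which is quadratic in h. *)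
  exists (5 * B + \sum_l D l) => [|x h hx hh].
    by rewrite addr_ge0 ?mulr_ge0 // sumr_ge0.
  set N := \sum_l `|h 0 l|.
  have hN l : `|h 0 l| <= N.
    by rewrite /N (bigD1 l) //= lerDl sumr_ge0.
  set dp := \sum_l h 0 l * rpeval (mderiv l p) x.
  have dpN : `|dp| <= N * \sum_l D l.
    rewrite (le_trans (ler_norm_sum _ _ _)) // mulr_sumr ler_sum // => l _.
    by rewrite normrM ler_pM // hD.
  have -> : \sum_l h 0 l * rpeval (mderiv l ('X_i * p)) x =
      h 0 i * rpeval p x + x 0 i * dp.
    rewrite /dp mulr_sumr.
    rewrite (_ : h 0 i * _ = \sum_l h 0 l * ((l == i)%:R * rpeval p x)); last first.
      rewrite (bigD1 i) //= eqxx mul1r big1 ?addr0 // => l /negbTE ->.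
      by rewrite mul0r mulr0.
    rewrite -big_split /=; apply: eq_bigr => l _.
    rewrite mderivM rpevalD !rpevalM rpevalX mderivXE.
    by case: (l == i); rewrite ?mulr1n ?mulr0n ?rpeval1 ?rpeval0; ring.
  rewrite !rpevalM !rpevalX mxE.
  rewrite (_ : _ - _ = (x 0 i + h 0 i) * (rpeval p (x + h) - rpeval p x - dp)
                       + h 0 i * dp); last by ring.
  rewrite (le_trans (ler_normD _ _)) // [leRHS]mulrDl lerD //.
    rewrite normrM -mulrA ler_pM //; last exact: hB.
    rewrite (le_trans (ler_normD _ _)) // (_ : 5 = 1 + 4) ?lerD //; by ring.
  by rewrite normrM expr2 [leRHS]mulrC -mulrA ler_pM.
Qed.

End polynomial_functions.

(** * The surface measure of the sphere *)

Section surface.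
Context {R : realType} {d : nat}.
Implicit Types (p q : {mpoly R[d]}) (x : 'rV[R]_d).

Lemma enorm_ge0 x : 0 <= enorm x. Proof. exact: sqrtr_ge0. Qed.

Lemma enorm_sqr x : enorm x ^+ 2 = \sum_(i < d) x 0 i ^+ 2.
Proof. by rewrite sqr_sqrtr // sumr_ge0 // => i _; rewrite sqr_ge0. Qed.

Lemma coord_le_enorm x i : `|x 0 i| <= enorm x.
Proof.
rewrite -sqrtr_sqr ler_sqrt ?sumr_ge0 // => [|j _]; last exact: sqr_ge0.
by rewrite (bigD1 i) //= lerDl sumr_ge0 // => j _; exact: sqr_ge0.
Qed.

Lemma enormZ (a : R) x : enorm (a *: x) = `|a| * enorm x.
Proof.
rewrite /enorm -sqrtr_sqr -sqrtrM ?sqr_ge0 // mulr_sumr.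
by congr Num.sqrt; apply: eq_bigr => i _; rewrite mxE exprMn.
Qed.

Lemma enorm_eq0 x : enorm x = 0 -> x = 0.
Proof.
move=> x0; apply/rowP => i; rewrite mxE; apply/eqP; rewrite -normr_le0.
by apply: le_trans (coord_le_enorm x i) _; rewrite x0.

Qed.

Lemma enorm_direction x : 0 < enorm x -> enorm (direction x) = 1.
Proof.
move=> x0; rewrite enormZ ger0_norm ?invr_ge0 ?enorm_ge0 // mulVf //.
by rewrite gt_eqF.
Qed.

Lemma continuous_enorm : continuous (@enorm R d).
Proof.
move=> x; apply: (@continuous_comp _ _ _ (fun y : 'rV[R]_d => \sum_(i < d) y 0 i ^+ 2)).
  move: x; apply: continuous_big => [|i _ y]; first exact: add_continuous.
  apply: (@continuous_comp _ _ _ (fun z : 'rV[R]_d => z 0 i) (fun t => t ^+ 2)).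
    exact: coord_continuous.
  exact: exprn_continuous.
exact: sqrt_continuous.
Qed.

Lemma measurable_enorm : measurable_fun setT (enorm : borel_rV R d -> R).
Proof. by apply: continuous_measurable_rV; exact: continuous_enorm. Qed.

Lemma measurable_direction :
  measurable_fun setT (direction : borel_rV R d -> borel_rV R d).
Proof.
apply: measurable_rV => i.
rewrite (_ : (fun _ => _) = fun x : borel_rV R d => enorm x `^ (-1) * (x : 'rV[R]_d) 0 i).
  apply: measurable_funM; last exact: measurable_coord.
  rewrite (_ : (fun _ => _) = (fun t : R => t `^ (-1)) \o (enorm : borel_rV R d -> R)) //.
  by apply: measurableT_comp; [exact: measurable_powR|exact: measurable_enorm].
by apply/funext => x; rewrite mxE powR_inv1 // enorm_ge0.
Qed.

Lemma measurable_usphere : measurable (@usphere R d : set (borel_rV R d)).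
Proof.
rewrite (_ : usphere = enorm @^-1` [set 1]) //.
exact: (measurable_preimage _ _ measurable_enorm (measurable_set1 _)).
Qed.

Lemma measurable_cube n :
  measurable [set x : borel_rV R n | forall i, (`|(x : 'rV[R]_n) 0 i| <= 1)%R].
Proof.
rewrite (_ : [set y | _] = \bigcap_(i in [set: 'I_n])
   ((fun y : borel_rV R n => (y : 'rV[R]_n) 0 i) @^-1` `[-1, 1]%classic)).
  apply: fin_bigcap_measurable => [|i _]; first exact: finite_finset.
  exact: (measurable_preimage _ _ (measurable_coord n i) (measurable_itv _)).
apply/seteqP; split=> y /= h i; last by have := h i I; rewrite /= in_itv /= ler_norml.
by move=> _ /=; rewrite in_itv /= -ler_norml.
Qed.

Lemma lebesgue_rV_cube n : (lebesgue_rV [set x : 'rV[R]_n | forall i, (`|x 0 i| <= 1)%R] < +oo)%E.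
Proof.
elim: n => [|n IH].
  by rewrite /= ltry.
have [L LE] := @lebesgue_rV_measure R n.
pose l1 : {measure set (measurableTypeR R) -> \bar R} := @lebesgue_measure R.
rewrite (lebesgue_rV_product n L) //.
rewrite (_ : _ @^-1` _ = `[-1, 1]%classic `*` [set y : 'rV[R]_n | forall i, (`|y 0 i| <= 1)%R]).
  rewrite (@product_measure1E _ _ _ _ R l1 L) //.
    have -> : l1 `[-1, 1]%classic = 2%:E.
      rewrite -[LHS]/(lebesgue_measure _) lebesgue_measure_itv /= lte_fin.
      by rewrite ifT ?ltrN10 // -EFinB opprK.
    by rewrite LE lte_mul_pinfty.
  exact: measurable_cube.
apply/seteqP; split=> -[t y] /=.
  move=> h; split => [|i]; last by have := h (lift ord0 i); rewrite rvconsS.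
  by have := h ord0; rewrite rvcons0 in_itv /= ler_norml.
move=> [t1 h] i; case: (unliftP ord0 i) => [j ->|->]; first by rewrite rvconsS.
by rewrite rvcons0; move: t1; rewrite in_itv /= ler_norml.
Qed.

Definition punctured_ball : set 'rV[R]_d := [set x | 0 < enorm x <= 1].

Lemma measurable_punctured_ball : measurable (punctured_ball : set (borel_rV R d)).
Proof.
rewrite (_ : punctured_ball = enorm @^-1` `]0, 1]%classic).
  exact: (measurable_preimage _ _ measurable_enorm (measurable_itv _)).
by apply/seteqP; split=> x /=; rewrite in_itv.
Qed.

(** It is d times the image under [direction] of Lebesgue measure on the punctured unit ball; the
    mass is finite because the ball lies in a cube. All later statements use a bundled measure [S]
    equal to it. *)
Lemma surface_measureE : exists S : {measure set (borel_rV R d) -> \bar R},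
  [/\ forall B, surface_measure B = S B, (S setT < +oo)%E & concentrated S usphere].
Proof.
have [L LE] := @lebesgue_rV_measure R d.
pose k : {nonneg R} := NngNum (ler0n R d).
pose S : {measure set (borel_rV R d) -> \bar R} := mscale k
  (image_measure (mrestr L measurable_punctured_ball) measurable_direction).
have SE B : surface_measure B = S B.
  rewrite /S /= /mscale /= /pushforward /mrestr /surface_measure LE /=.
  congr (_ * lebesgue_rV _)%E; apply/seteqP.
  by split=> x [? ?]; split.
have Sfin : (S setT < +oo)%E.
  rewrite -SE /surface_measure -LE lte_mul_pinfty // -?LE ?measure_ge0 //.
  apply: le_lt_trans (lebesgue_rV_cube d); rewrite -!LE; apply: le_measure.
  - rewrite inE; rewrite (_ : [set x | _] = punctured_ball).
      exact: measurable_punctured_ball.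
    by apply/seteqP; split=> x //= [].
  - by rewrite inE; exact: measurable_cube.
  - by move=> x [/andP[_ x1] _] i; exact: le_trans (coord_le_enorm x i) x1.
exists S; split => //; split => //.
  exact: measurable_usphere.
rewrite -SE /surface_measure (_ : [set x | _] = set0); last first.
  by apply/seteqP; split => // x [/andP[x0 _]] /=; rewrite /usphere /= enorm_direction.
by rewrite -LE measure0 mule0.
Qed.


End surface.

(** * Rotation invariance and orthogonality of spherical harmonics *)

Section rotations.
Context {R : realType} {d : nat}.
Implicit Types (p q : {mpoly R[d]}) (x : 'rV[R]_d) (i j : 'I_d) (t : R).

(* A plane rotation, with rational parametrisation of its cosine
   (1 - t^2) / (1 + t^2) and sine 2 t / (1 + t^2), is a product of three shears. *)
Definition rot i j t x : 'rV[R]_d :=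
  shear i j (- t) (shear j i (2 * t / (1 + t ^+ 2)) (shear i j (- t) x)).

Lemma sqr1_neq0 t : 1 + t ^+ 2 != 0.
Proof. by rewrite gt_eqF // ltr_pwDl // sqr_ge0. Qed.

Lemma rot_coord i j t x l : i != j -> rot i j t x 0 l =
  if l == i then (1 - t ^+ 2) / (1 + t ^+ 2) * x 0 i - 2 * t / (1 + t ^+ 2) * x 0 j
  else if l == j then 2 * t / (1 + t ^+ 2) * x 0 i + (1 - t ^+ 2) / (1 + t ^+ 2) * x 0 j
  else x 0 l.
Proof.
move=> ij; have t0 := sqr1_neq0 t.
rewrite /rot !shearE !eqxx (eq_sym j i) (negbTE ij).
case: (eqVneq l i) => [->|li]; first by rewrite (negbTE ij) /=; field.
by case: (eqVneq l j) => [->|lj] /=; field.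
Qed.

Lemma rotZ i j t a x : rot i j t (a *: x) = a *: rot i j t x.
Proof.
have sZ k l b y : shear k l b (a *: y) = a *: shear k l b y :> 'rV[R]_d.
  by apply/rowP => m; rewrite [RHS]mxE !shearE !mxE; ring.
by rewrite /rot !sZ.
Qed.

Lemma enorm_rot i j t x : i != j -> enorm (rot i j t x) = enorm x.
Proof.
move=> ij; rewrite /enorm; congr Num.sqrt; have t0 := sqr1_neq0 t.
have D (F : 'I_d -> R) : \sum_l F l = F i + F j + \sum_(l | (l != i) && (l != j)) F l.
  by rewrite (bigD1 i) //= (bigD1 j) 1?eq_sym //= addrA.
rewrite !D !(rot_coord i j t x _ ij) !eqxx (eq_sym j i) (negbTE ij); congr (_ + _).
  by field.
by apply: eq_bigr => l /andP[li lj]; rewrite rot_coord // (negbTE li) (negbTE lj).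
Qed.

Lemma direction_rot i j t x : i != j -> direction (rot i j t x) = rot i j t (direction x).
Proof. by move=> ij; rewrite /direction enorm_rot // rotZ. Qed.

Lemma measurable_rot i j t :
  measurable_fun setT (rot i j t : borel_rV R d -> borel_rV R d).
Proof.
have ms k l b : measurable_fun setT (shear k l b : borel_rV R d -> borel_rV R d).
  exact: measurable_shear.
exact: (measurableT_comp (ms i j (- t)) (measurableT_comp (ms j i _) (ms i j (- t)))).
Qed.

(** A rotation preserves the norm and commutes with [direction], so the cone over the preimage of B
    is the preimage of the cone over B; its Lebesgue measure survives the three shears. *)
Lemma surface_measure_rot i j t (B : set (borel_rV R d)) : i != j -> measurable B ->
  surface_measure [set x | B (rot i j t x)] = surface_measure B.
Proof.
move=> ij mB; rewrite /surface_measure; congr (_ * _)%E.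
pose C : set (borel_rV R d) := [set x | (0 < enorm x <= 1)%R /\ B (direction x)].
have mC : measurable C.
  apply: measurableI; first exact: measurable_punctured_ball.
  exact: measurable_preimage measurable_direction mB.
have ms k l b (D : set (borel_rV R d)) : measurable D ->
    measurable [set x : borel_rV R d | D (shear k l b x)].
  by move=> mD; apply: measurable_preimage (measurable_shear _ _ _ _) mD.
transitivity (lebesgue_rV [set x | C (rot i j t x)]).
  congr lebesgue_rV; apply/seteqP.
  by split=> x /=; rewrite /C /= enorm_rot // direction_rot.
rewrite (lebesgue_rV_shear _ i j (- t)
  [set x | C (shear i j (- t) (shear j i (2 * t / (1 + t ^+ 2)) x))]) //; last first.
  by apply: (ms j i _ [set x | C (shear i j (- t) x)]); exact: ms.
rewrite (lebesgue_rV_shear _ j i _ [set x | C (shear i j (- t) x)]) //; last exact: ms.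
  by rewrite lebesgue_rV_shear.
by rewrite eq_sym.
Qed.

Variable S : {measure set (borel_rV R d) -> \bar R}.
Hypothesis SE : forall B, surface_measure B = S B.
Hypothesis SC : concentrated S usphere.

Lemma usphere_coord x i : usphere x -> `|x 0 i| <= 1.
Proof. by move=> /= <-; exact: coord_le_enorm. Qed.

Lemma integrable_rpeval p : S.-integrable setT (EFin \o (rpeval p : borel_rV R d -> R)).
Proof.
have [B _ hB] := rpeval_bounded 1 p.
apply: (bounded_integrable S _ SC _ B) => [|x xs]; first exact: measurable_rpeval.
by apply: hB => i; exact: usphere_coord.
Qed.

Definition sphere_int p : R := \int[S]_x rpeval p x.

Lemma sphere_intD p q : sphere_int (p + q) = sphere_int p + sphere_int q.
Proof.
rewrite /sphere_int -RintegralD //; try exact: integrable_rpeval.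
by apply: eq_Rintegral => x _; exact: rpevalD.
Qed.

Lemma sphere_intZ c p : sphere_int (c *: p) = c * sphere_int p.
Proof.
rewrite /sphere_int -RintegralZl //; last exact: integrable_rpeval.
by apply: eq_Rintegral => x _; exact: rpevalZ.
Qed.

Lemma sphere_int0 : sphere_int 0 = 0.
Proof. by have := sphere_intZ 0 0; rewrite scale0r mul0r. Qed.

Lemma sphere_int_sum (I : Type) (r : seq I) (P : pred I) (F : I -> {mpoly R[d]}) :
  sphere_int (\sum_(i <- r | P i) F i) = \sum_(i <- r | P i) sphere_int (F i).
Proof. by elim/big_rec2: _ => [|i y p _ <-]; [exact: sphere_int0|exact: sphere_intD]. Qed.

Lemma sphere_int_rot i j t p : i != j ->
  S.-integrable setT (EFin \o (fun x : borel_rV R d => rpeval p (rot i j t x))) /\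
  \int[S]_x rpeval p (rot i j t x) = sphere_int p.
Proof.
move=> ij.
have E B : measurable B -> image_measure S (measurable_rot i j t) B = S B.
  by move=> mB; rewrite image_measureE -!SE surface_measure_rot.
have [B _ hB] := rpeval_bounded 1 p.
have mp : measurable_fun setT (fun x : borel_rV R d => rpeval p (rot i j t x)).
  apply: (@measurableT_comp _ _ _ _ _ _ (rpeval p : borel_rV R d -> R) setT).
    exact: measurable_rpeval.
  exact: measurable_rot.
have ip : S.-integrable setT (EFin \o (fun x : borel_rV R d => rpeval p (rot i j t x))).
  apply: (bounded_integrable S _ SC _ B) => // x xs; apply: hB => l.
  by apply: usphere_coord; rewrite /usphere /= enorm_rot.
split => //; rewrite /sphere_int.
have := @integral_pushforward _ _ _ _ R _ (measurable_rot i j t) S setT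
  (EFin \o (rpeval p : borel_rV R d -> R)).
rewrite preimage_setT => h; congr fine; rewrite -[LHS]h //; last first.
  by apply/measurable_EFinP; exact: measurable_rpeval.
rewrite -[LHS]/(\int[image_measure S (measurable_rot i j t)]_x (rpeval p x)%:E)%E.
by apply: eq_measure_integral => A mA _; exact: E.
Qed.

(** The integral of p over the rotated sphere does not depend on the angle, so its derivative, the
    integral of [rotd i j p], vanishes. Quantitatively, p(rot x) - p(x) differs from s times
    [rotd i j p] by O(t^2), while the sine s is at least t. *)
Lemma sphere_int_rotd i j p : sphere_int (rotd i j p) = 0.
Proof.
have [<-|ij] := eqVneq i j; first by rewrite /rotd subrr sphere_int0.
have [C C0 hC] := rpeval_taylor p.
have [Bi Bi0 hBi] := rpeval_bounded 1 (mderiv i p).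
have [Bj Bj0 hBj] := rpeval_bounded 1 (mderiv j p).
(* 64 t^2 is the square of |h_i| + |h_j| <= 8t; the other summand pays for the cosine, which differs
   from 1 by at most 2 t^2. *)
pose K := C * 64 + 2 * (Bi + Bj).
have K0 : 0 <= K by rewrite addr_ge0 ?mulr_ge0 ?addr_ge0.
have key t : 0 < t -> t <= 1 ->
    t * `|sphere_int (rotd i j p)| <= t ^+ 2 * (K * fine (S setT)).
  move=> t0 t1.
  (* The sine of the rotation, and its cosine minus 1. *)
  pose s := 2 * t / (1 + t ^+ 2); pose c := (1 - t ^+ 2) / (1 + t ^+ 2) - 1.
  have den : 1 <= 1 + t ^+ 2 by rewrite lerDl sqr_ge0.
  have den0 : 0 < 1 + t ^+ 2 by exact: lt_le_trans den.
  have tt : t ^+ 2 <= t by rewrite expr2 ler_piMr // ltW.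
  have ts : t <= s by rewrite /s ler_pdivlMr //; nra.
  have s0 : 0 <= s by rewrite (le_trans (ltW t0)).
  have s2 : s <= 2 * t by rewrite /s ler_pdivrMr //; nra.
  have cE : c = - (2 * t ^+ 2 / (1 + t ^+ 2)) by rewrite /c; field; rewrite gt_eqF.
  have c2 : `|c| <= 2 * t ^+ 2.
    have T2 : 0 <= 2 * t ^+ 2 by rewrite mulr_ge0 // sqr_ge0.
    rewrite cE normrN ger0_norm; last exact: (divr_ge0 T2 (ltW den0)).
    by rewrite ler_pdivrMr // ler_peMr.
  have pt x : usphere x ->
      `|rpeval p (rot i j t x) - rpeval p x - s * rpeval (rotd i j p) x| <= t ^+ 2 * K.
    move=> xs; have x1 l := usphere_coord x l xs.
    pose h := rot i j t x - x.
    have hE l : h 0 l = rot i j t x 0 l - x 0 l by rewrite /h mxE [X in _ + X]mxE.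
    have hi : h 0 i = c * x 0 i - s * x 0 j.
      by rewrite hE rot_coord // eqxx /c /s; ring.
    have hj : h 0 j = s * x 0 i + c * x 0 j.
      by rewrite hE rot_coord // eq_sym (negbTE ij) eqxx /c /s; ring.
    have hl l : l != i -> l != j -> h 0 l = 0.
      by move=> li lj; rewrite hE rot_coord // (negbTE li) (negbTE lj) subrr.
    have bnd (u v a b : R) : `|u| <= 2 * t ^+ 2 -> `|v| <= 2 * t ->
       `|a| <= 1 -> `|b| <= 1 -> `|u * a + v * b| <= 4 * t.
      move=> hu hv ha hb; rewrite (le_trans (ler_normD _ _)) // !normrM.
      have u1 : `|u| * `|a| <= 2 * t ^+ 2 * 1 by rewrite ler_pM.
      have v1 : `|v| * `|b| <= 2 * t * 1 by rewrite ler_pM.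
      lra.
    have ns : `|s| <= 2 * t by rewrite ger0_norm.
    have bi : `|h 0 i| <= 4 * t.
      by rewrite hi -mulrN; apply: (bnd _ _ _ _ c2 ns (x1 i)); rewrite normrN.
    have bj : `|h 0 j| <= 4 * t by rewrite hj addrC; exact: (bnd _ _ _ _ c2 ns (x1 j) (x1 i)).
    have sumh (F : 'I_d -> R) : \sum_l h 0 l * F l = h 0 i * F i + h 0 j * F j.
      rewrite (bigD1 i) //= (bigD1 j) 1?eq_sym //= big1 ?addr0 // => l /andP[li lj].
      by rewrite hl // mul0r.
    have sumn : \sum_l `|h 0 l| = `|h 0 i| + `|h 0 j|.
      rewrite (bigD1 i) //= (bigD1 j) 1?eq_sym //= big1 ?addr0 // => l /andP[li lj].
      by rewrite hl // normr0.
    have h4 l : `|h 0 l| <= 4.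
      have [->|li] := eqVneq l i; first by apply: le_trans bi _; lra.
      have [->|lj] := eqVneq l j; first by apply: le_trans bj _; lra.
      by rewrite hl // normr0.
    have := hC x h x1 h4; rewrite sumh sumn (_ : x + h = rot i j t x); last first.
      by rewrite /h addrC subrK.
    set A := rpeval p _ - rpeval p x => T.
    have -> : A - s * rpeval (rotd i j p) x =
      (A - (h 0 i * rpeval (mderiv i p) x + h 0 j * rpeval (mderiv j p) x)) +
      c * (x 0 i * rpeval (mderiv i p) x + x 0 j * rpeval (mderiv j p) x).
      by rewrite /rotd rpevalB !rpevalM !rpevalX hi hj; ring.
    rewrite (le_trans (ler_normD _ _)) // /K [leRHS]mulrDr lerD //.
      rewrite (le_trans T) // (mulrCA (t ^+ 2)) ler_wpM2l //.
      have : `|h 0 i| + `|h 0 j| <= 8 * t by lra.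
      have := normr_ge0 (h 0 i); have := normr_ge0 (h 0 j) => ? ? ?.
      have -> : t ^+ 2 * 64 = (8 * t) ^+ 2 by ring.
      by rewrite lerXn2r ?nnegrE //; lra.
    rewrite normrM mulrA (mulrC (t ^+ 2)); apply: ler_pM => //.
    rewrite (le_trans (ler_normD _ _)) // !normrM.
    apply: lerD; rewrite -[leRHS]mul1r; apply: ler_pM => //.
      by apply: hBi => l; exact: x1.
    by apply: hBj => l; exact: x1.
  have [ir er] := sphere_int_rot i j t p ij.
  have ip := integrable_rpeval p.
  have iq := integrable_rpeval (rotd i j p).
  have isq : S.-integrable setT
      (EFin \o (fun x : borel_rV R d => s * rpeval (rotd i j p) x)).
    exact: (integrableZl measurableT s iq).
  have ipr : S.-integrable setT
      (EFin \o (fun x : borel_rV R d => rpeval p (rot i j t x) - rpeval p x)).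
    exact: (integrableB measurableT ir ip).
  have I0 : \int[S]_x (rpeval p (rot i j t x) - rpeval p x - s * rpeval (rotd i j p) x) =
      - (s * sphere_int (rotd i j p)).
    rewrite RintegralB // RintegralB // er /sphere_int subrr sub0r RintegralZl //.
  have : `|s * sphere_int (rotd i j p)| <= t ^+ 2 * K * fine (S setT).
    rewrite -normrN -I0; apply: (normr_Rintegral_le_bound S _ SC) => //.
    have iall := integrableB measurableT ipr isq.
    by apply/measurable_EFinP; case/integrableP: iall.
  rewrite normrM (ger0_norm s0) mulrA; apply: le_trans.
  by rewrite ler_wpM2r.
apply/eqP; rewrite -normr_eq0; apply/eqP; apply/le_anti; rewrite normr_ge0 andbT.
rewrite leNgt; apply/negP => I0.
set I := `|_| in key I0.
have F0 : 0 <= K * fine (S setT) by rewrite mulr_ge0 // fine_ge0.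
set F := K * _ in key F0.
(* [key] gives I <= t F, whereas this t makes t F at most I/2. *)
pose t := Num.min 1 (I / (2 * (F + 1))).
have t0 : 0 < t by rewrite lt_min ltr01 divr_gt0 // mulr_gt0 // ltr_pwDr.
have t1 : t <= 1 by rewrite ge_min lexx.
have := key t t0 t1; rewrite expr2 -mulrA ler_pM2l // leNgt => /negP; apply.
have : t <= I / (2 * (F + 1)) by rewrite ge_min lexx orbT.
rewrite ler_pdivlMr; last by rewrite mulr_gt0 // ltr_pwDr.
nra.
Qed.

(** Integration by parts twice: a derivation whose integrals vanish is antisymmetric, so its square
    is symmetric. *)
Lemma sphere_int_rotd2 i j p q :
  sphere_int (rotd i j (rotd i j p) * q) = sphere_int (p * rotd i j (rotd i j q)).
Proof.
have h1 := sphere_int_rotd i j (rotd i j p * q).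
have h2 := sphere_int_rotd i j (p * rotd i j q).
rewrite rotdM sphere_intD in h1; rewrite rotdM sphere_intD in h2.
by move: h1; rewrite -[RHS]h2 addrC => /addrI.
Qed.

(** Eigenvectors of a symmetric operator, the sum of the squared infinitesimal rotations, for
    distinct eigenvalues -2k(k + d - 2). *)
Lemma sphere_int_harmonic (k k' : nat) p q : (2 <= d)%N -> k != k' ->
  p \is k.-homog -> laplacian p = 0 -> q \is k'.-homog -> laplacian q = 0 ->
  sphere_int (p * q) = 0.
Proof.
move=> d2 kj hp lp hq lq.
have : sphere_int ((\sum_i \sum_l rotd i l (rotd i l p)) * q) =
       sphere_int (p * (\sum_i \sum_l rotd i l (rotd i l q))).
  rewrite mulr_suml mulr_sumr !sphere_int_sum; apply: eq_bigr => i _.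
  rewrite mulr_suml mulr_sumr !sphere_int_sum; apply: eq_bigr => l _.
  exact: sphere_int_rotd2.
rewrite (sum_rotd2_harmonic k) // (sum_rotd2_harmonic k') //.
have Z n r : sphere_int (- (r *+ n)) = - (n%:R * sphere_int r).
  by rewrite -mulNrn -scaler_nat sphere_intZ -scaleN1r sphere_intZ mulN1r mulrN.
rewrite mulNr mulrN mulrnAl mulrnAr !Z => /oppr_inj /eqP.
rewrite -subr_eq0 -mulrBl mulf_eq0 subr_eq0 eqr_nat.
case/orP => [|/eqP //].
move=> /eqP e; exfalso; move: kj => /eqP; apply.
rewrite -!mulnA in e; have {}e : (k * (k + d - 2) = k' * (k' + d - 2))%N.
  by apply/eqP; rewrite -(eqn_pmul2l (ltn0Sn 1)); apply/eqP.
(* Strict growth of k(k + d - 2); d >= 2 keeps the truncated subtraction honest and the second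
   factor positive for b >= 1. *)
have lt a b : (a < b)%N -> (a * (a + d - 2) < b * (b + d - 2))%N.
  move=> ab; apply: (@leq_ltn_trans (a * (b + d - 2))).
    by rewrite leq_mul2l leq_sub2r ?orbT // leq_add2r ltnW.
  rewrite ltn_pmul2r // subn_gt0; apply: (@leq_trans (1 + d)); first by rewrite add1n ltnS.
  by rewrite leq_add2r (leq_trans _ ab).
by case: (ltngtP k k') => // /lt; rewrite e ltnn.
Qed.

End rotations.

(** * Density of polynomials on a compact set *)

Section polynomial_density.
Context {R : realType} {d : nat}.
Variable A : set 'rV[R]_d.
Hypothesis cA : compact A.
Implicit Types (p q : {mpoly R[d]}) (f g : 'rV[R]_d -> R).

Definition approximable g := forall e : R, 0 < e ->
  exists p, forall x, A x -> `|g x - rpeval p x| <= e.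

Lemma rpeval_bounded_on p : exists2 M, 0 < M & forall x, A x -> `|rpeval p x| <= M.
Proof.
have [K [_ hK]] := compact_bounded cA.
have [B B0 hB] := rpeval_bounded (`|K| + 1) p.
exists (B + 1) => [|x Ax]; first by rewrite ltr_wpDl.
rewrite (le_trans (hB x _)) ?lerDl // => i.
have /hK /(_ x Ax) : K < `|K| + 1 by rewrite (le_lt_trans (ler_norm _)) // ltrDl.
apply: le_trans; rewrite /Num.norm /= mx_normrE.
exact: (le_bigmax _ (fun ij : 'I_1 * 'I_d => `|x ij.1 ij.2|) (0, i)).
Qed.

Lemma approximable_rpeval p : approximable (rpeval p).
Proof. by move=> e e0; exists p => x _; rewrite subrr normr0 ltW. Qed.

Lemma approximable_lim g :
  (forall e, 0 < e -> exists2 h, approximable h & forall x, A x -> `|g x - h x| <= e) ->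
  approximable g.
Proof.
move=> hg e e0; have e2 : 0 < e / 2 by rewrite divr_gt0.
have [h ah hgh] := hg _ e2; have [p hp] := ah _ e2.
exists p => x Ax; rewrite -(subrK (h x) (g x)) -addrA [leRHS]splitr.
by rewrite (le_trans (ler_normD _ _)) // lerD ?hgh ?hp.
Qed.

Lemma approximableD f g : approximable f -> approximable g ->
  approximable (fun x => f x + g x).
Proof.
move=> af ag e e0; have e2 : 0 < e / 2 by rewrite divr_gt0.
have [p hp] := af _ e2; have [q hq] := ag _ e2.
exists (p + q) => x Ax; rewrite rpevalD opprD addrACA [leRHS]splitr.
by rewrite (le_trans (ler_normD _ _)) // lerD ?hp ?hq.
Qed.

Lemma approximableZ c f : approximable f -> approximable (fun x => c * f x).
Proof.
move=> af e e0; have c0 : 0 < `|c| + 1 by rewrite ltr_wpDl.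
have [p hp] := af (e / (`|c| + 1)) (divr_gt0 e0 c0).
exists (c *: p) => x Ax; rewrite rpevalZ -mulrBr normrM.
have := hp x Ax; rewrite ler_pdivlMr // => h; apply: le_trans h.
by rewrite mulrC ler_wpM2l // lerDl.
Qed.

(** The classical iteration q -> q + (u^2 - q^2)/2 from q = 0, which increases to |u| where |u| <=
    1. *)
Fixpoint abs_iter (u : {mpoly R[d]}) n : {mpoly R[d]} :=
  if n is m.+1 then abs_iter u m + 2^-1 *: (u * u - abs_iter u m * abs_iter u m)
  else 0.

Lemma abs_iter_bounds u n x : `|rpeval u x| <= 1 ->
  0 <= rpeval (abs_iter u n) x <= `|rpeval u x| /\
  `|rpeval u x| - rpeval (abs_iter u n) x <= 2 / n.+2%:R.
Proof.
move=> u1; elim: n => [|n [/andP[q0 qu] qn]].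
  by rewrite /= rpeval0 lexx normr_ge0 subr0 divff ?pnatr_eq0.
rewrite /= rpevalD rpevalZ rpevalB !rpevalM.
have -> : rpeval u x * rpeval u x = `|rpeval u x| * `|rpeval u x|.
  by rewrite -normrM ger0_norm // -expr2 sqr_ge0.
move: (rpeval (abs_iter u n) x) (`|rpeval u x|) q0 qu qn u1 => q a q0 qa qn a1.
split; first by apply/andP; split; nra.
have N0 : 0 < n.+2%:R :> R by [].
have E : n.+3%:R = n.+2%:R + 1 :> R by rewrite -natr1.
have N2 : 2 <= n.+2%:R :> R by rewrite ler_nat.
rewrite E; move: (n.+2%:R) N0 N2 qn => N N0 N2 qn.
set c := 2 / N in qn.
have cN : c * N = 2 by rewrite /c divfK // gt_eqF.
have c0 : 0 < c by rewrite /c divr_gt0.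
have c1 : c <= 1 by rewrite /c ler_pdivrMr // mul1r.
clearbody c.
(* The error e = a - q becomes e (1 - (a + q)/2) <= e - e^2/2, which increases with e <= 1. With c =
   2/N the value c - c^2/2 is at most 2/(N+1). *)
have : a - (q + 2^-1 * (a * a - q * q)) <= c - c * c / 2 by nra.
move=> h; apply: (le_trans h).
rewrite ler_pdivlMr; last by lra.
nra.
Qed.

Lemma approximable_abs g : approximable g -> approximable (fun x => `|g x|).
Proof.
move=> ag; apply: approximable_lim => e e0; have [p hp] := ag e e0.
exists (fun x => `|rpeval p x|); last first.
  by move=> x Ax; apply: le_trans (ler_dist_dist _ _) (hp x Ax).
have [M M0 hM] := rpeval_bounded_on p.
pose u := M^-1 *: p.
have -> : (fun x => `|rpeval p x|) = (fun x => M * `|rpeval u x|).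
  apply/funext => x; rewrite /u rpevalZ normrM gtr0_norm ?invr_gt0 //.
  by rewrite mulrA divff ?mul1r // gt_eqF.
apply: approximableZ => e' e'0.
pose n := Num.truncn (2 / e').
have ne : 2 / n.+2%:R <= e'.
  rewrite ler_pdivrMr // mulrC -ler_pdivrMr //.
  have /andP[_ h] := truncn_itv (ltW (divr_gt0 (ltr0n _ 2) e'0)).
  by rewrite ltW // (lt_le_trans h) // ler_nat.
exists (abs_iter u n) => x Ax.
have u1 : `|rpeval u x| <= 1.
  rewrite /u rpevalZ normrM gtr0_norm ?invr_gt0 // mulrC ler_pdivrMr // mul1r.
  exact: hM.
have [/andP[q0 qu] h] := abs_iter_bounds u n x u1.
by rewrite ger0_norm ?subr_ge0 // (le_trans h).
Qed.

Lemma approximable_max f g : approximable f -> approximable g ->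
  approximable (fun x => Num.max (f x) (g x)).
Proof.
move=> af ag.
have -> : (fun x => Num.max (f x) (g x)) =
    (fun x => 2^-1 * (f x + g x + `|f x + (-1) * g x|)).
  by apply/funext => x; rewrite maxr_absE mulN1r mulrC.
apply: approximableZ; apply: approximableD; first exact: approximableD.
apply: approximable_abs; apply: approximableD => //; exact: approximableZ.
Qed.

(** Each point y has a downward paraboloid that stays below f on all of A and comes close to f near
    y. By compactness the maximum of finitely many of them is uniformly close to f, and maxima of
    approximable functions are approximable because absolute values are. *)
Theorem continuous_approximable f : {within A, continuous f} -> approximable f.
Proof.
move=> cf; apply: approximable_lim => e' e'0.
pose e := e' / 3; have e0 : 0 < e by rewrite divr_gt0.
have [M hM] : exists M, forall x, A x -> `|f x| <= M.
  have [K [_ hK]] := compact_bounded (continuous_compact cf cA).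
  exists (`|K| + 1) => x Ax; apply: (hK (`|K| + 1)); last by exists x.
  by rewrite (le_lt_trans (ler_norm _)) // ltrDl.
have {}cf : forall x, A x -> f @ within A (nbhs x) --> f x.
  exact/subspace_continuousP.
(* The paraboloid with apex at height f(y) - e over y and opening C. *)
pose P y C : {mpoly R[d]} := (f y - e)%:MP - C *: \sum_i ('X_i - (y 0 i)%:MP) ^+ 2.
have PE y C x : rpeval (P y C) x = f y - e - C * \sum_i (x 0 i - y 0 i) ^+ 2.
  rewrite /P rpevalB rpevalZ rpeval_sum {1}/rpeval mevalC; congr (_ - C * _).
  apply: eq_bigr => i _; rewrite !expr2 rpevalM rpevalB rpevalX.
  by rewrite /rpeval mevalC.
have low y : A y -> exists C, forall x, A x -> rpeval (P y C) x <= f x.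
  move=> Ay; have /cvgrPdist_lt /(_ e e0) := cf y Ay.
  rewrite near_withinE => /nbhs_ballP[dl /= dl0 hdl].
  (* Within distance dl the drop by e keeps the paraboloid below f; farther away C |x - y|^2 >= 2|M|
     exceeds the oscillation of f. *)
  exists (2 * `|M| / dl ^+ 2) => x Ax; rewrite PE.
  have S0 : 0 <= \sum_i (x 0 i - y 0 i) ^+ 2.
    by apply: sumr_ge0 => i _; exact: sqr_ge0.
  have C0 : 0 <= 2 * `|M| / dl ^+ 2.
    by apply: divr_ge0; [exact: mulr_ge0|exact: sqr_ge0].
  have [xy|nxy] := pselect (ball y dl x).
    have := hdl x xy Ax; rewrite ltr_norml => /andP[_ h].
    have := mulr_ge0 C0 S0; lra.
  have [i hi] : exists i, dl <= `|x 0 i - y 0 i|.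
    apply: contrapT => /forallNP h; apply: nxy; split => // k i; rewrite ord1.
    by rewrite /ball /= distrC ltNge; apply/negP; exact: h.
  have S1 : dl ^+ 2 <= \sum_i (x 0 i - y 0 i) ^+ 2.
    rewrite (bigD1 i) //= -[(x 0 i - _) ^+ 2]real_normK ?num_real //.
    rewrite (le_trans (_ : _ <= `|x 0 i - y 0 i| ^+ 2)) ?lerXn2r ?nnegrE ?(ltW dl0) //.
    by rewrite lerDl sumr_ge0 // => j _; exact: sqr_ge0.
  have h2 : 2 * `|M| <= 2 * `|M| / dl ^+ 2 * \sum_i (x 0 i - y 0 i) ^+ 2.
    by rewrite mulrAC ler_pdivlMr ?exprn_gt0 // ler_wpM2l // mulr_ge0.
  have := le_trans (hM x Ax) (ler_norm M); have := le_trans (hM y Ay) (ler_norm M).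
  rewrite !ler_norml => /andP[_ a1] /andP[a2 _]; lra.
pose C y := if pselect (A y) is left Ay then sval (cid (low y Ay)) else 0.
have hC y : A y -> forall x, A x -> rpeval (P y (C y)) x <= f x.
  by rewrite /C; case: pselect => // Ay _; case: (cid _).
(* 3e, because at y the gap is e and near y both f and the paraboloid move by less than e. *)
pose U y : set 'rV[R]_d := interior [set x | A x -> f x - 3 * e <= rpeval (P y (C y)) x].
have yU y : A y -> U y y.
  move=> Ay; have /cvgrPdist_lt /(_ e e0) := cf y Ay.
  rewrite near_withinE => h1.
  have /cvgrPdist_lt /(_ e e0) h2 := continuous_rpeval (P y (C y)) y.
  rewrite /U /interior /=; near=> x => Ax.
  have : `|f y - f x| < e by move: Ax; near: x.
  have : `|rpeval (P y (C y)) y - rpeval (P y (C y)) x| < e by near: x.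
  rewrite {1}PE big1 => [|i _]; last by rewrite subrr expr0n.
  rewrite mulr0 subr0 !ltr_norml => /andP[_ a] /andP[b _]; lra.
have [D DA Dcov] : finite_subset_cover A U A.
  move: cA; rewrite compact_cover; apply; first by move=> y _; exact: open_interior.
  by move=> y Ay; exists y => //; exact: yU.
have [s hs Dc] : exists2 s : seq 'rV[R]_d, (forall y, y \in s -> A y) &
    forall x, A x -> exists2 y, y \in s & U y x.
  exists (finmap.enum_fset D) => [y yD|x Ax]; first exact: set_mem (DA y yD).
  by have [y yD Uyx] := Dcov x Ax; exists y.
suff [h ah [hf hfl]] : exists2 h, approximable h & (forall x, A x -> h x <= f x) /\
    forall x, A x -> (exists2 y, y \in s & U y x) -> f x - 3 * e <= h x.
  exists h => // x Ax; rewrite ger0_norm ?subr_ge0 ?hf //.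
  have := hfl x Ax (Dc x Ax); rewrite lerBlDr -lerBlDl (_ : 3 * e = e') //.
  by rewrite /e mulrC divfK // pnatr_eq0.
(* The maximum is built along the list of centres, starting from the constant -M, which lies below f
   on A. *)
elim: s hs {Dc} => [_|y s IH hs].
  exists (rpeval (- M)%:MP); first exact: approximable_rpeval.
  split=> [x Ax|x _ [] //]; rewrite /rpeval mevalC.
  by have := hM x Ax; rewrite ler_norml => /andP[].
have Ay : A y by apply: hs; rewrite mem_head.
have [|h ah [h1 h2]] := IH; first by move=> z zs; apply: hs; rewrite inE zs orbT.
exists (fun x => Num.max (rpeval (P y (C y)) x) (h x)).
  by apply: approximable_max => //; exact: approximable_rpeval.
split=> x Ax; first by rewrite ge_max hC // h1.
move=> [z]; rewrite inE => /predU1P[-> /interior_subset /(_ Ax) |zs Uz] ; rewrite le_max.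
  by move=> ->.
by rewrite (h2 x Ax) ?orbT //; exists z.
Unshelve. all: by end_near. Qed.

End polynomial_density.

(** * Supports of measures and the geometry of the annulus *)

(** A point off the support has a null open neighbourhood, hence lies in a null member of the
    countable base [B]; there are countably many of these. The class [op] of open sets is a
    parameter so that the lemma serves both the line and row vectors. *)
Lemma measure_off_support {disp : measure_display} {T : measurableType disp}
    {R : realType} (m : {measure set T -> \bar R}) (op : set T -> Prop)
    (B : nat -> set T) : (forall n, measurable (B n)) ->
  (forall U, op U -> measurable U) ->
  (forall U x, op U -> U x -> exists2 n, B n x & B n `<=` U) ->
  exists N, [/\ measurable N, m N = 0%E &
    forall x, ~ (forall U, op U -> U x -> (0 < m U)%E) -> N x].
Proof.
move=> mB mop hB.
pose F n := if m (B n) == 0%E then B n else set0.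
have mF n : measurable (F n) by rewrite /F; case: ifP => // _; exact: measurable0.
exists (\bigcup_n F n); split; first exact: bigcupT_measurable.
  apply/negligibleP; first exact: bigcupT_measurable.
  apply: negligible_bigcup => n; apply/negligibleP => //.
  by rewrite /F; case: ifP => [/eqP //|_]; exact: measure0.
move=> x /existsNP[U] /not_implyP[oU] /not_implyP[Ux] /negP.
rewrite -leNgt => U0; have [n Bx BU] := hB U x oU Ux.
exists n => //; rewrite /F ifT // -measure_le0.
by apply: le_trans U0; apply: le_measure; rewrite ?inE //; exact: mop.
Qed.

Section supports.
Context {R : realType}.

Lemma concentrated_msupport_rV n (m : {measure set (borel_rV R n) -> \bar R})
    (A : set 'rV[R]_n) : (m setT < +oo)%E -> closed A ->
  (forall x, (forall U, open U -> U x -> (0 < m U)%E) -> A x) ->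
  concentrated m A.
Proof.
move=> mfin cA hA; split => //; first exact: measurable_closed_rV.
pose B k : set (borel_rV R n) :=
  if unpickle k is Some z then rat_ball (z : 'rV[rat]_n * nat) else set0.
have [|U oU|U x oU Ux|N [mN N0 hN]] := @measure_off_support _ _ _ m
    (fun U => open (U : set 'rV[R]_n)) B.
- move=> k; rewrite /B; case: unpickle => [z|]; last exact: measurable0.
  by apply: (@measurable_rat_ball R _ (borel_rV R n) n id z) => i; exact: measurable_coord.
- exact: measurable_open_rV.
- have [z zx zU] := open_rat_ball n U x oU Ux.
  by exists (pickle z); rewrite /B pickleK.
apply: (subset_measure0 _ mN _ N0); last first.
  by move=> x nAx; apply: hN => /hA.
by apply: measurableC; exact: measurable_closed_rV.
Qed.

Lemma measure_off_msupport (m : {measure set R -> \bar R}) :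
  exists N, [/\ measurable N, m N = 0%E & ~` (msupport m) `<=` N].
Proof.
pose B k : set R :=
  if unpickle k is Some z then `](ratr z.1 : R), (ratr z.2 : R)[%classic else set0.
have [|U oU|U x oU Ux|N [mN N0 hN]] := @measure_off_support _ _ _ m
    (fun U => open (U : set R)) B.
- move=> k; rewrite /B; case: unpickle => [z|]; last exact: measurable0.
  exact: measurable_itv.
- exact: open_measurable.
- move: oU; rewrite openE => /(_ x Ux) /nbhs_ballP[e /= e0 eU].
  have xe1 : x - e < x by rewrite ltrBlDr ltrDl.
  have xe2 : x < x + e by rewrite ltrDl.
  have [p hp] := rat_in_itvoo xe1; have [q hq] := rat_in_itvoo xe2.
  move: hp hq; rewrite !in_itv /= => /andP[ep px] /andP[xq qe].
  exists (pickle (p, q)); rewrite /B pickleK /=; first by rewrite in_itv /= px.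
  move=> y; rewrite /= in_itv /= => /andP[py yq]; apply: eU.
  rewrite /ball /= ltr_distl; apply/andP; split; lra.
by exists N; split => // x; exact: hN.
Qed.

Lemma closed_annulus d (rho r : R) : closed (@annulus R d rho r).
Proof.
rewrite (_ : annulus rho r = enorm @^-1` `[rho, r]%classic); last first.
  by apply/seteqP; split=> x; rewrite /annulus /= in_itv.
have /continuous_closedP := @continuous_enorm R d; apply.
exact: itv_closed.
Qed.

Lemma compact_annulus d (rho r : R) : compact (@annulus R d rho r).
Proof.
apply: bounded_closed_compact; last exact: closed_annulus.
exists r; split; first exact: num_real.
move=> M rM x /andP[_ xr]; rewrite /Num.norm /= mx_normrE.
have r0 : 0 <= r by apply: le_trans xr; exact: enorm_ge0.
apply: bigmax_le => [|[i j] _ /=]; first by rewrite (le_trans r0) // ltW.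
rewrite ord1 (le_trans (coord_le_enorm x j)) // (le_trans xr) // ltW //.
Qed.

Lemma rpeval_homog d k (p : {mpoly R[d]}) a x : p \is k.-homog ->
  rpeval p (a *: x) = a ^+ k * rpeval p x.
Proof.
move=> /dhomogP hp; rewrite /rpeval !mevalE mulr_sumr big_seq [RHS]big_seq.
apply: eq_bigr => m /hp /= mk; rewrite mulrCA; congr (_ * _).
rewrite -mk mdegE -prodrXr -big_split /=; apply: eq_bigr => i _.
by rewrite mxE exprMn.
Qed.

Lemma enorm_direction_scale d (x : 'rV[R]_d) : enorm x *: direction x = x.
Proof.
have [x0|x0] := eqVneq (enorm x) 0.
  by rewrite (enorm_eq0 x x0) /direction !scaler0.
by rewrite /direction scalerA divff // scale1r.
Qed.

Lemma rpeval_polar d k (p : {mpoly R[d]}) x : p \is k.-homog ->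
  rpeval p x = enorm x ^+ k * rpeval p (direction x).
Proof. by move=> hp; rewrite -(rpeval_homog _ _ _ _ _ hp) enorm_direction_scale. Qed.

Lemma enorm_direction_le1 d (x : 'rV[R]_d) : enorm (direction x) <= 1.
Proof.
rewrite /direction enormZ ger0_norm ?invr_ge0 ?enorm_ge0 //.
have [->|x0] := eqVneq (enorm x) 0; first by rewrite mulr0.
by rewrite mulVf.
Qed.

Lemma direction_bounded d (p : {mpoly R[d]}) : exists2 B, 0 <= B &
  forall x, `|rpeval p (direction x)| <= B.
Proof.
have [B B0 hB] := rpeval_bounded 1 p; exists B => // x; apply: hB => i.
exact: le_trans (coord_le_enorm _ i) (enorm_direction_le1 _ _).
Qed.

End supports.

(** * Component measures of a signed measure on the annulus *)

Section signed_pair.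
Context {R : realType} {d : nat}.
Variables (P N : {measure set (borel_rV R d) -> \bar R}) (rho r : R).
Hypotheses (PC : concentrated P (annulus rho r)) (NC : concentrated N (annulus rho r)).
Hypotheses (rho0 : 0 <= rho) (rho_r : rho < r).
Implicit Types (g : 'rV[R]_d -> R) (p : {mpoly R[d]}).

(** [P] and [N] play the role of the Jordan parts of mu or sigma. *)
Definition signed_int g : R := \int[P]_x g x - \int[N]_x g x.

Definition signed_mass : R := fine (P setT) + fine (N setT).

Lemma signed_mass_ge0 : 0 <= signed_mass.
Proof. by rewrite addr_ge0 // fine_ge0. Qed.

Definition bounded_meas g := measurable_fun setT (g : borel_rV R d -> R) /\
  exists B, forall x, annulus rho r x -> `|g x| <= B.

Lemma bounded_meas_integrable g : bounded_meas g ->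
  P.-integrable setT (EFin \o (g : borel_rV R d -> R)) /\
  N.-integrable setT (EFin \o (g : borel_rV R d -> R)).
Proof.
by move=> [mg [B hB]]; split; [exact: (bounded_integrable P _ PC _ B)
                              |exact: (bounded_integrable N _ NC _ B)].
Qed.

Lemma signed_intD g h : bounded_meas g -> bounded_meas h ->
  signed_int (fun x => g x + h x) = signed_int g + signed_int h.
Proof.
move=> /bounded_meas_integrable[gP gN] /bounded_meas_integrable[hP hN].
by rewrite /signed_int !RintegralD //; ring.
Qed.

Lemma signed_intZ c g : bounded_meas g ->
  signed_int (fun x => c * g x) = c * signed_int g.
Proof.
move=> /bounded_meas_integrable[gP gN].
by rewrite /signed_int !RintegralZl //; ring.
Qed.

Lemma eq_signed_int g h : bounded_meas g -> bounded_meas h ->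
  (forall x, annulus rho r x -> g x = h x) -> signed_int g = signed_int h.
Proof.
move=> [mg _] [mh _] gh; rewrite /signed_int.
by rewrite (eq_Rintegral_concentrated P _ PC g h) // (eq_Rintegral_concentrated N _ NC g h).
Qed.

Lemma signed_int_bound g B : measurable_fun setT (g : borel_rV R d -> R) ->
  (forall x, annulus rho r x -> `|g x| <= B) -> `|signed_int g| <= B * signed_mass.
Proof.
move=> mg gB; rewrite /signed_int (le_trans (ler_normB _ _)) // mulrDr lerD //.
  exact: (normr_Rintegral_le_bound P _ PC).
exact: (normr_Rintegral_le_bound N _ NC).
Qed.

Lemma bounded_meas_rpeval p : bounded_meas (rpeval p).
Proof.
split; first exact: measurable_rpeval.
have [M _ hM] := rpeval_bounded_on _ (compact_annulus d rho r) p.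
by exists M.
Qed.

Lemma bounded_meas_radial (h : R -> R) p : continuous h ->
  bounded_meas (fun x => h (enorm x) * rpeval p x).
Proof.
move=> ch; have ch' : continuous (fun x : 'rV[R]_d => h (enorm x)).
  by move=> x; apply: continuous_comp; [exact: continuous_enorm|exact: ch].
have cg : continuous (fun x : 'rV[R]_d => h (enorm x) * rpeval p x).
  by move=> x; exact: (cvgM (ch' x) (continuous_rpeval p x)).
split; first exact: continuous_measurable_rV.
have [K [_ hK]] := compact_bounded (continuous_compact
  (continuous_subspaceT cg) (compact_annulus d rho r)).
exists (`|K| + 1) => x Ax; apply: (hK (`|K| + 1)); last by exists x.
by rewrite (le_lt_trans (ler_norm _)) // ltrDl.
Qed.

(** The real form of [component_measure]: test functions are real-valued and continuous on the whole
    line. *)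
Definition signed_component (y : {mpoly R[d]}) (nu : {measure set R -> \bar R}) : Prop :=
  forall h : R -> R, continuous h ->
  (exists c n, forall t, 0 <= t -> `|h t| <= c * (1 + t) ^+ n) ->
  nu.-integrable halfline (EFin \o h) /\
  \int[nu]_(t in halfline) h t = signed_int (fun x => h (enorm x) * rpeval y x).

Section component.
Variables (k : nat) (y : {mpoly R[d]}) (nu : {measure set R -> \bar R}).
Hypothesis yk : y \is k.-homog.
Hypothesis nu0 : nu `]-oo, 0[%classic = 0%E.
Hypothesis nuE : signed_component y nu.

Let mhalf : measurable (@halfline R).
Proof. exact: measurable_itv. Qed.

Lemma halflineC : ~` (@halfline R) = `]-oo, 0[%classic.
Proof.
apply/seteqP; split=> t; rewrite /halfline /= !in_itv /= andbT.
  by move=> /negP; rewrite -ltNge.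
by move=> t0; apply/negP; rewrite -ltNge.
Qed.

Lemma component_halfline : concentrated nu (@halfline R).
Proof.
have [|i1 _] := nuE (cst 1) (fun x => @cst_continuous _ _ _ _).
  by exists 1, 0%N => t _; rewrite /= normr1 expr0 mulr1.
split => //; last by rewrite halflineC.
rewrite -(setUv (@halfline R)) (le_lt_trans (measureU2 _ _ _)) //.
  exact: measurableC.
rewrite [X in (_ + X)%E](_ : _ = 0%E) ?adde0; last by rewrite halflineC.
have := i1 => /integrableP[_]; rewrite (eq_integral (cst 1%E)) => [|t _].
  by rewrite integral_cst // mul1e.
by rewrite /= normr1.
Qed.

Lemma component_int (h : R -> R) : continuous h ->
  (exists c n, forall t, 0 <= t -> `|h t| <= c * (1 + t) ^+ n) ->
  nu.-integrable setT (EFin \o h) /\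
  \int[nu]_t h t = signed_int (fun x => h (enorm x) * rpeval y x).
Proof.
move=> ch hb; have [i e] := nuE h ch hb.
have mh : measurable_fun setT h by exact: continuous_measurable_fun.
have nc := component_halfline.
have mp : measurable_fun setT (h \_ (@halfline R)) by exact: measurable_patch.
have he t : halfline t -> h t = (h \_ (@halfline R)) t.
  by move=> tt; rewrite patchE mem_set.
split.
  apply: (eq_integrable_concentrated nu _ nc h (h \_ (@halfline R))) => //.
  have := (integrable_mkcond (EFin \o h) mhalf).1 i.
  by rewrite restrict_EFin.
by rewrite -e [RHS]Rintegral_mkcond; exact: (eq_Rintegral_concentrated nu _ nc h _ mh mp he).
Qed.

Let clamp t := Num.max rho (Num.min r t).

(** Tested against the distance to [rho, r]: this function of |x| vanishes on the annulus, so its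
    integral against [nu] is 0, and it is positive off the interval. *)
Lemma component_concentrated : concentrated nu `[rho, r]%classic.
Proof.
have [nf mI nI] := component_halfline.
pose h t := `|t - clamp t|.
have ch : continuous h.
  move=> t; apply: cvg_norm; apply: cvgB; first exact: cvg_id.
  apply: continuous_max; first exact: cvg_cst.
  by apply: continuous_min; [exact: cvg_cst|exact: cvg_id].
have hI t : rho <= t <= r -> h t = 0.
  by move=> /andP[a b]; rewrite /h /clamp min_r // max_r // subrr normr0.
have hb : exists c n, forall t, 0 <= t -> `|h t| <= c * (1 + t) ^+ n.
  exists (1 + r), 1%N => t t0; rewrite expr1 /h normr_id.
  have r0 : 0 < r by exact: le_lt_trans rho_r.
  have c0 : 0 <= clamp t by rewrite le_max rho0.
  have cr : clamp t <= r by rewrite ge_max (ltW rho_r) ge_min lexx.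
  rewrite ler_norml; apply/andP; split; nra.
have [ih eh] := component_int h ch hb.
have z : \int[nu]_t h t = 0.
  rewrite eh (eq_signed_int _ (fun=> 0)).
  - by rewrite /signed_int !Rintegral_cst // !mul0r subrr.
  - exact: bounded_meas_radial.
  - by split; [exact: measurable_cst|exists 0 => *; rewrite normr0].
  - by move=> x /hI ->; rewrite mul0r.
have := Rintegral_eq0_concentrated nu _ component_halfline h ih
  (fun t _ => normr_ge0 _) z.
set M := [set t | _] => M0.
have mM : measurable M.
  rewrite (_ : M = halfline `&` ~` (h @^-1` [set 0])); last by apply/seteqP; split.
  apply: measurableI => //; apply: measurableC; rewrite -[X in measurable X]setTI.
  exact: continuous_measurable_fun.
split => //.
apply: (@subset_measure0 _ _ _ _ _ (M `|` `]-oo, 0[%classic)).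
- exact: measurableC.
- exact: measurableU.
- move=> t /= nt; have [t0|t0] := ltP t 0; first by right; rewrite /= in_itv.
  left; split; first by rewrite /halfline /= in_itv /= t0.
  move=> /normr0_eq0 /eqP; rewrite subr_eq0 => /eqP e; apply: nt.
  rewrite /= in_itv /= e /clamp le_max lexx /= ge_max (ltW rho_r) /=.
  by rewrite ge_min lexx.
- by apply: null_set_setU => //.
Qed.

Lemma component_horner (p : {poly R}) :
  \int[nu]_t p.[t ^+ 2] = signed_int (fun x => p.[enorm x ^+ 2] * rpeval y x).
Proof.
have -> : (fun t : R => p.[t ^+ 2]) = horner (p \Po 'X^2).
  by apply/funext => t; rewrite horner_comp hornerXn.
have [] // := component_int (horner (p \Po 'X^2)).
- exact: continuous_horner.
- move: (p \Po 'X^2) => q.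
  have : exists2 c, 0 <= c & exists n, forall t : R, 0 <= t -> `|q.[t]| <= c * (1 + t) ^+ n.
    elim/poly_ind: q => [|q a [c c0 [n hn]]].
      by exists 0 => //; exists 0%N => t _; rewrite horner0 normr0 mul0r.
    exists (c + `|a|); first by rewrite addr_ge0.
    exists n.+1 => t t0; rewrite hornerMXaddC (le_trans (ler_normD _ _)) //.
    rewrite mulrDl lerD //.
      rewrite normrM (ger0_norm t0) exprSr mulrA ler_pM //; first exact: hn.
      by rewrite lerDr.
    by rewrite ler_peMr // exprn_ege1 // lerDl.
  by move=> [c _ [n hn]]; exists c, n.
move=> _ ->; rewrite /signed_int; congr (_ - _); apply: eq_Rintegral => x _;
  by rewrite horner_comp hornerXn.
Qed.

(** Tested against h_n(t) = 1/(1 + (n+1)|t|), which is 1 at 0. Since |y(x)| <= B |x|^k with k >= 1,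
    the function h_n(|x|) |y(x)| is at most B r^(k-1)/(n+1) on the annulus, so the mass at 0 is
    bounded by a quantity that tends to 0. *)
Lemma component_null0 : (0 < k)%N -> nu [set 0] = 0%E.
Proof.
move=> k0; have [B B0 hB] := direction_bounded d y.
have [nf _ _] := component_halfline.
have r0 : 0 < r by exact: le_lt_trans rho_r.
pose K := B * r ^+ k.-1 * signed_mass.
have K0 : 0 <= K by rewrite !mulr_ge0 ?signed_mass_ge0 // exprn_ge0 // ltW.
pose M := fine (nu [set 0]).
have ME : nu [set 0] = M%:E.
  rewrite /M fineK // ge0_fin_numE //; apply: le_lt_trans nf.
  by apply: le_measure; rewrite ?inE.
have key n : M <= K / n.+1%:R.
  pose h (t : R) : R := (1 + n.+1%:R * `|t|)^-1.
  have den (t : R) : 0 < 1 + n.+1%:R * `|t| by rewrite ltr_pwDl // mulr_ge0.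
  have h0 t : 0 <= h t by rewrite invr_ge0 ltW.
  have h1 t : h t <= 1 by rewrite invf_le1 // lerDl mulr_ge0.
  have ch : continuous h.
    move=> t; apply: cvgV; first by rewrite gt_eqF.
    apply: cvgD; first exact: cvg_cst.
    apply: cvgM; first exact: cvg_cst.
    by apply: cvg_norm; exact: cvg_id.
  have [|ih eh] := component_int h ch.
    by exists 1, 0%N => t _; rewrite expr0 mulr1 ger0_norm.
  have le1 : M <= \int[nu]_t h t.
    rewrite -[M]mul1r -(Rintegral_cst nu (measurable_set1 0)) Rintegral_mkcond.
    apply: le_Rintegral => //.
      rewrite -restrict_EFin; apply/(integrable_mkcond _ (measurable_set1 0)).1.
      apply: (integrableS measurableT) => //.
      exact: (integrable_cst_concentrated nu _ component_halfline 1).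
    move=> t _; rewrite patchE; case: ifPn => // /set_mem /= ->.
    by rewrite /h normr0 mulr0 addr0 invr1.
  apply: (le_trans le1); rewrite eh (le_trans (ler_norm _)) //.
  rewrite /K mulrAC; apply: signed_int_bound; first by case: (bounded_meas_radial h y ch).
  move=> x /andP[_ xr]; rewrite normrM (ger0_norm (h0 _)) (rpeval_polar _ _ _ _ yk).
  rewrite normrM ger0_norm ?exprn_ge0 ?enorm_ge0 // mulrA [B * _]mulrC -!mulrA.
  rewrite [B / _]mulrC !mulrA ler_pM // ?mulr_ge0 ?exprn_ge0 ?enorm_ge0 //.
  rewrite /h ger0_norm ?enorm_ge0 // mulrC.
  rewrite ler_pdivrMr ?ltr_pwDl ?mulr_ge0 ?enorm_ge0 //.
  rewrite -(prednK k0) exprSr mulrAC ler_pdivlMr //=.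
  have x0 := enorm_ge0 x.
  have a0 : enorm x ^+ k.-1 <= r ^+ k.-1 by rewrite lerXn2r ?nnegrE ?(ltW r0).
  rewrite -mulrA ler_pM ?exprn_ge0 ?mulr_ge0 //.
  by rewrite mulrC lerDr.
rewrite ME; congr EFin; apply/le_anti; rewrite fine_ge0 // andbT.
rewrite leNgt; apply/negP => M0.
pose n := Num.truncn (K / M).
have /andP[_ hn] := truncn_itv (divr_ge0 K0 (ltW M0)).
have := key n; rewrite ler_pdivlMr // leNgt => /negP; apply.
by move: hn; rewrite ltr_pdivrMr // mulrC.
Qed.

End component.
End signed_pair.

(** * The integral of t^(-k) against a component measure *)

Section component_weight.
Context {R : realType} {d : nat}.
Variables (P N : {measure set (borel_rV R d) -> \bar R}) (rho r : R).
Hypotheses (PC : concentrated P (annulus rho r)) (NC : concentrated N (annulus rho r)).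
Hypotheses (rho0 : 0 <= rho) (rho_r : rho < r).
Variables (k : nat) (y : {mpoly R[d]}) (nu : {measure set R -> \bar R}).
Hypothesis yk : y \is k.-homog.
Hypothesis nu0 : nu `]-oo, 0[%classic = 0%E.
Hypothesis nuE : signed_component P N y nu.

Local Notation weight := (fun t : R => (t ^+ 2) `^ (- (k%:R / 2))).

(** The weight is t^(-k) for t > 0, written as a power of t^2 to match the profile after the
    substitution. At t = 0 it is 1 for k = 0 and 0 otherwise. *)
Lemma weightE (t : R) : 0 <= t -> weight t = if t == 0 then (k == 0)%:R else (t ^+ k)^-1.
Proof.
move=> t0; case: eqVneq => [->|tn0].
  rewrite expr0n /=; have [->|k0] := eqVneq k 0%N; first by rewrite mul0r oppr0 powRr0.
  by rewrite powR0 // oppr_eq0 mulf_neq0 ?pnatr_eq0 // invr_eq0 pnatr_eq0.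
rewrite powRN -powR_mulrn // -powRrM mulrC divfK ?pnatr_eq0 //.
by rewrite powR_mulrn.
Qed.

Lemma measurable_weight : measurable_fun setT weight.
Proof.
rewrite (_ : weight = (fun t => t `^ (- (k%:R / 2))) \o (fun t : R => t ^+ 2)) //.
apply: measurableT_comp; first exact: measurable_powR.
exact: measurable_funX.
Qed.

(** Continuous minorants of the weight for k >= 1: they increase with n to |t|^(-k) off 0 and vanish
    at 0. *)
Let psi n (t : R) : R := `|t| / (`|t| ^+ k.+1 + n.+1%:R^-1).

Let psi_den n (t : R) : 0 < `|t| ^+ k.+1 + n.+1%:R^-1.
Proof. by rewrite ltr_wpDl ?exprn_ge0 // invr_gt0. Qed.

Let psi_ge0 n t : 0 <= psi n t.
Proof. by rewrite divr_ge0 // ltW. Qed.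

Let psi_continuous n : continuous (psi n).
Proof.
move=> t; apply: cvgM; first by apply: cvg_norm; exact: cvg_id.
apply: cvgV; first by rewrite gt_eqF.
apply: cvgD; last exact: cvg_cst.
apply: (@continuous_comp _ _ _ (fun u : R => `|u|) (fun u => u ^+ k.+1)).
  exact: norm_continuous.
exact: exprn_continuous.
Qed.

Let psi_nondecreasing t : {homo psi ^~ t : m n / (m <= n)%N >-> m <= n}.
Proof.
move=> m n mn; rewrite /psi ler_wpM2l // lef_pV2 ?posrE //.
by rewrite lerD2l lef_pV2 ?posrE // ler_nat.
Qed.

Let psi_cvg t : (0 < k)%N -> 0 <= t -> psi n t @[n --> \oo] --> weight t.
Proof.
move=> k0 t0; have -> := weightE t t0; case: eqVneq => [->|tn0].
  rewrite (_ : psi ^~ 0 = cst 0); last first.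
    by apply/funext => n; rewrite /psi normr0 mul0r.
  by rewrite eqn0Ngt k0; exact: cvg_cst.
rewrite (_ : (t ^+ k)^-1 = t / (t ^+ k.+1 + 0)); last first.
  by rewrite addr0 exprS invfM mulrA divff // mul1r.
rewrite /psi ger0_norm //; apply: cvgM; first exact: cvg_cst.
apply: cvgV; first by rewrite addr0 expf_neq0.
by apply: cvgD; [exact: cvg_cst|exact: cvg_harmonic].
Qed.

(** The weight is not an admissible test function, so it is approached by [psi n]: by monotone
    convergence under [nu], and by dominated convergence under [P] and [N], since psi_n(|x|) |y(x)|
    is at most |y(x/|x|)|. Finiteness of the limit yields integrability of the weight. *)
Lemma component_weight :
  nu.-integrable setT (EFin \o weight) /\
  \int[nu]_t weight t = signed_int P N (fun x => rpeval y (direction x)).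
Proof.
have nuC := component_concentrated P N rho r PC NC rho0 rho_r y nu nu0 nuE.
have nuH := component_halfline P N y nu nu0 nuE.
have [nf mI nI] := nuC.
(* For k = 0 the weight is the constant 1, which [psi n] would miss at 0. *)
have [k0|k0] := posnP k.
  have W1 : weight = cst 1 by apply/funext => t; rewrite k0 mul0r oppr0 powRr0.
  split; first by rewrite W1; exact: (integrable_cst_concentrated nu _ nuC 1).
  have [|_] := component_int P N y nu nu0 nuE (cst 1) (fun x => @cst_continuous _ _ _ _).
    by exists 1, 0%N => t _; rewrite normr1 expr0 mulr1.
  rewrite W1 => ->; congr (_ - _); apply: eq_Rintegral => x _;
    by rewrite mul1r (rpeval_polar _ _ _ _ yk) k0 expr0 mul1r.
have psiE n : nu.-integrable setT (EFin \o psi n) /\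
    \int[nu]_t psi n t = signed_int P N (fun x => psi n (enorm x) * rpeval y x).
  apply: (component_int P N y nu nu0 nuE (psi n) (psi_continuous n)).
  exists n.+1%:R, 1%N => t t0; rewrite ger0_norm // expr1 /psi.
  have := psi_den n t; rewrite (ger0_norm t0) => den; rewrite ler_pdivrMr //.
  have q1 : n.+1%:R * n.+1%:R^-1 = 1 :> R by rewrite divff // pnatr_eq0.
  have A0 : 0 <= n.+1%:R * (1 + t) * t ^+ k.+1.
    by rewrite !mulr_ge0 ?addr_ge0 ?exprn_ge0.
  rewrite mulrDr [n.+1%:R * _ * n.+1%:R^-1]mulrAC q1 mul1r; lra.
have [B B0 hB] := direction_bounded d y.
pose f_ n (x : 'rV[R]_d) := psi n (enorm x) * rpeval y x.
have mf n : measurable_fun setT (f_ n : borel_rV R d -> R).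
  by case: (bounded_meas_radial rho r (psi n) y (psi_continuous n)).
have mdir : measurable_fun setT (fun x : borel_rV R d => rpeval y (direction x)).
  exact: (measurableT_comp (measurable_rpeval y) measurable_direction).
have f_le n x : `|f_ n x| <= B.
  rewrite /f_ normrM (ger0_norm (psi_ge0 _ _)) (rpeval_polar _ _ _ _ yk) normrM mulrA.
  rewrite -[leRHS]mul1r ler_pM ?mulr_ge0 //.
  rewrite [X in _ * X]ger0_norm ?exprn_ge0 ?enorm_ge0 // /psi mulrAC.
  rewrite ler_pdivrMr // mul1r ger0_norm ?enorm_ge0 // -exprS.
  by rewrite lerDl.
have f_cvg x : f_ n x @[n --> \oo] --> rpeval y (direction x).
  have -> : rpeval y (direction x) = weight (enorm x) * rpeval y x.
    have -> := weightE _ (enorm_ge0 x).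
    rewrite (rpeval_polar _ _ _ x yk); case: eqVneq => [x0|xn0].
      rewrite eqn0Ngt k0 mul0r /direction (enorm_eq0 x x0) scaler0.
      rewrite -(scale0r (0 : 'rV[R]_d)) (rpeval_homog _ _ _ _ _ yk).
      by rewrite expr0n eqn0Ngt k0 mul0r.
    by rewrite mulrA mulVf ?mul1r // expf_neq0.
  by apply: cvgM; [exact: psi_cvg (enorm_ge0 x)|exact: cvg_cst].
have dom (M : {measure set (borel_rV R d) -> \bar R}) :
    concentrated M (annulus rho r) ->
    \int[M]_x f_ n x @[n --> \oo] --> \int[M]_x rpeval y (direction x).
  move=> MC; have iB := integrable_cst_concentrated M _ MC B.
  have [||||| _ _ h] := @dominated_convergence _ _ _ M setT measurableT
    (fun n x => (f_ n x)%:E) (fun x => (rpeval y (direction x))%:E) (fun=> B%:E).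
  - by move=> n; apply/measurable_EFinP; exact: mf.
  - by apply/measurable_EFinP.
  - by apply: aeW => x _; apply: cvg_EFin; [exact: nearW|exact: f_cvg].
  - exact: iB.
  - by apply: aeW => x n _; rewrite lee_fin.
  apply: fine_cvg; rewrite fineK //.
  apply: (integrable_fin_num measurableT).
  by apply: (bounded_integrable M _ MC _ B) => // x _; exact: hB.
have Icvg : \int[nu]_t psi n t @[n --> \oo] -->
    signed_int P N (fun x => rpeval y (direction x)).
  rewrite (_ : (fun n => \int[nu]_t psi n t) =
    (fun n => \int[P]_x f_ n x - \int[N]_x f_ n x)).
    by apply: cvgB; [exact: dom PC|exact: dom NC].
  by apply/funext => n; rewrite (psiE n).2.
have mono : (\int[nu]_t (psi n t)%:E @[n --> \oo] --> \int[nu]_t (weight t)%:E)%E.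
  have := @cvg_monotone_convergence _ _ _ nu setT measurableT
    (fun n t => (psi n t)%:E).
  rewrite (_ : (\int[nu]_x limn (fun n => (psi n x)%:E))%E = (\int[nu]_t (weight t)%:E)%E).
    apply.
    - by move=> n; apply/measurable_EFinP; exact: continuous_measurable_fun.
    - by move=> n t _; rewrite lee_fin.
    - by move=> t _ a b ab; rewrite lee_fin; exact: psi_nondecreasing.
  apply: eq_integral => t _; apply/cvg_lim => //.
  apply: cvg_EFin; first exact: nearW.
  have := psi_cvg `|t| k0 (normr_ge0 t); rewrite real_normK ?num_real //.
  by rewrite (_ : psi ^~ `|t| = psi ^~ t) //; apply/funext => n; rewrite /psi normr_id.
have eqI : (\int[nu]_t (weight t)%:E = (signed_int P N (fun x => rpeval y (direction x)))%:E)%E.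
  apply: (cvg_unique _ mono) => //.
  rewrite (_ : (fun n => \int[nu]_t (psi n t)%:E)%E = (fun n => (\int[nu]_t psi n t)%:E)).
    by apply: cvg_EFin => //; exact: nearW.
  apply/funext => n; rewrite fineK //.
  exact: (integrable_fin_num measurableT (psiE n).1).
split; last by rewrite /Rintegral eqI.
apply/integrableP; split; first by apply/measurable_EFinP; exact: measurable_weight.
rewrite (eq_integral (fun t => (weight t)%:E)); first by rewrite eqI ltry.
by move=> t _ /=; rewrite ger0_norm // powR_ge0.
Qed.

End component_weight.

(** * Laplace-Fourier coefficients and their integrals against components *)

Lemma measurable_patch_within {disp : measure_display} {T : measurableType disp}
    {R : realType} (A : set T) (F : T -> R) : measurable A -> measurable_fun A F ->
  measurable_fun setT (F \_ A).
Proof. by move=> mA mF; apply/(measurable_restrictT _ _).1. Qed.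

Lemma measurable_within_continuous {R : realType} {d : nat} (A : set 'rV[R]_d)
    (g : 'rV[R]_d -> R) : closed A -> {within A, continuous g} ->
  measurable_fun (A : set (borel_rV R d)) (g : borel_rV R d -> R).
Proof.
move=> cA /continuousP cg.
apply: (@measurability _ _ (borel_rV R d) R A g (@RGenOpens.G R)).
  exact: RGenOpens.measurableE.
move=> _ [_ [a [b ->]] <-].
have oab : open (`]a, b[%classic : set R) by exact: interval_open.
have /open_subspaceP[V oV VA] := cg _ oab.

rewrite setIC -VA; apply: measurableI; first exact: measurable_open_rV.
exact: measurable_closed_rV.
Qed.

Section laplace_fourier.
Context {R : realType} {d : nat}.
Variable S : {measure set (borel_rV R d) -> \bar R}.
Hypothesis SE : forall B, surface_measure B = S B.
Hypothesis SC : concentrated S usphere.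
Variables (rho r : R).
Hypotheses (rho0 : 0 <= rho) (rho_r : rho < r).
Local Notation A := (@annulus R d rho r).
Implicit Types (g : 'rV[R]_d -> R) (y p : {mpoly R[d]}).

Lemma Rintegral_usphere g : measurable_fun setT (g : borel_rV R d -> R) ->
  \int[S]_(x in usphere) g x = \int[S]_x g x.
Proof.
move=> mg; rewrite Rintegral_mkcond; apply/esym.
apply: (eq_Rintegral_concentrated S _ SC) => //.
  by apply: measurable_patch => //; exact: measurable_usphere.
by move=> x xs; rewrite patchE mem_set.
Qed.

Definition lf_int y g (t : R) : R := \int[S]_(x in usphere) (g (t *: x) * rpeval y x).

(** The retraction onto [rho, r]. Coefficients are meaningful only for radii in this interval;
    composed with [clamp] they become continuous functions on the whole line. *)
Definition clamp (t : R) := Num.max rho (Num.min r t).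

Lemma clamp_itv t : rho <= clamp t <= r.
Proof. by rewrite le_max lexx ge_max (ltW rho_r) ge_min lexx. Qed.

Lemma clamp_id t : rho <= t <= r -> clamp t = t.
Proof. by move=> /andP[a b]; rewrite /clamp min_r // max_r. Qed.

Lemma continuous_clamp : continuous clamp.
Proof.
move=> t; apply: continuous_max; first exact: cvg_cst.
by apply: continuous_min; [exact: cvg_cst|exact: cvg_id].
Qed.

Lemma annulus_scale t x : rho <= t <= r -> usphere x -> A (t *: x).
Proof.
move=> /andP[a b] /= x1; rewrite /annulus /= enormZ x1 mulr1.
by rewrite ger0_norm ?a ?b // (le_trans rho0).
Qed.

Lemma within_annulus_bounded g : {within A, continuous g} ->
  exists2 B, 0 <= B & forall x, A x -> `|g x| <= B.
Proof.
move=> cg; have [K [_ hK]] := compact_bounded (continuous_compact cg (compact_annulus d rho r)).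
exists (`|K| + 1) => [|x Ax]; first by rewrite addr_ge0.
apply: (hK (`|K| + 1)); last by exists x.
by rewrite (le_lt_trans (ler_norm _)) // ltrDl.
Qed.

Lemma measurable_scaled_patch g t : {within A, continuous g} ->
  measurable_fun setT (fun x : borel_rV R d => (g \_ A) (t *: (x : 'rV[R]_d))).
Proof.
move=> cg; have mA : measurable (A : set (borel_rV R d)).
  exact: (measurable_closed_rV d _ (closed_annulus d rho r)).
have mg : measurable_fun setT (g \_ A : borel_rV R d -> R).
  exact: (measurable_patch_within _ _ mA
    (measurable_within_continuous A g (closed_annulus d rho r) cg)).
have ms : measurable_fun setT
    (fun x : borel_rV R d => t *: (x : 'rV[R]_d) : borel_rV R d).
  apply: measurable_rV => i; under eq_fun do rewrite mxE.
  by apply: measurable_funM; [exact: measurable_cst|exact: measurable_coord].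
exact: (measurableT_comp mg ms).
Qed.

(** [g] is controlled on the annulus only; its extension by 0 is measurable everywhere and has the
    same values on the spheres in question. *)
Lemma lf_intE y g t : {within A, continuous g} -> rho <= t <= r ->
  lf_int y g t = \int[S]_x ((g \_ A) (t *: x) * rpeval y x) /\
  S.-integrable setT (EFin \o (fun x : borel_rV R d => (g \_ A) (t *: (x : 'rV[R]_d)) * rpeval y x)).
Proof.
move=> cg trho.
have mg : measurable_fun setT
    (fun x : borel_rV R d => (g \_ A) (t *: (x : 'rV[R]_d)) * rpeval y x).
  by apply: measurable_funM; [exact: measurable_scaled_patch|exact: measurable_rpeval].
split.
  rewrite -Rintegral_usphere //; apply: eq_Rintegral => x /set_mem xs.
  by rewrite patchE mem_set //; exact: annulus_scale.
have [B B0 hB] := within_annulus_bounded g cg.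
have [C C0 hC] := rpeval_bounded 1 y.
apply: (bounded_integrable S _ SC _ (B * C)) => // x xs.
have Ax := annulus_scale t x trho xs.
rewrite normrM patchE mem_set // ler_pM // ?hB //.
by apply: hC => i; exact: usphere_coord.
Qed.

Lemma lf_intB y g h t : {within A, continuous g} -> {within A, continuous h} ->
  rho <= t <= r ->
  lf_int y (fun x => g x - h x) t = lf_int y g t - lf_int y h t.
Proof.
move=> cg ch trho.
have cgh : {within A, continuous (fun x => g x - h x)}.
  by move=> x; apply: cvgB; [exact: cg|exact: ch].
rewrite (lf_intE y _ t cgh trho).1.
have [-> ig] := lf_intE y g t cg trho; have [-> ih] := lf_intE y h t ch trho.
rewrite -RintegralB //; apply: eq_Rintegral => x _.
by rewrite !patchE; case: ifP => _; [rewrite mulrBl|rewrite !mul0r subrr].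
Qed.

(** |y| <= (1 + y^2)/2 and y has norm 1 on the sphere, so the constant depends neither on k nor on
    l. This uniformity is what makes the partial sums of the expansion uniformly bounded. *)
Lemma lf_int_bound y g t B : {within A, continuous g} -> rho <= t <= r ->
  sphere_int S (y * y) = 1 -> 0 <= B ->
  (forall x, A x -> `|g x| <= B) ->
  `|lf_int y g t| <= B * ((fine (S setT) + 1) / 2).
Proof.
move=> cg trho y1 B0 gB.
have [-> ig] := lf_intE y g t cg trho.
have mg : measurable_fun setT
    (fun x : borel_rV R d => (g \_ A) (t *: (x : 'rV[R]_d)) * rpeval y x).
  by apply/measurable_EFinP; case/integrableP: ig.
have iyy := integrable_rpeval S SC (2^-1 *: (1 + y * y)).
pose G (x : 'rV[R]_d) := B * rpeval (2^-1 *: (1 + y * y)) x.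
have iG : S.-integrable setT (EFin \o (G : borel_rV R d -> R)).
  exact: (integrableZl measurableT B iyy).
have := normr_Rintegral_concentrated S _ SC _ G mg iG; rewrite /G RintegralZl //.
rewrite -/(sphere_int S _) sphere_intZ // sphere_intD // y1.
rewrite (_ : sphere_int S 1 = fine (S setT)); last first.
  rewrite /sphere_int -[RHS]mul1r -Rintegral_cst //.
  by apply: eq_Rintegral => x _; exact: rpeval1.
rewrite [2^-1 * _]mulrC; apply => x xs.
have Ax := annulus_scale t x trho xs.
rewrite normrM patchE mem_set // ler_pM // ?gB //.
rewrite rpevalZ rpevalD rpeval1 rpevalM.
rewrite -[rpeval y x * _]expr2 -real_normK ?num_real //.
by have := sqr_ge0 (`|rpeval y x| - 1); nra.
Qed.

End laplace_fourier.

Section laplace_fourier_component.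
Context {R : realType} {d : nat}.
Variable S : {measure set (borel_rV R d) -> \bar R}.
Hypothesis SE : forall B, surface_measure B = S B.
Hypothesis SC : concentrated S usphere.
Variables (P N : {measure set (borel_rV R d) -> \bar R}) (rho r : R).
Hypotheses (PC : concentrated P (annulus rho r)) (NC : concentrated N (annulus rho r)).
Hypotheses (rho0 : 0 <= rho) (rho_r : rho < r).
Local Notation A := (@annulus R d rho r).
Local Notation clamp := (clamp rho r).
Implicit Types (g : 'rV[R]_d -> R) (p : {mpoly R[d]}).

Lemma continuous_scaled_within g x : {within A, continuous g} -> usphere x ->
  continuous (fun t => g (clamp t *: x)).
Proof.
move=> cg xs t.
have {}cg : forall z, A z -> g @ within A (nbhs z) --> g z by exact/subspace_continuousP.
have AC u : A (clamp u *: x) by apply: annulus_scale => //; exact: clamp_itv.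
have cc : clamp u *: x @[u --> t] --> clamp t *: x.
  by apply: cvgZr_tmp; exact: continuous_clamp.
apply: cvg_comp (cg _ (AC t)) => Q /cc; rewrite /= !nbhs_simpl /=.
by apply: filterS => u; apply; exact: AC.
Qed.

(** Dominated by B |y|, uniformly in the radius. *)
Lemma continuous_lf_int y g : {within A, continuous g} ->
  continuous (fun t => lf_int S y g (clamp t)).
Proof.
move=> cg t.
have [B B0 hB] := within_annulus_bounded rho r g cg.
pose f t (x : borel_rV R d) := (g \_ A) (clamp t *: (x : 'rV[R]_d)) * rpeval y x.
have fE u : lf_int S y g (clamp u) = \int[S]_x f u x /\ S.-integrable setT (EFin \o f u).
  by apply: lf_intE => //; exact: clamp_itv.
rewrite (_ : (fun _ => _) = fun u => \int[S]_x f u x); last first.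
  by apply/funext => u; rewrite (fE u).1.
have iY := integrable_rpeval S SC y.
apply: (@continuity_under_integral _ _ _ S f setT measurableT (t - 1) (t + 1) _ _
  (fun x => B * `|rpeval y x|)).
- by move=> u _; exact: (fE u).2.
- apply: (concentrated_ae S _ SC) => x xs _ u _.
  rewrite (_ : f ^~ x = fun t => g (clamp t *: x) * rpeval y x).
    by apply: cvgM; [exact: continuous_scaled_within|exact: cvg_cst].
  apply/funext => v; rewrite /f patchE mem_set //.
  by apply: annulus_scale => //; exact: clamp_itv.
- exact: (integrableZl measurableT B (integrable_norm iY)).
- move=> u _; apply: (concentrated_ae S _ SC) => x xs _.
  rewrite /f normrM ler_wpM2r // patchE mem_set ?hB //.
    by apply: annulus_scale => //; exact: clamp_itv.
  by apply: annulus_scale => //; exact: clamp_itv.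
- by rewrite inE /= in_itv /= ltrBlDr ltrDl ltr01.
Qed.

Section one_component.
Variables (k : nat) (y : {mpoly R[d]}) (nu : {measure set R -> \bar R}).
Hypothesis yk : y \is k.-homog.
Hypothesis y1 : sphere_int S (y * y) = 1.
Hypothesis nu0 : nu `]-oo, 0[%classic = 0%E.
Hypothesis nuE : signed_component P N y nu.

Definition weight k (t : R) : R := (t ^+ 2) `^ (- (k%:R / 2)).

(** The contribution of one pair (k, l) to the integral of g: the integral of g_{k,l}(t) t^(-k)
    against [nu]. *)
Definition lf_term g : R := \int[nu]_t (lf_int S y g (clamp t) * weight k t).

Definition sphere_cst : R := (fine (S setT) + 1) / 2.

Lemma sphere_cst_ge0 : 0 <= sphere_cst.
Proof. by rewrite divr_ge0 // addr_ge0 // fine_ge0. Qed.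

Let W := component_weight P N rho r PC NC rho0 rho_r k y nu yk nu0 nuE.

Let nuC := component_concentrated P N rho r PC NC rho0 rho_r y nu nu0 nuE.

Lemma measurable_lf_term g : {within A, continuous g} ->
  measurable_fun setT (fun t => lf_int S y g (clamp t) * weight k t).
Proof.
move=> cg; apply: measurable_funM; last exact: measurable_weight.
by apply: continuous_measurable_fun; exact: continuous_lf_int.
Qed.

Lemma lf_term_le g (B : R) t : {within A, continuous g} -> 0 <= B ->
  (forall x, A x -> `|g x| <= B) ->
  `|lf_int S y g (clamp t) * weight k t| <= B * sphere_cst * weight k t.
Proof.
move=> cg B0 gB; rewrite normrM (ger0_norm (powR_ge0 _ _)) ler_wpM2r ?powR_ge0 //.
by apply: (lf_int_bound S SC rho r rho0) => //; exact: clamp_itv.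
Qed.

Lemma integrable_lf_term g : {within A, continuous g} ->
  nu.-integrable setT (EFin \o (fun t => lf_int S y g (clamp t) * weight k t)).
Proof.
move=> cg; have [B B0 gB] := within_annulus_bounded rho r g cg.
apply: (le_integrable_concentrated nu _ nuC _ (fun t => B * sphere_cst * weight k t)).
- exact: measurable_lf_term.
- by move=> t _; exact: lf_term_le.
- exact: (integrableZl measurableT (B * sphere_cst) W.1).
Qed.

Lemma lf_termB g h : {within A, continuous g} -> {within A, continuous h} ->
  lf_term (fun x => g x - h x) = lf_term g - lf_term h.
Proof.
move=> cg ch; rewrite /lf_term -RintegralB //; try exact: integrable_lf_term.
apply: eq_Rintegral => t _.
by rewrite (lf_intB S SC rho r rho0) // ?clamp_itv //; ring.
Qed.

Lemma lf_term_bound g (B : R) : {within A, continuous g} -> 0 <= B ->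
  (forall x, A x -> `|g x| <= B) ->
  `|lf_term g| <= B * sphere_cst * \int[nu]_t weight k t.
Proof.
move=> cg B0 gB; rewrite -RintegralZl //; last exact: W.1.
apply: (normr_Rintegral_concentrated nu _ nuC).
- exact: measurable_lf_term.
- exact: (integrableZl measurableT (B * sphere_cst) W.1).
- by move=> t _; exact: lf_term_le.
Qed.

Lemma lf_int_homog j (p : {mpoly R[d]}) t : p \is j.-homog ->
  lf_int S y (rpeval p) t = t ^+ j * sphere_int S (p * y).
Proof.
move=> pj; rewrite /lf_int -RintegralZl //; last exact: integrable_rpeval.
rewrite -Rintegral_usphere //; last first.
  by apply: measurable_funM; [exact: measurable_cst|exact: measurable_rpeval].
by apply: eq_Rintegral => x _; rewrite (rpeval_homog _ _ _ _ _ pj) rpevalM mulrA.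
Qed.

Lemma lf_term_homog0 j (p : {mpoly R[d]}) : p \is j.-homog ->
  sphere_int S (p * y) = 0 -> lf_term (rpeval p) = 0.
Proof.
move=> pj p0; rewrite /lf_term.
under eq_Rintegral do rewrite (lf_int_homog j) // p0 mulr0 mul0r.
by rewrite Rintegral_cst // mul0r.
Qed.

Lemma rpeval_sqnorm (x : 'rV[R]_d) : rpeval sqnorm x = enorm x ^+ 2.
Proof.
rewrite enorm_sqr /sqnorm rpeval_sum; apply: eq_bigr => i _.
by rewrite !expr2 rpevalM rpevalX.
Qed.

Lemma rpeval_sqnormX i p (x : 'rV[R]_d) :
  rpeval (sqnorm ^+ i * p) x = (enorm x ^+ 2) ^+ i * rpeval p x.
Proof.
elim: i => [|i IH]; first by rewrite !expr0 !mul1r.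
by rewrite exprS -mulrA rpevalM IH rpeval_sqnorm mulrA -exprS.
Qed.

Lemma sphere_int_sqnormX i p q :
  sphere_int S (sqnorm ^+ i * p * q) = sphere_int S (p * q).
Proof.
apply: (eq_Rintegral_concentrated S _ SC); try exact: measurable_rpeval.
by move=> x xs; rewrite -mulrA rpeval_sqnormX xs expr1n expr1n mul1r.
Qed.

(** The coefficient of |x|^(2i) y is t^(2i+k); the weight cancels t^k, and the integral of the
    remaining t^(2i) against [nu] is the defining property of the component. *)
Lemma lf_term_sqnormX i :
  lf_term (rpeval (sqnorm ^+ i * y)) = signed_int P N (rpeval (sqnorm ^+ i * y)).
Proof.
have hm := sqnormX_homog i k y yk.
have cw : {within A, continuous (rpeval (sqnorm ^+ i * y))}.
  by apply: continuous_subspaceT; exact: continuous_rpeval.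
rewrite [RHS](_ : _ = \int[nu]_t ('X^i : {poly R}).[t ^+ 2]); last first.
  rewrite (component_horner P N y nu nu0 nuE) /signed_int.
  by congr (_ - _); apply: eq_Rintegral => x _; rewrite hornerXn rpeval_sqnormX.
rewrite /lf_term.
have [nf mI nI] := nuC.
(* The cancellation fails at t = 0 if k > 0, but then 0 carries no mass and is removed from the
   interval. *)
have [D DC DE] : exists2 D, concentrated nu D &
    forall t, D t -> rho <= t <= r /\ (t == 0 -> k = 0%N).
  have [k0|k0] := posnP k.
    by exists `[rho, r]%classic => // t /=; rewrite in_itv /= => h.
  exists (`[rho, r] `\` [set 0]).
    split => //; first exact: measurableD.
    rewrite setCD; apply: null_set_setU => //; first exact: measurableC.
    exact: (component_null0 P N rho r PC NC rho0 rho_r k y nu).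
  by move=> t /= [+ t0]; rewrite in_itv /= => h; split => // /eqP.
apply: (eq_Rintegral_concentrated nu _ DC).
- exact: measurable_lf_term.
- apply: continuous_measurable_fun => t.
  apply: (@continuous_comp _ _ _ (fun u : R => u ^+ 2) (horner 'X^i)).
    exact: exprn_continuous.
  exact: continuous_horner.
- move=> t /DE[trho t0k]; rewrite clamp_id // (lf_int_homog _ _ _ hm).
  rewrite sphere_int_sqnormX y1 mulr1 hornerXn /weight.
  have t0 : 0 <= t by case/andP: trho => a _; exact: le_trans a.
  rewrite (weightE k t t0) exprD exprM.
  case: eqVneq => [t00|tn0]; last by rewrite -mulrA divff ?mulr1 // expf_neq0.
  by rewrite (t0k (introT eqP t00)) eqxx expr0 !mulr1.
Qed.

End one_component.
End laplace_fourier_component.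

(** * Convergence of the Laplace-Fourier expansion of an integral *)

Lemma measurable_annulus {R : realType} {d : nat} (rho r : R) :
  measurable (annulus rho r : set (borel_rV R d)).
Proof. exact: (measurable_closed_rV d _ (closed_annulus d rho r)). Qed.

Lemma bounded_meas_patch {R : realType} {d : nat} (rho r : R) (g : 'rV[R]_d -> R) :
  {within annulus rho r, continuous g} -> bounded_meas rho r (g \_ (annulus rho r)).
Proof.
move=> cg; split.
  exact: (measurable_patch_within _ _ (measurable_annulus rho r)
    (measurable_within_continuous _ g (closed_annulus d rho r) cg)).
have [B _ gB] := within_annulus_bounded rho r g cg.
by exists B => x Ax; rewrite patchE mem_set // gB.
Qed.

Section expansion.
Context {R : realType} {d : nat}.
Hypothesis d2 : (2 <= d)%N.
Variable S : {measure set (borel_rV R d) -> \bar R}.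
Hypothesis SE : forall B, surface_measure B = S B.
Hypothesis SC : concentrated S usphere.
Variables (P N : {measure set (borel_rV R d) -> \bar R}) (rho r : R).
Hypotheses (PC : concentrated P (annulus rho r)) (NC : concentrated N (annulus rho r)).
Hypotheses (rho0 : 0 <= rho) (rho_r : rho < r).
Local Notation A := (@annulus R d rho r).
Variables (a : nat -> nat) (Y : forall k, 'I_(a k) -> {mpoly R[d]}).
Arguments Y {k}.
Hypothesis Yhomog : forall k (l : 'I_(a k)), Y l \is k.-homog.
Hypothesis Yharm : forall k (l : 'I_(a k)), laplacian (Y l) = 0.
Hypothesis Yorth : forall k (l l' : 'I_(a k)), sphere_int S (Y l * Y l') = (l == l')%:R.
Hypothesis Yspan : forall k (p : {mpoly R[d]}), p \is k.-homog -> laplacian p = 0 ->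
  exists c : 'I_(a k) -> R, p = \sum_l c l *: Y l.
Variable nu : forall k, 'I_(a k) -> {measure set R -> \bar R}.
Arguments nu {k}.
Hypothesis nu0 : forall k (l : 'I_(a k)), nu l `]-oo, 0[%classic = 0%E.
Hypothesis nuE : forall k (l : 'I_(a k)), signed_component P N (Y l) (nu l).

Definition lf_sum n (g : 'rV[R]_d -> R) : R :=
  \sum_(k < n) \sum_(l < a k) lf_term S rho r k (Y l) (nu l) g.

Let Y1 k (l : 'I_(a k)) : sphere_int S (Y l * Y l) = 1.
Proof. by rewrite Yorth eqxx. Qed.

Let termB k l g h cg ch := lf_termB S SC P N rho r PC NC rho0 rho_r k (Y l) (nu l)
  (Yhomog k l) (Y1 k l) (nu0 k l) (nuE k l) g h cg ch.

Let cont_rpeval p : {within A, continuous (rpeval p)}.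
Proof. by apply: continuous_subspaceT; exact: continuous_rpeval. Qed.

Lemma lf_sumB n g h : {within A, continuous g} -> {within A, continuous h} ->
  lf_sum n (fun x => g x - h x) = lf_sum n g - lf_sum n h.
Proof.
move=> cg ch; rewrite /lf_sum -sumrB; apply: eq_bigr => k _; rewrite -sumrB.
by apply: eq_bigr => l _; exact: termB.
Qed.

Lemma lf_sum_rpevalD n p q :
  lf_sum n (rpeval (p + q)) = lf_sum n (rpeval p) + lf_sum n (rpeval q).
Proof.
have B u v : lf_sum n (rpeval (u - v)) = lf_sum n (rpeval u) - lf_sum n (rpeval v).
  rewrite -(lf_sumB n _ _ (cont_rpeval u) (cont_rpeval v)); congr lf_sum; apply/funext => x.
  by rewrite -scaleN1r rpevalD rpevalZ mulN1r.
have Z : lf_sum n (rpeval 0) = 0 by have := B 0 0; rewrite !subrr.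
by rewrite -{1}[q]opprK B -[- q]sub0r B Z sub0r opprK.
Qed.

Let signed_rpevalD p q :
  signed_int P N (rpeval (p + q)) = signed_int P N (rpeval p) + signed_int P N (rpeval q).
Proof.
rewrite -(signed_intD P N rho r PC NC); try exact: bounded_meas_rpeval.
by congr signed_int; apply/funext => x; exact: rpevalD.
Qed.

(** Orthogonality kills every term but the matching one: across degrees by [sphere_int_harmonic],
    within a degree by the choice of basis. *)
Lemma lf_term_basis k (l : 'I_(a k)) k' (l' : 'I_(a k')) i (c : R) :
  lf_term S rho r k' (Y l') (nu l') (rpeval (c *: (sqnorm ^+ i * Y l))) =
  if (k' == k) && (val l' == val l)
  then signed_int P N (rpeval (c *: (sqnorm ^+ i * Y l))) else 0.
Proof.
have hm : c *: (sqnorm ^+ i * Y l) \is (2 * i + k)%N.-homog.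
  by apply: dhomogZ; exact: sqnormX_homog.
have sE : sphere_int S (c *: (sqnorm ^+ i * Y l) * Y l') = c * sphere_int S (Y l * Y l').
  by rewrite -scalerAl sphere_intZ // sphere_int_sqnormX.
have [kk|kk] /= := eqVneq k' k; last first.
  apply: (lf_term_homog0 S SC rho r k' (Y l') (nu l') _ _ hm).
  by rewrite sE (sphere_int_harmonic S SE SC k k') ?mulr0 // eq_sym.
subst k'; have [ll|ll] := eqVneq (val l') (val l); last first.
  apply: (lf_term_homog0 S SC rho r k (Y l') (nu l') _ _ hm).
  by rewrite sE Yorth [l == l']eq_sym -val_eqE (negPf ll) mulr0.
have -> : l' = l by exact: val_inj.
rewrite (_ : rpeval _ = fun x => c * rpeval (sqnorm ^+ i * Y l) x); last first.
  by apply/funext => x; exact: rpevalZ.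
rewrite (signed_intZ P N rho r PC NC); last exact: bounded_meas_rpeval.
rewrite -(lf_term_sqnormX S SC P N rho r PC NC rho0 rho_r k (Y l) (nu l)
  (Yhomog k l) (Y1 k l) (nu0 k l) (nuE k l)).
have hm' := sqnormX_homog i k (Y l) (Yhomog k l).
rewrite /lf_term -RintegralZl //; last first.
  by apply: (integrable_lf_term S SC P N rho r PC NC rho0 rho_r k (Y l) (nu l)
   (Yhomog k l) (Y1 k l) (nu0 k l) (nuE k l)).
apply: eq_Rintegral => t _; rewrite mulrA; congr (_ * _).
rewrite (lf_int_homog S SC _ _ _ _ hm') mulrCA -sphere_intZ // scalerAl.
rewrite -(lf_int_homog S SC _ _ _ _ hm).
by congr lf_int; apply/funext => x; rewrite rpevalZ.
Qed.

(** By the Gauss decomposition it suffices to treat |x|^(2i) Y_{k,l}, for which the partial sums are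
    exact as soon as they include degree k. *)
Lemma lf_sum_rpeval p :
  exists n0, forall n, (n0 <= n)%N -> lf_sum n (rpeval p) = signed_int P N (rpeval p).
Proof.
pose good p := exists n0, forall n, (n0 <= n)%N -> lf_sum n (rpeval p) = signed_int P N (rpeval p).
have good0 : good 0.
  exists 0%N => n _; have := lf_sum_rpevalD n 0 0; have := signed_rpevalD 0 0.
  by rewrite addr0; lra.
have goodD u v : good u -> good v -> good (u + v).
  move=> [n1 h1] [n2 h2]; exists (maxn n1 n2) => n; rewrite geq_max => /andP[a1 a2].
  by rewrite lf_sum_rpevalD h1 // h2 // signed_rpevalD.
apply: (gauss_ind good) => //; first exact: ltnW.
move=> i k h hk lh; have [c ->] := Yspan k h hk lh.
rewrite mulr_sumr; apply: (big_ind good) => // l _.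
rewrite -scalerAr; exists k.+1 => n kn.
rewrite /lf_sum (bigD1 (Ordinal kn)) //= (bigD1 l) //= lf_term_basis !eqxx /=.
rewrite big1 ?addr0; last first.
  by move=> l' ll; rewrite lf_term_basis eqxx /= val_eqE (negPf ll).
rewrite big1 ?addr0 // => k' kk; rewrite big1 // => l' _.
by rewrite lf_term_basis -val_eqE /= in kk *; rewrite (negPf kk).
Qed.

Variable Sg : R.
Hypothesis nuS : forall n, \sum_(k < n) \sum_(l < a k) \int[nu l]_t weight k t <= Sg.

Lemma lf_sum_bound n g (B : R) : {within A, continuous g} -> 0 <= B ->
  (forall x, A x -> `|g x| <= B) -> `|lf_sum n g| <= B * sphere_cst S * Sg.
Proof.
move=> cg B0 gB; rewrite (le_trans (ler_norm_sum _ _ _)) //.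
apply: (@le_trans _ _ (B * sphere_cst S * \sum_(k < n) \sum_(l < a k) \int[nu l]_t weight k t)).
  rewrite mulr_sumr; apply: ler_sum => k _.
  rewrite (le_trans (ler_norm_sum _ _ _)) // mulr_sumr; apply: ler_sum => l _.
  exact: (lf_term_bound S SC P N rho r PC NC rho0 rho_r k (Y l) (nu l)
   (Yhomog k l) (Y1 k l) (nu0 k l) (nuE k l)).
by rewrite ler_wpM2l // mulr_ge0 // sphere_cst_ge0.
Qed.

(** Uniform boundedness plus exactness on a dense set: g is replaced by a nearby polynomial, at a
    cost controlled by the bound on the partial sums and by the total mass. *)
Lemma lf_sum_cvg g : {within A, continuous g} ->
  lf_sum n g @[n --> \oo] --> signed_int P N (g \_ A).
Proof.
move=> cg; pose K := sphere_cst S * Sg + signed_mass P N.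
have Sg0 : 0 <= Sg by have := nuS 0; rewrite big_ord0.
have K0 : 0 <= K.
  by rewrite addr_ge0 ?mulr_ge0 ?sphere_cst_ge0 // signed_mass_ge0.
apply/cvgrPdist_le => e e0.
have e1 : 0 < e / (K + 1) by rewrite divr_gt0 // ltr_wpDl.
have [p hp] := continuous_approximable _ (compact_annulus d rho r) g cg _ e1.
have [n0 hn0] := lf_sum_rpeval p.
near=> n; have nn : (n0 <= n)%N by near: n; exact: nbhs_infty_ge.
rewrite distrC.
have -> : lf_sum n g - signed_int P N (g \_ A) =
    lf_sum n (fun x => g x - rpeval p x) - signed_int P N (fun x => (g \_ A) x - rpeval p x).
  rewrite (lf_sumB n _ _ cg (cont_rpeval p)) hn0 //.
  have mg := bounded_meas_patch rho r g cg.
  have mp := bounded_meas_rpeval (d := d) rho r p.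
  rewrite (_ : (fun x => (g \_ A) x - _) = fun x => (g \_ A) x + (-1) * rpeval p x).
    rewrite (signed_intD P N rho r PC NC) //.
      by rewrite (signed_intZ P N rho r PC NC) //; ring.
    split; first by apply: measurable_funM; [exact: measurable_cst|exact: mp.1].
    by have [B hB] := mp.2; exists B => x Ax; rewrite normrM normrN1 mul1r hB.
  by apply/funext => x; rewrite mulN1r.
rewrite (le_trans (ler_normB _ _)) //.
have cgp : {within A, continuous (fun x => g x - rpeval p x)}.
  by move=> x; apply: cvgB; [exact: cg|exact: cont_rpeval].
apply: (@le_trans _ _ (e / (K + 1) * K)); last first.
  by rewrite mulrAC ler_pdivrMr ?ltr_wpDl // ler_wpM2l ?lerDl // ltW.
rewrite /K mulrDr lerD //.
  by rewrite mulrA lf_sum_bound // ltW.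
apply: (signed_int_bound P N rho r PC NC).
  apply: measurable_funB; last exact: measurable_rpeval.
  exact: (bounded_meas_patch rho r g cg).1.
by move=> x Ax; rewrite patchE mem_set // hp.
Unshelve. all: by end_near. Qed.

End expansion.

(** * Repeated Rolle and the remainder of Hermite interpolation *)

Section hermite.
Context {R : realType}.
Implicit Types (F G : R -> R) (a b t x : R) (xs zs : seq R).

(* [Fs i] is the [i]-th derivative of [Fs 0] on ]a, b[, for [i <= n]. *)
Definition jet n a b (Fs : nat -> R -> R) := forall i x, (i < n)%N ->
  x \in `]a, b[ -> is_derive x 1 (Fs i) (Fs i.+1 x).

Lemma jet_derive1n n a b (Fs : nat -> R -> R) F : jet n a b Fs ->
  {in `]a, b[, F =1 Fs 0} ->
  forall i, (i <= n)%N -> {in `]a, b[, derive1n i F =1 Fs i}.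
Proof.
move=> hj h0; elim=> [//|i IH] lin x xab.
rewrite derive1nS derive1E.
have H := hj i x lin xab.
have -> : 'D_1 (derive1n i F) x = 'D_1 (Fs i) x.
  apply: near_eq_derive.
  near=> y; apply: IH; first exact: ltnW.
  near: y; exact: near_in_itvoo.
by rewrite derive_val.
Unshelve. all: by end_near. Qed.

(** One Rolle point in each gap of the increasing list. The points are recorded as different from
    the old zeros because [hermite_error] adds them to the nodes. *)
Lemma rolle_seq a b (G G' : R -> R) x zs :
  (forall y, y \in `]a, b[ -> is_derive y 1 G (G' y)) ->
  (forall y, y \in x :: zs -> (y \in `]a, b[) /\ G y = 0) -> path <%R x zs ->
  exists ys, [/\ size ys = size zs, uniq ys &
    forall y, y \in ys -> [/\ x < y, y \in `]a, b[, y \notin x :: zs & G' y = 0]].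
Proof.
move=> hG; elim: zs x => [|z zs IH] x h0 /=; first by exists [::].
move=> /andP[xz pz].
have [|//|ys [szy uy hy]] := IH z.
  by move=> y yz; apply: h0; rewrite inE yz orbT.
have [xab Gx] := h0 x (mem_head _ _).
have [zab Gz] : (z \in `]a, b[) /\ G z = 0 by apply: h0; rewrite !inE eqxx orbT.
have sub y : y \in `[x, z] -> y \in `]a, b[.
  move: xab zab; rewrite !in_itv /= => /andP[ax xb] /andP[az zb] /andP[xy yz].
  by rewrite (lt_le_trans ax) // (le_lt_trans yz).
have [] := @Rolle R G x z xz.
- move=> y yxz; have := hG y (sub y (subset_itv_oo_cc yxz)).
  by case.
- apply: derivable_within_continuous => y yxz.
  by have := hG y (sub y yxz); case.
- by rewrite Gx Gz.
move=> c cxz dc; have cab := sub c (subset_itv_oo_cc cxz).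
have Gc : G' c = 0.
  have := hG c cab => -[_ <-]; by case: dc.
move: (cxz); rewrite in_itv /= => /andP[xc cz].
have zlt y : y \in zs -> z < y.
  by move: pz; rewrite (path_sortedE lt_trans) => /andP[/allP h _] /h.
have nxs y : z < y -> y != x.
  by move=> zy; rewrite gt_eqF // (lt_trans xz).
exists (c :: ys); split; first by rewrite /= szy.
  rewrite /= uy andbT; apply/negP => /hy[zc _ _ _].
  by have := lt_trans zc cz; rewrite ltxx.
move=> y; rewrite inE => /predU1P[->|/hy[zy yab nin G0]].
  split => //; rewrite !inE !negb_or gt_eqF //= lt_eqF //=.
  by apply/negP => /zlt /(lt_trans cz); rewrite ltxx.
by split => //; [exact: lt_trans zy|rewrite inE negb_or nxs].
Qed.

Lemma multi_rolle n a b (Gs : nat -> R -> R) zs : jet n a b Gs -> uniq zs ->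
  size zs = n.+1 -> (forall y, y \in zs -> (y \in `]a, b[) /\ Gs 0%N y = 0) ->
  exists2 xi, xi \in `]a, b[ & Gs n xi = 0.
Proof.
elim: n Gs zs => [|n IH] Gs zs hj uz sz hz.
  case: zs uz sz hz => [//|z zs] _ _ /(_ z (mem_head _ _))[zab G0]; by exists z.
have := uz; rewrite -(sort_uniq <=%R) => us.
have ss : sorted <%R (sort <=%R zs).
  by rewrite lt_sorted_uniq_le us sort_le_sorted.
case E : (sort <=%R zs) ss => [|x xs] ss.
  by have := sz; rewrite -(size_sort <=%R) E.
have [||//|ys [sy uy hy]] := @rolle_seq a b (Gs 0%N) (Gs 1%N) x xs.
- by move=> y yab; apply: hj.
- by move=> y; rewrite -E mem_sort => /hz.
apply: (IH (fun i => Gs i.+1) ys) => //.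
- by move=> i y lin yab; apply: hj.
- by rewrite sy; have := sz; rewrite -(size_sort <=%R) E => -[].
- by move=> y /hy[].
Qed.

Lemma jet_horner n a b (p : {poly R}) : jet n a b (fun i => horner (derivn i p)).
Proof. by move=> i x _ _; rewrite derivnS; apply: is_derive_poly. Qed.

Lemma jet_comb n a b (Fs Gs : nat -> R -> R) (c e : R) : jet n a b Fs -> jet n a b Gs ->
  jet n a b (fun i x => c * Fs i x + e * Gs i x).
Proof.
move=> hF hG i x lin xab.
have := hF i x lin xab; have := hG i x lin xab => dG dF.
exact: (is_deriveD (is_deriveZ _ _) (is_deriveZ _ _)).
Qed.

Definition nodal xs : {poly R} := \prod_(x <- xs) ('X - x%:P).

Lemma nodal_monic xs : nodal xs \is monic.
Proof. exact: monic_prod_XsubC. Qed.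

Lemma size_nodal xs : size (nodal xs) = (size xs).+1.
Proof. exact: size_prod_XsubC. Qed.

Lemma nodal_eq0 xs t : ((nodal xs).[t] == 0) = (t \in xs).
Proof. by rewrite -rootE root_prod_XsubC. Qed.

Lemma derivn_monic (p : {poly R}) n : p \is monic -> size p = n.+1 ->
  derivn n p = (n`!)%:R%:P.
Proof.
move=> /monicP lp sp; apply/polyP => i; rewrite coef_derivn coefC.
case: i => [|i] /=.
  by rewrite addn0 ffactnn -{1}[n]/(n.+1.-1) -sp -lead_coefE lp.
by rewrite nth_default ?mul0rn // sp addnS ltnS leq_addr.
Qed.

(** Newton's scheme: a new node x is handled by adding a linear factor times the squared node
    polynomial of the earlier nodes, which disturbs neither values nor derivatives there. *)
Lemma hermite_interpolation xs (u v : R -> R) : uniq xs ->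
  exists H : {poly R}, (size H <= 2 * size xs)%N /\
   {in xs, forall x, H.[x] = u x /\ H^`().[x] = v x}.
Proof.
elim: xs => [|x xs IH] /=; first by exists 0; rewrite size_poly0.
move=> /andP[xn /IH[H [sH hH]]].
pose w := (nodal xs) ^+ 2.
have w0 : w.[x] != 0 by rewrite horner_exp expf_neq0 // nodal_eq0.
(* [al] corrects the value at x; [be] then corrects the derivative and leaves the value alone. *)
pose al := (u x - H.[x]) / w.[x].
pose be := (v x - H^`().[x] - al * w^`().[x]) / w.[x].
exists (H + (al%:P + be *: ('X - x%:P)) * w); split.
  apply: (leq_trans (size_polyD _ _)); rewrite geq_max.
  apply/andP; split; first by apply: (leq_trans sH); rewrite leq_mul2l leqnSn orbT.
  apply: (leq_trans (size_polyMleq _ _)).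
  have s1 : (size (al%:P + be *: ('X - x%:P))%R <= 2)%N.
    apply: (leq_trans (size_polyD _ _)); rewrite geq_max.
    rewrite (leq_trans (size_polyC_leq1 _)) //=.
    by rewrite (leq_trans (size_scale_leq _ _)) // size_XsubC.
  have s2 : size w = (2 * size xs).+1.
    rewrite /w expr2 size_Mmonic ?nodal_monic ?monic_neq0 ?nodal_monic //.
    by rewrite !size_nodal mul2n -addnn addnS.
  rewrite s2 addnS /= mulnS.
  by rewrite leq_add2r.
move=> y; rewrite inE => /predU1P[->|yxs].
  have E1 : (H + (al%:P + be *: ('X - x%:P)) * w).[x] = H.[x] + al * w.[x].
    rewrite hornerD hornerM !hornerD hornerZ hornerXsubC subrr mulr0 hornerC.
    by rewrite addr0.
  have E2 : (H + (al%:P + be *: ('X - x%:P)) * w)^`().[x] =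
      H^`().[x] + be * w.[x] + al * w^`().[x].
    rewrite derivD derivM derivD derivC derivZ derivXsubC add0r alg_polyC.
    rewrite !hornerD !hornerM !hornerD hornerZ hornerXsubC subrr mulr0 !hornerC.
    by rewrite addr0 addrA.
  by rewrite E1 E2 /be /al !divfK //; split; ring.
have [e1 e2] := hH y yxs.
have wy : (nodal xs).[y] = 0 by apply/eqP; rewrite nodal_eq0.
have w1 : w.[y] = 0 by rewrite horner_exp wy expr0n.
have w2 : w^`().[y] = 0.
  by rewrite /w expr2 derivM hornerD !hornerM wy mulr0 mul0r addr0.
clearbody w; split; first by rewrite hornerD hornerM w1 mulr0 addr0.
by rewrite derivD derivM !hornerD !hornerM w1 w2 !mulr0 !addr0.
Qed.

(** With w the squared node polynomial and K chosen so that G = F - H - K w vanishes at t, the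
    function G vanishes at the nodes and at t. Rolle gives as many new zeros of G' as there are
    nodes, and G' also vanishes at the nodes; further applications of Rolle give a zero of the
    derivative of order 2|xs|, where H drops out and w contributes (2|xs|)!. *)
Lemma hermite_error a b (Fs : nat -> R -> R) xs (H : {poly R}) t :
  uniq xs -> (0 < size xs)%N -> jet (2 * size xs) a b Fs ->
  {in xs, forall x, x \in `]a, b[} -> (size H <= 2 * size xs)%N ->
  {in xs, forall x, H.[x] = Fs 0%N x /\ H^`().[x] = Fs 1%N x} ->
  t \in `]a, b[ ->
  exists2 xi, xi \in `]a, b[ & Fs 0%N t - H.[t] =
    Fs (2 * size xs)%N xi / ((2 * size xs)`!)%:R * (nodal xs).[t] ^+ 2.
Proof.
move=> ux sx hj xab sH hH tab.
(* At a node both sides vanish and any point serves as xi. *)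
have [txs|txs] := boolP (t \in xs).
  exists t => //; have /eqP -> : (nodal xs).[t] == 0 by rewrite nodal_eq0.
  by have [-> _] := hH t txs; rewrite subrr expr0n mulr0.
pose w := (nodal xs) ^+ 2.
have wt : w.[t] != 0 by rewrite horner_exp expf_neq0 // nodal_eq0.
have wE : w.[t] = (nodal xs).[t] ^+ 2 by rewrite horner_exp.
have wm : w \is monic by apply: monic_exp; exact: nodal_monic.
have sw : size w = (2 * size xs).+1.
  rewrite /w expr2 size_Mmonic ?nodal_monic ?monic_neq0 ?nodal_monic //.
  by rewrite !size_nodal mul2n -addnn addnS.
have wx x : x \in xs -> w.[x] = 0 /\ w^`().[x] = 0.
  move=> xxs; have wy : (nodal xs).[x] = 0 by apply/eqP; rewrite nodal_eq0.
  split; first by rewrite horner_exp wy expr0n.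
  by rewrite /w expr2 derivM hornerD !hornerM wy mulr0 mul0r addr0.
clearbody w.
pose K := (Fs 0%N t - H.[t]) / w.[t].
have KE : K * w.[t] = Fs 0%N t - H.[t] by rewrite /K divfK.
pose q := H + K *: w.
pose Gs i x := 1 * Fs i x + (-1) * (derivn i q).[x].
have jG : jet (2 * size xs) a b Gs by apply: jet_comb => //; exact: jet_horner.
have G0t : Gs 0%N t = 0.
  by rewrite /Gs /q derivn0 hornerD hornerZ KE; lra.
have G0 x : x \in xs -> Gs 0%N x = 0.
  move=> xxs; have [e1 e2] := hH x xxs; have [w1 w2] := wx x xxs.
  by rewrite /Gs /q derivn0 hornerD hornerZ w1 e1; lra.
have G1 x : x \in xs -> Gs 1%N x = 0.
  move=> xxs; have [e1 e2] := hH x xxs; have [w1 w2] := wx x xxs.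
  by rewrite /Gs /q derivn1 derivD derivZ hornerD hornerZ w2 e2; lra.
pose zs := t :: xs.
have ss : sorted <%R (sort <=%R zs).
  by rewrite lt_sorted_uniq_le sort_uniq /= txs ux sort_le_sorted.
case E : (sort <=%R zs) ss => [|x xs'] ss.
  by have := size_sort <=%R zs; rewrite E.
have memE y : (y \in x :: xs') = (y \in zs) by rewrite -E mem_sort.
have [||//|ys [sy uy hy]] := @rolle_seq a b (Gs 0%N) (Gs 1%N) x xs'.
- move=> y yab; apply: jG => //; by rewrite muln_gt0.
- by move=> y; rewrite memE inE => /predU1P[->|yxs]; split; auto.
(* Applied to G', whose 2|xs| zeros are the nodes and the Rolle points; hence the order 2|xs| -
   1. *)
have [||||xi xiab Gxi] := @multi_rolle (2 * size xs).-1 a b (fun i => Gs i.+1) (xs ++ ys).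
- move=> i y lin yab; apply: jG => //.
  by move: lin; rewrite -ltnS prednK ?muln_gt0.
- rewrite cat_uniq ux uy andbT /=; apply/hasPn => y /hy[_ _ + _].
  by rewrite memE inE negb_or => /andP[].
- rewrite size_cat sy prednK ?muln_gt0 //.
  have := size_sort <=%R zs; rewrite E => -[->].
  by rewrite mul2n addnn.
- move=> y; rewrite mem_cat => /orP[yxs|/hy[_ yab _ G1y]]; last by [].
  by split; [exact: xab|exact: G1].
exists xi => //; move: Gxi; rewrite prednK ?muln_gt0 // /Gs /q.
rewrite derivnD derivnZ derivn_poly0 // add0r (derivn_monic w (2 * size xs)) //.
rewrite hornerZ hornerC => eF.
have -> : Fs (2 * size xs)%N xi = K * (2 * size xs)`!%:R by lra.
rewrite mulfK ?pnatr_eq0 -?lt0n ?fact_gt0 //.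
by rewrite -wE KE.
Qed.

End hermite.

(** * Gauss quadrature on an interval *)

Lemma measurable_horner {R : realType} (p : {poly R}) :
  measurable_fun setT (horner p).
Proof. by apply: continuous_measurable_fun; exact: continuous_horner. Qed.

Section quadrature.
Context {R : realType}.
Variables (m n : {measure set R -> \bar R}) (al be : R) (s : nat) (xs : seq R).
Implicit Types (p q : {poly R}) (F : R -> R).
Local Notation W := (nodal xs).

Hypotheses (mC : concentrated m `[al, be]) (nC : concentrated n `[al, be]).
Hypothesis exact : forall p, (size p <= 2 * s)%N ->
  \int[m]_x p.[x] = \int[n]_x p.[x].
Hypotheses (uxs : uniq xs) (sxs : (size xs <= s)%N).
Hypothesis xsI : forall x, x \in xs -> x \in `[al, be].
Hypothesis nxs : n (~` [set` xs]) = 0%E.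

Lemma horner_bounded p : exists B, forall x, x \in `[al, be] -> `|p.[x]| <= B.
Proof.
elim/poly_ind: p => [|p c [B hB]].
  by exists 0 => x _; rewrite horner0 normr0.
exists (B * Num.max `|al| `|be| + `|c|) => x xab.
rewrite hornerD hornerC hornerMX.
rewrite (le_trans (ler_normD _ _)) // lerD2r normrM ler_pM //; first exact: hB.
move: xab; rewrite in_itv /= => /andP[ax xb]; rewrite le_max.
have [x0|x0] := lerP 0 x.
  by rewrite (ger0_norm x0) (le_trans xb (ler_norm _)) orbT.
rewrite (ltr0_norm x0); apply/orP; left; rewrite -(normrN al).
by apply: le_trans (ler_norm _); rewrite lerN2.
Qed.

Lemma integrable_horner (k : {measure set R -> \bar R}) p :
  concentrated k `[al, be] -> k.-integrable setT (EFin \o horner p).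
Proof.
move=> kC; have [B hB] := horner_bounded p.
by apply: (bounded_integrable _ _ kC _ B) => //; exact: measurable_horner.
Qed.

Let kx : concentrated n [set` xs].
Proof.
have [nf _ _] := nC; split => //.
apply: countable_measurable; first exact: measurable_set1.
by apply: finite_set_countable; apply/finite_seqP; exists xs.
Qed.

Let nodal_sq_ge0 x : 0 <= (W ^+ 2).[x].
Proof. by rewrite horner_exp sqr_ge0. Qed.

Lemma nodal_null_concentrated : \int[m]_x (W ^+ 2).[x] = 0 ->
  concentrated m [set` xs].
Proof.
move=> W0; have [mf mI m0] := mC; have [_ mxs _] := kx; split => //.
have := Rintegral_eq0_concentrated m _ mC _ (integrable_horner m (W ^+ 2) mC)
  (fun x _ => nodal_sq_ge0 x) W0.
set N := [set x | _] => N0.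
have mN : measurable N.
  rewrite (_ : N = `[al, be] `&` ~` (horner (W ^+ 2) @^-1` [set 0])).
    apply: measurableI => //; apply: measurableC.
    by rewrite -[X in measurable X]setTI; exact: measurable_horner.
  by apply/seteqP; split.
have sub : ~` [set` xs] `<=` N `|` ~` `[al, be].
  move=> x /= nx; have [xI|] := pselect (`[al, be]%classic x); last by right.
  left; split => //; apply/eqP; rewrite horner_exp expf_neq0 // nodal_eq0.
  exact/negP.
have mCI : measurable (~` `[al, be]%classic) by exact: measurableC.
apply: (subset_measure0 _ _ sub) => //; [exact: measurableC|exact: measurableU|].
exact: null_set_setU.
Qed.

(** If the squared node polynomial has integral 0, then [m] lives on the nodes as [n] does, where F
    coincides with a polynomial of degree < 2s. *)
Lemma quadrature_degenerate F : \int[m]_x (W ^+ 2).[x] = 0 ->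
  measurable_fun setT F -> \int[m]_x F x = \int[n]_x F x.
Proof.
move=> /nodal_null_concentrated mx mF.
(* Only the values at the nodes matter; the prescribed derivatives are arbitrary. *)
have [H [sH hH]] := hermite_interpolation xs F F uxs.
have FH x : [set` xs] x -> F x = H.[x] by move=> /hH[].
rewrite (eq_Rintegral_concentrated m _ mx F (horner H)) //; last exact: measurable_horner.
rewrite (eq_Rintegral_concentrated n _ kx F (horner H)) //; last exact: measurable_horner.
by apply: exact; rewrite (leq_trans sH) // leq_mul2l sxs orbT.
Qed.

Lemma Rintegral_nodal_vanish p : \int[n]_x (W * p).[x] = 0.
Proof.
rewrite (eq_Rintegral_concentrated n _ kx _ (fun=> 0)) ?Rintegral_cst ?mul0r //.
  exact: measurable_horner.
move=> x /= xx; rewrite hornerM; have := nodal_eq0 xs x.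
by rewrite xx => /eqP ->; rewrite mul0r.
Qed.

Lemma integrable_hornerD (k : {measure set R -> \bar R}) p q :
  concentrated k `[al, be] ->
  \int[k]_x (p + q).[x] = \int[k]_x p.[x] + \int[k]_x q.[x].
Proof.
move=> kC; rewrite -RintegralD //; try exact: integrable_horner.
by apply: eq_Rintegral => x _; rewrite hornerD.
Qed.

Hypothesis Wpos : \int[m]_x (W ^+ 2).[x] != 0.

(** With fewer than s nodes the squared node polynomial would have degree < 2s, and exactness would
    force its integral to be 0. *)
Lemma quadrature_size : size xs = s.
Proof.
apply/eqP; rewrite eqn_leq sxs leqNgt; apply/negP => lt.
move/eqP: Wpos; apply; rewrite exact.
  by rewrite expr2 Rintegral_nodal_vanish.
rewrite expr2 size_Mmonic ?nodal_monic ?monic_neq0 ?nodal_monic // !size_nodal.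
by rewrite addSn /= mul2n -addnn leq_add // ltnW.
Qed.

Lemma nodal_orthogonal p : (size p <= s)%N -> \int[m]_x (W * p).[x] = 0.
Proof.
move=> sp; rewrite exact ?Rintegral_nodal_vanish //.
apply: (leq_trans (size_polyMleq _ _)); rewrite size_nodal addSn /=.
by rewrite mul2n -addnn leq_add.
Qed.

Lemma quadrature_interior x : x \in xs -> x \in `]al, be[.
Proof.
move=> xxs; have xI := xsI x xxs.
(* If a node x were an endpoint, W^2 / (t - x) would have constant sign on
   [al, be] and integral 0, so m would live on the nodes. *)
have Wx : W = ('X - x%:P) * \prod_(y <- rem x xs) ('X - y%:P).
  by rewrite /nodal (perm_big _ (perm_to_rem xxs)) /= big_cons.
set V := \prod_(y <- rem x xs) ('X - y%:P) in Wx.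
have sV : (size V <= s)%N.
  rewrite size_prod_XsubC size_rem // prednK //.
  by move: xxs; case: (xs).
have i0 : \int[m]_t (W * V).[t] = 0 by apply: nodal_orthogonal.
have main (c : R) : c != 0 -> (forall t, t \in `[al, be] -> 0 <= c * (t - x)) -> False.
  move=> c0 ht; move/eqP: Wpos; apply.
  have := Rintegral_eq0_concentrated m _ mC _ (integrable_horner m (c *: (W * V)) mC).
  have pos t : `[al, be]%classic t -> 0 <= (c *: (W * V)).[t].
    move=> /ht tx.
    have -> : (c *: (W * V)).[t] = c * (t - x) * V.[t] ^+ 2.
      by rewrite hornerZ hornerM Wx hornerM hornerXsubC; ring.
    by rewrite mulr_ge0 // sqr_ge0.
  have z0 : \int[m]_t (c *: (W * V)).[t] = 0.
    under eq_Rintegral do rewrite hornerZ.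
    by rewrite RintegralZl // ?i0 ?mulr0 //; exact: integrable_horner.
  move=> /(_ pos z0).
  set N := [set t | _] => N0.
  have mN : measurable N.
    rewrite (_ : N = `[al, be] `&` ~` (horner (c *: (W * V)) @^-1` [set 0])).
      apply: measurableI => //; apply: measurableC.
      by rewrite -[X in measurable X]setTI; exact: measurable_horner.
    by apply/seteqP; split.
  have mI : concentrated m (`[al, be] `\` N).
    have [mf mI m0] := mC; split => //; first exact: measurableD.
    rewrite setCD; apply: null_set_setU => //; exact: measurableC.
  rewrite (eq_Rintegral_concentrated m _ mI _ (fun=> 0)) ?Rintegral_cst ?mul0r //.
    exact: measurable_horner.
  move=> t [tI]; rewrite /N /= => /not_andP[//|/contrapT].
  rewrite hornerZ hornerM => /eqP; rewrite mulf_eq0 (negbTE c0) /= mulf_eq0.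
  rewrite horner_exp Wx hornerM => /orP[/eqP -> |/eqP ->]; first by rewrite expr0n.
  by rewrite mulr0 expr0n.
move: xI; rewrite !in_itv /= => /andP[ax xb].
rewrite !lt_neqAle ax xb !andbT; apply/andP; split; apply/eqP => e.
  apply: (main 1); rewrite ?oner_neq0 // => t; rewrite in_itv /= => /andP[+ _].
  by rewrite mul1r subr_ge0 e.
apply: (main (-1)); rewrite ?oppr_eq0 ?oner_neq0 // => t; rewrite in_itv /= => /andP[_].
by rewrite mulN1r opprB subr_ge0 e.
Qed.

(** W - Q has degree < s, both polynomials being monic of degree s, so W^2 - Q^2 = (W + Q)(W - Q)
    integrates to 0 by orthogonality. *)
Lemma nodal_sq_monic_orthogonal Q : Q \is monic -> size Q = s.+1 ->
  (forall p, (size p <= s)%N -> \int[m]_x (Q * p).[x] = 0) ->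
  \int[m]_x (W ^+ 2).[x] = \int[m]_x (Q ^+ 2).[x].
Proof.
move=> Qm sQ hQ.
have sD : (size (W - Q)%R <= s)%N.
  have [->|nz] := eqVneq (W - Q) 0; first by rewrite size_poly0.
  have : (size (W - Q)%R <= s.+1)%N.
    rewrite (leq_trans (size_polyD _ _)) // geq_max size_polyN sQ size_nodal.
    by rewrite quadrature_size leqnn.
  rewrite leq_eqVlt => /orP[/eqP e|//].
  suff : lead_coef (W - Q) == 0 by rewrite lead_coef_eq0 (negbTE nz).
  rewrite lead_coefE e coefB /=.
  have /monicP := nodal_monic xs; rewrite lead_coefE size_nodal quadrature_size /= => ->.
  by move/monicP: Qm; rewrite lead_coefE sQ /= => ->; rewrite subrr.
have -> : W ^+ 2 = Q ^+ 2 + (W * (W - Q) + Q * (W - Q)) by ring.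
by rewrite !integrable_hornerD // nodal_orthogonal // hQ // !addr0.
Qed.

Hypothesis s0 : (0 < s)%N.

(** H agrees with F at the nodes, so the integral of F under [n] is that of H, and by exactness the
    integral of H under [m]. *)
Lemma quadrature_hermite F (Fs : nat -> R -> R) : jet (2 * s) al be Fs ->
  (forall x, x \in `]al, be[ -> F x = Fs 0%N x) -> measurable_fun setT F ->
  exists2 H : {poly R}, \int[n]_x F x = \int[m]_x H.[x] &
    forall t, t \in `]al, be[ -> exists2 xi, xi \in `]al, be[ &
      F t - H.[t] = Fs (2 * s)%N xi / ((2 * s)`!)%:R * (W ^+ 2).[t].
Proof.
move=> hj hF mF.
have [H [sH hH]] := hermite_interpolation xs (Fs 0%N) (Fs 1%N) uxs.
exists H.
  rewrite exact -?quadrature_size //.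
  apply: (eq_Rintegral_concentrated n _ kx) => //; first exact: measurable_horner.
  by move=> x /= xx; rewrite (hH x xx).1 hF // quadrature_interior.
move=> t tI; rewrite hF // horner_exp -quadrature_size.
apply: hermite_error; rewrite ?quadrature_size //.
- by move=> x /quadrature_interior.
- by rewrite -quadrature_size.
Qed.

End quadrature.

(** * Sign and size of the quadrature error *)

Section quadrature_bounds.
Context {R : realType}.
Variables (m n : {measure set R -> \bar R}) (al be : R) (s : nat) (xs : seq R).
Implicit Types (p q : {poly R}) (F : R -> R).
Local Notation W := (nodal xs).

Hypotheses (albe : al < be).
Hypotheses (mC : concentrated m `[al, be]) (nC : concentrated n `[al, be]).
Hypothesis exact : forall p, (size p <= 2 * s)%N ->
  \int[m]_x p.[x] = \int[n]_x p.[x].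
Hypotheses (uxs : uniq xs) (sxs : (size xs <= s)%N).
Hypothesis xsI : forall x, x \in xs -> x \in `[al, be].
Hypothesis nxs : n (~` [set` xs]) = 0%E.
Hypothesis s0 : (0 < s)%N.
Variables (F : R -> R) (Fs : nat -> R -> R).
Hypotheses (hj : jet (2 * s) al be Fs)
  (hF : forall x, x \in `]al, be[ -> F x = Fs 0%N x) (mF : measurable_fun setT F).
Hypothesis Fal : m [set al] = 0%E \/ F x @[x --> al^'+] --> F al.
Hypothesis Fbe : F x @[x --> be^'-] --> F be.

Lemma le0_at_right (G : R -> R) : (forall t, t \in `]al, be[ -> G t <= 0) ->
  G x @[x --> al^'+] --> G al -> G al <= 0.
Proof.
move=> hG cG; apply: (@closed_cvg _ _ _ _ G [set y | y <= 0] _ _ _ cG).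
  exact: closed_le.
near=> x; apply: hG; rewrite in_itv /=; apply/andP; split; near: x.
  exact: nbhs_right_gt.
exact: nbhs_right_lt.
Unshelve. all: by end_near. Qed.

Lemma le0_at_left (G : R -> R) : (forall t, t \in `]al, be[ -> G t <= 0) ->
  G x @[x --> be^'-] --> G be -> G be <= 0.
Proof.
move=> hG cG; apply: (@closed_cvg _ _ _ _ G [set y | y <= 0] _ _ _ cG).
  exact: closed_le.
near=> x; apply: hG; rewrite in_itv /=; apply/andP; split; near: x.
  exact: nbhs_left_gt.
exact: nbhs_left_lt.
Unshelve. all: by end_near. Qed.

Lemma horner_at_right p : p.[x] @[x --> al^'+] --> p.[al].
Proof. by apply: cvg_at_right_filter; exact: continuous_horner. Qed.

Lemma horner_at_left p : p.[x] @[x --> be^'-] --> p.[be].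
Proof. by apply: cvg_at_left_filter; exact: continuous_horner. Qed.

(** The remainder formula holds on the open interval only. At the right endpoint the inequality
    follows by continuity; at the left one either by continuity or by discarding the point as null,
    which covers the singularity of t^(-k/2) at 0. *)
Lemma concentrated_extension (G : R -> R) :
  (forall t, t \in `]al, be[ -> G t <= 0) ->
  (F x @[x --> al^'+] --> F al -> G x @[x --> al^'+] --> G al) ->
  G x @[x --> be^'-] --> G be ->
  exists2 A, concentrated m A & forall x, A x -> G x <= 0.
Proof.
move=> hG Gal Gbe.
have Gbe0 := le0_at_left G hG Gbe.
have [mf mI m0] := mC.
have [mal|Fcv] := Fal.
  exists `]al, be]%classic.
    split => //.
    rewrite (_ : `]al, be]%classic = `[al, be] `\` [set al]); last first.
      by rewrite setDitv1l.
    rewrite setCD; apply: null_set_setU => //; exact: measurableC.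
  move=> x /=; rewrite in_itv /= => /andP[ax]; rewrite le_eqVlt.
  by move=> /predU1P[->//|xb]; apply: hG; rewrite in_itv /= ax.
exists `[al, be]%classic => // x /=; rewrite in_itv /= => /andP[].
rewrite le_eqVlt => /predU1P[<- _|ax]; first exact: (le0_at_right G hG (Gal Fcv)).
by rewrite le_eqVlt => /predU1P[->//|xb]; apply: hG; rewrite in_itv /= ax.
Qed.

(** A nonnegative derivative of order 2s puts the Hermite interpolant below F. *)
Lemma quadrature_le : (forall x, x \in `]al, be[ -> 0 <= Fs (2 * s)%N x) ->
  m.-integrable setT (EFin \o F) -> \int[n]_x F x <= \int[m]_x F x.
Proof.
move=> F2 iF.
have [W0|W0] := eqVneq (\int[m]_x (W ^+ 2).[x]) 0.
  by rewrite (quadrature_degenerate m n al be s xs mC nC exact uxs sxs nxs F W0 mF).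
have [H -> hH] := quadrature_hermite m n al be s xs mC nC exact uxs sxs xsI nxs W0
  s0 F Fs hj hF mF.
have [|||A Ac hA] := @concentrated_extension (fun x => H.[x] - F x).
- move=> t /hH[xi xiI E]; rewrite -oppr_ge0 opprB E mulr_ge0 //.
    by rewrite divr_ge0 // F2.
  by rewrite horner_exp sqr_ge0.
- by move=> cF; apply: cvgB => //; exact: horner_at_right.
- by apply: cvgB => //; exact: horner_at_left.
apply: (le_Rintegral_concentrated _ _ Ac) => //.
- exact: (integrable_horner al be).
- by move=> x /hA; rewrite subr_le0.
Qed.

(** |F - H| is at most M/(2s)! times the squared node polynomial, whose integral is that of Q^2. If
    the former integral is 0, there is no error and nothing is required of Q. *)
Lemma quadrature_error M (Q : {poly R}) :
  (forall x, x \in `]al, be[ -> `|Fs (2 * s)%N x| <= M) ->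
  (\int[m]_x (W ^+ 2).[x] != 0 -> [/\ Q \is monic, size Q = s.+1 &
    forall p, (size p <= s)%N -> \int[m]_x (Q * p).[x] = 0]) ->
  `|\int[m]_x F x - \int[n]_x F x| <= M / ((2 * s)`!)%:R * \int[m]_x (Q ^+ 2).[x].
Proof.
move=> F2 hQ.
have M0 : 0 <= M.
  apply: le_trans (F2 ((al + be) / 2) _); first by [].
  by rewrite mid_in_itvoo.
have [W0|W0] := eqVneq (\int[m]_x (W ^+ 2).[x]) 0.
  rewrite (quadrature_degenerate m n al be s xs mC nC exact uxs sxs nxs F W0 mF).
  rewrite subrr normr0 mulr_ge0 //; first by rewrite divr_ge0.
  by apply: Rintegral_ge0 => x _; rewrite horner_exp sqr_ge0.
have [Qm sQ oQ] := hQ W0.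
have [H -> hH] := quadrature_hermite m n al be s xs mC nC exact uxs sxs xsI nxs W0
  s0 F Fs hj hF mF.
have <- := nodal_sq_monic_orthogonal m n al be s xs mC nC exact sxs nxs W0 Q Qm sQ oQ.
pose c := M / ((2 * s)`!)%:R.
have [|||A Ac hA] := @concentrated_extension
    (fun x => `|F x - H.[x]| - (c *: W ^+ 2).[x]).
- move=> t /hH[xi xiI ->]; rewrite subr_le0 hornerZ normrM.
  rewrite (ger0_norm (_ : 0 <= (W ^+ 2).[t])); last by rewrite horner_exp sqr_ge0.
  rewrite ler_wpM2r //; first by rewrite horner_exp sqr_ge0.
  by rewrite normrM [`|_^-1|]ger0_norm // ler_wpM2r // F2.
- move=> cF; apply: cvgB; last exact: horner_at_right.
  by apply: cvg_norm; apply: cvgB => //; exact: horner_at_right.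
- apply: cvgB; last exact: horner_at_left.
  by apply: cvg_norm; apply: cvgB => //; exact: horner_at_left.
have iH := integrable_horner al be m H mC.
have iW := integrable_horner al be m (c *: W ^+ 2) mC.
have FH x : A x -> `|F x - H.[x]| <= (c *: W ^+ 2).[x].
  by move=> /hA; rewrite subr_le0.
have mFH : measurable_fun setT (fun x => F x - H.[x]).
  by apply: measurable_funB => //; exact: measurable_horner.
have iFH := le_integrable_concentrated m A Ac _ _ mFH FH iW.
have iF : m.-integrable setT (EFin \o F).
  rewrite (_ : EFin \o F = (EFin \o (fun x => F x - H.[x])) \+ (EFin \o horner H)).
    exact: integrableD.
  by apply/funext => x /=; rewrite -EFinD subrK.
rewrite -RintegralB //.
apply: (le_trans (normr_Rintegral_concentrated m A Ac _ _ mFH iW FH)).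
rewrite -RintegralZl //; last exact: (integrable_horner al be).
by rewrite le_eqVlt; apply/orP; left; apply/eqP; apply: eq_Rintegral => x _; rewrite hornerZ.
Qed.

End quadrature_bounds.

(** * Image measures, finite supports, derivatives of powers *)

Lemma integral_image {d1 d2 : measure_display} {T1 : measurableType d1}
    {T2 : measurableType d2} {R : realType} (m : {measure set T1 -> \bar R})
    (f : T1 -> T2) (mf : measurable_fun setT f) (F : T2 -> \bar R) :
  measurable_fun setT F ->
  (\int[image_measure m mf]_x F x = \int[m]_x F (f x))%E.
Proof.
move=> mF; rewrite integralE [RHS]integralE.
congr (_ - _)%E; rewrite ge0_integral_pushforward //.
- by rewrite preimage_setT; apply: eq_integral => x _; rewrite /= !funeposE.
- exact: measurable_funepos.
- by rewrite preimage_setT; apply: eq_integral => x _; rewrite /= !funenegE.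
- exact: measurable_funeneg.
Qed.

Lemma Rintegral_image {d1 d2 : measure_display} {T1 : measurableType d1}
    {T2 : measurableType d2} {R : realType} (m : {measure set T1 -> \bar R})
    (f : T1 -> T2) (mf : measurable_fun setT f) (F : T2 -> R) :
  measurable_fun setT F ->
  \int[image_measure m mf]_x F x = \int[m]_x F (f x).
Proof.
by move=> mF; rewrite /Rintegral integral_image //; exact/measurable_EFinP.
Qed.

Lemma image_measure_concentrated {d1 d2 : measure_display} {T1 : measurableType d1}
    {T2 : measurableType d2} {R : realType} (m : {measure set T1 -> \bar R})
    (f : T1 -> T2) (mf : measurable_fun setT f) A B :
  concentrated m A -> measurable B -> A `<=` f @^-1` B -> concentrated (image_measure m mf) B.
Proof.
move=> [mT mA m0] mB AB; split => //; rewrite image_measureE.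
apply: (subset_measure0 _ _ _ m0); last by apply: subsetC => x /AB.
  by rewrite -[_ @^-1` _]setTI; apply: mf => //; exact: measurableC.
exact: measurableC.
Qed.

Lemma measurable_set_seq {R : realType} (xs : seq R) : measurable [set` xs].
Proof.
apply: countable_measurable; first exact: measurable_set1.
by apply: finite_set_countable; apply/finite_seqP; exists xs.
Qed.

Lemma measure_off_support_seq {R : realType} (nu : {measure set R -> \bar R}) :
  finite_set (msupport nu) ->
  let ys := finmap.enum_fset (fset_set (msupport nu)) in
  uniq ys /\ nu (~` [set` ys]) = 0%E.
Proof.
move=> fs ys; split; first exact: finmap.fset_uniq.
have [M [mM M0 sM]] := measure_off_msupport nu.
apply: (subset_measure0 _ mM _ M0); first by apply: measurableC; exact: measurable_set_seq.
by apply: subset_trans sM; apply: subsetC => x; rewrite -[X in X x](fset_setK fs).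
Qed.

Lemma powR_jet {R : realType} (al be e : R) n : 0 <= al ->
  jet n al be (fun i t => (\prod_(j < i) (e - j%:R)) * t `^ (e - i%:R)).
Proof.
move=> al0 i t _; rewrite in_itv /= => /andP[alt _].
have t0 : 0 < t by exact: le_lt_trans alt.
rewrite big_ord_recr /= -mulrA.
rewrite (_ : e - i.+1%:R = e - i%:R - 1); last by rewrite -natr1; ring.
exact: (is_deriveZ _ (is_derive1_powR (e - i%:R) t0)).
Qed.

Section quadrature_support.
Context {R : realType}.
Variables (m n : {measure set R -> \bar R}) (al be : R) (s : nat) (xs : seq R).
Hypotheses (mC : concentrated m `[al, be]) (nC : concentrated n `[al, be]).
Hypothesis exact : forall p : {poly R}, (size p <= 2 * s)%N ->
  \int[m]_x p.[x] = \int[n]_x p.[x].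
Hypotheses (uxs : uniq xs) (sxs : (size xs <= s)%N).
Hypothesis nxs : n (~` [set` xs]) = 0%E.

(** If [m] lived on fewer than s points, then on them the node polynomial W would equal its
    remainder q modulo their own node polynomial. As q has degree < s, the integral of W^2 would be
    that of W q, hence 0. *)
Lemma quadrature_support ys : \int[m]_x (nodal xs ^+ 2).[x] != 0 ->
  m (~` [set` ys]) = 0%E -> (s <= size ys)%N.
Proof.
move=> W0 mys; rewrite leqNgt; apply/negP => ys_s; move/eqP: W0; apply.
have orth := nodal_orthogonal m n al be s xs nC exact sxs nxs.
pose V := nodal ys; pose q := nodal xs %% V.
have sq : (size q <= s)%N.
  rewrite -ltnS (leq_trans (ltn_modpN0 _ _)) ?monic_neq0 ?nodal_monic //.
  by rewrite size_nodal ltnS ltnW.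
rewrite -(orth q sq); have [mT _ _] := mC.
have mys' : concentrated m [set` ys] by split => //; exact: measurable_set_seq.
apply: (eq_Rintegral_concentrated m _ mys'); try exact: measurable_horner.
move=> y /= yy; rewrite expr2 !hornerM; congr (_ * _).
have := divp_eq (nodal xs) V => /(congr1 (fun p => p.[y])).
rewrite hornerD hornerM; have := nodal_eq0 ys y; rewrite yy => /eqP ->.
by rewrite mulr0 add0r.
Qed.
End quadrature_support.

(** * Gauss quadrature for a component after the substitution t -> t^2 *)

Section radial_quadrature.
Context {R : realType} {d : nat}.
Variables (P N P' N' : {measure set (borel_rV R d) -> \bar R}) (rho r : R) (s : nat).
Hypotheses (PC : concentrated P (annulus rho r)) (NC : concentrated N (annulus rho r)).
Hypotheses (PC' : concentrated P' (annulus rho r)) (NC' : concentrated N' (annulus rho r)).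
Hypotheses (rho0 : 0 <= rho) (rho_r : rho < r) (s0 : (0 < s)%N).
Variables (k : nat) (y : {mpoly R[d]}) (nu nu' : {measure set R -> \bar R}).
Hypothesis yk : y \is k.-homog.
Hypothesis nu0 : nu `]-oo, 0[%classic = 0%E.
Hypothesis nuE : signed_component P N y nu.
Hypothesis nu0' : nu' `]-oo, 0[%classic = 0%E.
Hypothesis nuE' : signed_component P' N' y nu'.
Hypothesis exact : forall j, (j < 2 * s)%N ->
  signed_int P N (rpeval (sqnorm ^+ j * y)) = signed_int P' N' (rpeval (sqnorm ^+ j * y)).
Hypothesis nodes : (msupport nu' #<= `I_s)%card.

Let msq : measurable_fun setT (@sq_map R).
Proof. exact: measurable_funX. Qed.

Let nuC := component_concentrated P N rho r PC NC rho0 rho_r y nu nu0 nuE.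
Let nuC' := component_concentrated P' N' rho r PC' NC' rho0 rho_r y nu' nu0' nuE'.

Let m := image_measure nu msq.
Let n := image_measure nu' msq.

Lemma sq_itv t : t \in `[rho, r] -> t ^+ 2 \in `[rho ^+ 2, r ^+ 2].
Proof.
rewrite !in_itv /= => /andP[a b]; have t0 : 0 <= t by exact: le_trans a.
by rewrite !lerXn2r // ?nnegrE // (le_trans t0).
Qed.

Lemma image_sq_concentrated (e : {measure set R -> \bar R}) : concentrated e `[rho, r] ->
  concentrated (image_measure e msq) `[rho ^+ 2, r ^+ 2].
Proof.
by move=> eC; apply: (image_measure_concentrated e _ msq _ _ eC) => // t; exact: sq_itv.
Qed.

Let mC := image_sq_concentrated nu nuC.
Let nC := image_sq_concentrated nu' nuC'.

Let albe : rho ^+ 2 < r ^+ 2.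
Proof. by rewrite ltrXn2r // ?nnegrE // ltW // (le_lt_trans rho0). Qed.

(** p(|x|^2) y(x) is a combination of the polynomials |x|^(2j) y with j < 2s. *)
Lemma image_sq_exact (p : {poly R}) : (size p <= 2 * s)%N ->
  \int[m]_x p.[x] = \int[n]_x p.[x].
Proof.
move=> sp; rewrite !Rintegral_image; try exact: measurable_horner.
rewrite (component_horner P N y nu nu0 nuE) (component_horner P' N' y nu' nu0' nuE').
pose q j : {mpoly R[d]} := \sum_(i < j) p`_i *: (sqnorm ^+ i * y).
have -> : (fun x : 'rV[R]_d => p.[enorm x ^+ 2] * rpeval y x) = rpeval (q (size p)).
  apply/funext => x; rewrite horner_coef mulr_suml /q rpeval_sum; apply: eq_bigr => i _.
  by rewrite rpevalZ rpeval_sqnormX mulrA.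
suff H j : (j <= 2 * s)%N -> signed_int P N (rpeval (q j)) = signed_int P' N' (rpeval (q j)).
  exact: H.
elim: j => [_|j IH js].
  rewrite /q big_ord0 (_ : rpeval 0 = fun x => 0 * rpeval 0 x).
    rewrite (signed_intZ P N rho r PC NC) ?(signed_intZ P' N' rho r PC' NC') ?mul0r //;
      exact: bounded_meas_rpeval.
  by apply/funext => x; rewrite rpeval0 mul0r.
rewrite /q big_ord_recr /= -/(q j).
rewrite (_ : rpeval _ = fun x => rpeval (q j) x + p`_j * rpeval (sqnorm ^+ j * y) x).
  have bz : bounded_meas rho r (fun x => p`_j * rpeval (sqnorm ^+ j * y) x).
    rewrite (_ : (fun x => _) = rpeval (p`_j *: (sqnorm ^+ j * y))).
      exact: bounded_meas_rpeval.
    by apply/funext => x; rewrite rpevalZ.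
  have bq u : bounded_meas (d := d) rho r (rpeval u) by exact: bounded_meas_rpeval.
  rewrite (signed_intD P N rho r PC NC) // (signed_intD P' N' rho r PC' NC') //.
  rewrite (signed_intZ P N rho r PC NC) // (signed_intZ P' N' rho r PC' NC') //.
  by rewrite IH ?exact // ltnW.
by apply/funext => x; rewrite rpevalD rpevalZ.
Qed.

Lemma image_sq_nodes : exists xs, [/\ uniq xs, (size xs <= s)%N,
  forall x, x \in xs -> x \in `[rho ^+ 2, r ^+ 2] & n (~` [set` xs]) = 0%E].
Proof.
have fs : finite_set (msupport nu') by apply/finite_set_leP; exists s.
have [_] := measure_off_support_seq nu' fs; set ys := finmap.enum_fset _ => ys0.
(* The nodes are the squares of the support points; the filter places them in the interval at no
   loss of mass. *)
pose xs := undup (map sq_map [seq t <- ys | t \in `[rho, r]]).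
exists xs; split; first exact: undup_uniq.
- rewrite (leq_trans (size_undup _)) // size_map size_filter.
  by rewrite (leq_trans (count_size _ _)) //; exact: geq_card_fset_set.
- by move=> x; rewrite mem_undup => /mapP[t]; rewrite mem_filter => /andP[tI _] ->; exact: sq_itv.
have [_ _ C0] := nuC'.
rewrite /n image_measureE.
have mys : measurable (~` [set` ys]) by apply: measurableC; exact: measurable_set_seq.
have mI : measurable (~` `[rho, r]%classic) by exact: measurableC.
apply: (subset_measure0 _ _ _ (null_set_setU mys mI ys0 C0)).
- rewrite -[_ @^-1` _]setTI; apply: msq => //.
  by apply: measurableC; exact: measurable_set_seq.
- exact: measurableU.
move=> t /= tx; have [ty|ty] := boolP (t \in ys); last by left; apply/negP.
right => tI; apply: tx; rewrite /= mem_undup; apply/mapP; exists t => //.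
by rewrite mem_filter ty andbT.
Qed.

Lemma image_sq_null : rho = 0 -> (0 < k)%N -> m [set rho ^+ 2] = 0%E.
Proof.
move=> rhoE k0; rewrite /m image_measureE rhoE expr0n /=.
rewrite (_ : _ @^-1` _ = [set 0]).
  exact: (component_null0 P N rho r PC NC rho0 rho_r k y nu yk nu0 nuE k0).
by apply/seteqP; split => t /=; rewrite /sq_map => /eqP; rewrite ?sqrf_eq0 => /eqP // ->; rewrite expr0n.
Qed.

(** When the squared node polynomial has positive integral, the support has at least s points by
    [quadrature_support], so Q is the orthogonal polynomial and not the default 0. *)
Lemma gauss_polynomial_orthogonal xs (Q : {poly R}) : (size xs <= s)%N ->
  n (~` [set` xs]) = 0%E -> gauss_polynomial nu s Q ->
  \int[m]_x (nodal xs ^+ 2).[x] != 0 ->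
  [/\ Q \is monic, size Q = s.+1 &
    forall p : {poly R}, (size p <= s)%N -> \int[m]_x (Q * p).[x] = 0].
Proof.
move=> sxs nxs [Q1 _] W0.
have supp : (`I_s #<= msupport nu)%card.
  have [fs|/infiniteP ifs] := pselect (finite_set (msupport nu)); last first.
    by apply: card_le_trans ifs; exact: subset_card_le.
  have [_ ys0] := measure_off_support_seq nu fs.
  have [_ _ nu0'' ] := nuC.
  pose ys := map sq_map (finmap.enum_fset (fset_set (msupport nu))).
  have sys : (s <= size ys)%N.
    apply: (quadrature_support m n _ _ s xs mC nC image_sq_exact sxs nxs) => //.
    rewrite /m image_measureE.
    apply: (subset_measure0 _ _ _ ys0).
    - rewrite -[_ @^-1` _]setTI; apply: msq => //.
      by apply: measurableC; exact: measurable_set_seq.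
    - by apply: measurableC; exact: measurable_set_seq.
    - by move=> t /= tn ty; apply: tn; exact: map_f.
  rewrite size_map in sys.
  have [j Mj] := (finite_setP _).1 fs; rewrite (card_fset_set Mj) -card_le_II in sys.
  by apply: card_le_trans sys _; move: Mj; rewrite card_eq_le => /andP[].
have [Qm sQ Qo] := Q1 supp; split => // p /Qo; rewrite /Rintegral.
under [X in fine X]eq_integral do rewrite hornerM.
by move=> ->.
Qed.

Section error.
Variables (F : R -> R) (Fs : nat -> R -> R).
Hypotheses (hj : jet (2 * s) (rho ^+ 2) (r ^+ 2) Fs)
  (hF : forall x, x \in `]rho ^+ 2, r ^+ 2[ -> F x = Fs 0%N x)
  (mF : measurable_fun setT F).
Hypothesis Fal : (rho = 0 /\ (0 < k)%N) \/ F x @[x --> (rho ^+ 2)^'+] --> F (rho ^+ 2).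
Hypothesis Fbe : F x @[x --> (r ^+ 2)^'-] --> F (r ^+ 2).

Let Fal' : m [set rho ^+ 2] = 0%E \/ F x @[x --> (rho ^+ 2)^'+] --> F (rho ^+ 2).
Proof. by case: Fal => [[a b]|]; [left; exact: image_sq_null|right]. Qed.

Lemma radial_quadrature_le :
  (forall x, x \in `]rho ^+ 2, r ^+ 2[ -> 0 <= Fs (2 * s)%N x) ->
  nu.-integrable setT (EFin \o (fun t => F (t ^+ 2))) ->
  \int[nu']_t F (t ^+ 2) <= \int[nu]_t F (t ^+ 2).
Proof.
move=> F2 iF; have [xs [uxs sxs xsI nxs]] := image_sq_nodes.
have -> : \int[nu']_t F (t ^+ 2) = \int[n]_x F x by rewrite Rintegral_image.
have -> : \int[nu]_t F (t ^+ 2) = \int[m]_x F x by rewrite Rintegral_image.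
apply: (quadrature_le m n _ _ s xs albe mC nC image_sq_exact uxs sxs xsI nxs s0 F Fs) => //.
apply: integrable_pushforward => //; exact/measurable_EFinP.
Qed.

Lemma radial_quadrature_error (M : R) (Q : {poly R}) : gauss_polynomial nu s Q ->
  (forall x, x \in `]rho ^+ 2, r ^+ 2[ -> `|Fs (2 * s)%N x| <= M) ->
  `|\int[nu]_t F (t ^+ 2) - \int[nu']_t F (t ^+ 2)| <=
    M / ((2 * s)`!)%:R * \int[m]_x (Q ^+ 2).[x].
Proof.
move=> hQ F2; have [xs [uxs sxs xsI nxs]] := image_sq_nodes.
have -> : \int[nu']_t F (t ^+ 2) = \int[n]_x F x by rewrite Rintegral_image.
have -> : \int[nu]_t F (t ^+ 2) = \int[m]_x F x by rewrite Rintegral_image.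
apply: (quadrature_error m n _ _ s xs albe mC nC image_sq_exact uxs sxs xsI nxs s0 F Fs) => //.
exact: gauss_polynomial_orthogonal.
Qed.

(** This is the case in which the bound reads sup times 0, where the sup may be infinite. The
    squared node polynomial then integrates to 0 too: otherwise Q would be the orthogonal
    polynomial, with the same integral of squares. *)
Lemma radial_quadrature_eq (Q : {poly R}) : gauss_polynomial nu s Q ->
  \int[m]_x (Q ^+ 2).[x] = 0 -> \int[nu]_t F (t ^+ 2) = \int[nu']_t F (t ^+ 2).
Proof.
move=> hQ Q0; have [xs [uxs sxs xsI nxs]] := image_sq_nodes.
have -> : \int[nu']_t F (t ^+ 2) = \int[n]_x F x by rewrite Rintegral_image.
have -> : \int[nu]_t F (t ^+ 2) = \int[m]_x F x by rewrite Rintegral_image.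
apply: (quadrature_degenerate m n _ _ s xs mC nC image_sq_exact uxs sxs nxs) => //.
apply/eqP; apply: contraPT Q0 => W0; apply/eqP.
have [Qm sQ Qo] := gauss_polynomial_orthogonal xs Q sxs nxs hQ W0.
by rewrite -(nodal_sq_monic_orthogonal m n _ _ s xs mC nC image_sq_exact sxs nxs W0 Q).
Qed.

End error.

(** As a function of the squared radius the weight is t^(-k/2), whose even derivatives are
    nonnegative, so the quadrature underestimates it. This transfers the summability hypothesis from
    mu to sigma. *)
Lemma component_weight_le : \int[nu']_t weight k t <= \int[nu]_t weight k t.
Proof.
pose e : R := - (k%:R / 2).
pose Fs i t := (\prod_(j < i) (e - j%:R)) * t `^ (e - i%:R) : R.
have e0 : e <= 0 by rewrite oppr_le0 divr_ge0.
have cpow t : 0 < t -> {for t, continuous (fun u : R => u `^ e)}.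
  move=> t0; apply: differentiable_continuous; apply/derivable1_diffP.
  by apply: derivable_powR; rewrite in_itv /= t0.
have r2 : 0 < r ^+ 2 by rewrite exprn_gt0 // (le_lt_trans rho0).
apply: (radial_quadrature_le (fun t => t `^ e) Fs).
- by apply: powR_jet; exact: sqr_ge0.
- by move=> x _; rewrite /Fs big_ord0 mul1r subr0.
- exact: measurable_powR.
(* The left endpoint is singular only for rho = 0 and k > 0, and in that case it has no mass. *)
- have [rhoE|rho1] := eqVneq rho 0; last first.
    right; apply: cvg_at_right_filter; apply: cpow.
    by rewrite exprn_gt0 // lt_def rho1.
  have [k0|k0] := posnP k; last by left.
  right; rewrite /e k0 mul0r oppr0.
  under eq_fun do rewrite powRr0.
  by rewrite powRr0; exact: cvg_cst.
- by apply: cvg_at_left_filter; exact: cpow.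
- move=> t _; rewrite /Fs mulr_ge0 ?powR_ge0 //.
  (* The factors e - j are all nonpositive and are consumed in pairs. *)
  elim: (s) => [|i IH]; first by rewrite muln0 big_ord0.
  rewrite mulnS add2n !big_ord_recr /= -mulrA mulr_ge0 //.
  by rewrite mulr_le0 // subr_le0 (le_trans e0).
- exact: (component_weight P N rho r PC NC rho0 rho_r k y nu yk nu0 nuE).1.
Qed.

End radial_quadrature.

(** * Differentiation along rays *)

Section chain_rule.
Context {R : realType} {d : nat}.
Variables (g : 'rV[R]_d -> R) (Dg : 'I_d -> 'rV[R]_d -> R).
Implicit Types (u v w x z : 'rV[R]_d).

Lemma is_derive_line u v c l : is_derive (u + c *: v) v g l ->
  is_derive c 1 (fun t => g (u + t *: v)) l.
Proof.
have E : (fun h : R => h^-1 *: (((fun t => g (u + t *: v)) \o shift c) (h *: 1) - g (u + c *: v)))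
       = (fun h => h^-1 *: ((g \o shift (u + c *: v)) (h *: v) - g (u + c *: v))).
  apply/funext => h /=; congr (_ *: (g _ - _)).
  by rewrite scalerDl [h *: 1]mulr1 addrCA.
move=> [dg gl]; split; first by rewrite /derivable E.
by rewrite -gl /derive E.
Qed.

Variable z : 'rV[R]_d.
Hypothesis gD : forall i, \forall y \near z, is_derive y (delta_mx 0 i) g (Dg i y).
Hypothesis Dgc : forall i, {for z, continuous (Dg i)}.

Let trunc (j : nat) w : 'rV[R]_d := \row_i (if (i < j)%N then w 0 i else 0).

(** Partial derivatives that exist near z and are continuous at z give total differentiability: the
    coordinates are switched on one at a time by [trunc], with the mean value theorem at each
    stage. *)
Lemma linearization (e : R) : 0 < e -> exists2 del : R, 0 < del &
  forall w, (forall i, `|w 0 i| < del) ->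
  `|g (z + w) - g z - \sum_i w 0 i * Dg i z| <= e * \sum_i `|w 0 i|.
Proof.
move=> e0.
pose close i (y : 'rV[R]_d) := is_derive y (delta_mx 0 i) g (Dg i y) /\ `|Dg i z - Dg i y| <= e.
have hi i : \forall y \near z, close i y.
  near=> y; split; first by near: y; exact: gD.
  by near: y; have /cvgrPdist_le := Dgc i; exact.
have : nbhs z [set y | forall i, close i y] by exact: (@filter_forall _ _ close (nbhs z) _ hi).
move=> /nbhs_ballP[del /= del0 hdel].
exists del => // w wdel.
have in_ball j (c : R) (jd : (j < d)%N) : `|c| <= `|w 0 (Ordinal jd)| ->
    ball z del (z + trunc j w + c *: delta_mx 0 (Ordinal jd)).
  move=> cw; split=> // i0 i; rewrite (ord1 i0) {i0} /ball /= !mxE /= -addrA opprD addNKr normrN.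
  have [->|ij] := eqVneq i (Ordinal jd).
    by rewrite ltnn add0r mulr1 (le_lt_trans cw).
  rewrite mulr0 addr0; case: ifP => _; [exact: wdel|by rewrite normr0].
have key j : (j <= d)%N ->
  `|g (z + trunc j w) - g z - \sum_(i < d | (i < j)%N) w 0 i * Dg i z|
    <= e * \sum_(i < d | (i < j)%N) `|w 0 i|.
  elim: j => [_|j IH jd].
    rewrite !big_pred0 // (_ : trunc 0 w = 0) ?addr0 ?subrr ?mulr0 ?normr0 //.
    by apply/rowP => i; rewrite !mxE.
  pose jj := Ordinal jd; set u := z + trunc j w.
  have split_sum (F : 'I_d -> R) :
      \sum_(i < d | (i < j.+1)%N) F i = F jj + \sum_(i < d | (i < j)%N) F i.
    rewrite (bigD1 jj) //=; congr (_ + _); apply: eq_bigl => i.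
    by rewrite -val_eqE /= ltnS [(i < j)%N]ltn_neqAle andbC.
  rewrite !split_sum.
  have -> : z + trunc j.+1 w = u + w 0 jj *: delta_mx 0 jj.
    rewrite /u -addrA; congr (_ + _); apply/rowP => i; rewrite !mxE /=.
    have [->|ij] := eqVneq i jj; first by rewrite /= ltnSn ltnn add0r mulr1.
    by rewrite mulr0 addr0 ltnS [(i < j)%N]ltn_neqAle -val_eqE /= in ij *; rewrite ij.
  have step : `|g (u + w 0 jj *: delta_mx 0 jj) - g u - w 0 jj * Dg jj z| <= e * `|w 0 jj|.
    pose psi (s : R) := g (u + (w 0 jj * s) *: delta_mx 0 jj).
    have ub (s : R) : s \in `[0, 1] -> ball z del (u + (w 0 jj * s) *: delta_mx 0 jj).
      rewrite in_itv /= => /andP[s0 s1]; apply: in_ball.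
      by rewrite normrM ler_piMr // ger0_norm.
    have dpsi (s : R) : s \in `[0, 1] -> is_derive s 1 psi
        (w 0 jj * Dg jj (u + (w 0 jj * s) *: delta_mx 0 jj)).
      move=> /ub /hdel /(_ jj)[dg _].
      have h1 := is_derive_line u (delta_mx 0 jj) (w 0 jj * s) _ dg.
      have h2 : is_derive s 1 (fun s : R => w 0 jj * s) (w 0 jj).
        by have := is_deriveZ (w 0 jj) (is_derive_id s (1 : R)); rewrite [_ *: 1]mulr1.
      have h3 := is_derive1_comp (f := fun t => g (u + t *: delta_mx 0 jj)) h1 h2.
      by apply: (is_derive_eq h3); rewrite /GRing.scale /= mulrC.
    have cpsi : {within `[0, 1], continuous psi}.
      by apply: derivable_within_continuous => s /dpsi h; exact: ex_derive.
    have dpsi' (s : R) : s \in `]0, 1[ -> is_derive s 1 psi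
        (w 0 jj * Dg jj (u + (w 0 jj * s) *: delta_mx 0 jj)).
      by move=> sI; apply: dpsi; exact: (subset_itv_oo_cc sI).
    have [c cI] := MVT_segment ler01 dpsi' cpsi.
    rewrite /psi mulr0 scale0r addr0 mulr1 subr0 mulr1 => ->.
    rewrite -mulrBr normrM mulrC ler_wpM2r //.
    by have [_] := hdel _ (ub _ cI) jj; rewrite distrC.
  have := IH (ltnW jd); rewrite -/u; move: step.
  set a1 := _ - w 0 jj * _; set a2 := _ - \sum_(i < d | _) _ => h1 h2.
  rewrite (_ : _ - _ = a1 + a2); last by rewrite /a1 /a2; ring.
  by rewrite mulrDr (le_trans (ler_normD _ _)) // lerD.
have := key d (leqnn d).
rewrite (_ : trunc d w = w); last by apply/rowP => i; rewrite !mxE ltn_ord.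
have E (F : 'I_d -> R) : \sum_(i < d | (i < d)%N) F i = \sum_i F i.
  by apply: eq_bigl => i; rewrite ltn_ord.
by rewrite !E.
Unshelve. all: by end_near. Qed.

End chain_rule.

Lemma is_derive_ray {R : realType} {d : nat} (g : 'rV[R]_d -> R)
    (Dg : 'I_d -> 'rV[R]_d -> R) (x : 'rV[R]_d) (t : R) :
  (forall i, \forall y \near t *: x, is_derive y (delta_mx 0 i) g (Dg i y)) ->
  (forall i, {for t *: x, continuous (Dg i)}) ->
  is_derive t 1 (fun u => g (u *: x)) (\sum_i x 0 i * Dg i (t *: x)).
Proof.
move=> gD Dgc; set l := \sum_i _.
have cv : (fun h : R => h^-1 *: (((fun u => g (u *: x)) \o shift t) (h *: 1) - g (t *: x)))
    @ 0^' --> l.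
  apply/cvgrPdist_le => e e0.
  pose K := \sum_i `|x 0 i|; have K0 : 0 <= K by rewrite sumr_ge0.
  have K1 : 0 < K + 1 by rewrite ltr_wpDl.
  have [|del del0 hdel] := linearization g Dg (t *: x) gD Dgc (e / (K + 1)).
    by rewrite divr_gt0.
  near=> h.
  have h0 : h != 0 by near: h; exact: nbhs_dnbhs_neq.
  have hs : `|h| < del / (K + 1).
    near: h; apply: dnbhs0_lt; by rewrite divr_gt0.
  have := hdel (h *: x) _.
  have -> : \sum_i (h *: x) 0 i * Dg i (t *: x) = h * l.
    by rewrite mulr_sumr; apply: eq_bigr => i _; rewrite !mxE mulrA.
  have -> : \sum_i `|(h *: x) 0 i| = `|h| * K.
    by rewrite mulr_sumr; apply: eq_bigr => i _; rewrite !mxE normrM.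
  rewrite /= [h *: 1]mulr1 scalerDl [h *: x + _]addrC => H.
  rewrite -(ler_pM2l (x := `|h|)) ?normr_gt0 // -normrM mulrBr.
  rewrite [h * (_ *: _)]mulrA divff // mul1r distrC (le_trans (H _)) //.
    move=> i; rewrite !mxE normrM (@le_lt_trans _ _ (`|h| * (K + 1))) //.
      rewrite ler_wpM2l // /K (bigD1 i) //= -addrA lerDl addr_ge0 //.
      by rewrite sumr_ge0.
    by rewrite -ltr_pdivlMr.
  rewrite mulrCA ler_wpM2l // mulrAC ler_pdivrMr // ler_wpM2l ?lerDl //.
  exact: ltW.
split; first by apply/cvg_ex; exists l.
exact: cvg_lim.
Unshelve. all: by end_near. Qed.

(** * Smoothness of the radial profiles *)

Lemma Cn_onS {R : realType} {d : nat} (U : set 'rV[R]_d) n (g : 'rV[R]_d -> R) :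
  Cn_on n.+1 U g -> Cn_on n U g.
Proof.
elim: n g => [|n IH] g; first by case=> cg _; split.
move=> [cg Dg]; split => // i; have [dg /IH h] := Dg i; split => //.
Qed.

Lemma Cn_on_continuous {R : realType} {d : nat} (U : set 'rV[R]_d) n (g : 'rV[R]_d -> R) x :
  Cn_on n U g -> U x -> {for x, continuous g}.
Proof. by case: n => [|n] [cg _]; exact: cg. Qed.

Lemma jet_sum {R : realType} {I : Type} (D : seq I) n (al be : R) (c : I -> R)
    (Fs : I -> nat -> R -> R) : (forall i, jet n al be (Fs i)) ->
  jet n al be (fun j t => \sum_(i <- D) c i * Fs i j t).
Proof.
move=> hF; elim: D => [|i D IH] j t jn tI.
  rewrite big_nil (_ : (fun _ => _) = cst 0); first exact: is_derive_cst.
  by apply/funext => u; rewrite big_nil.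
rewrite (_ : (fun _ => _) = fun u => c i * Fs i j u + 1 * \sum_(i <- D) c i * Fs i j u).
  rewrite big_cons -[X in _ + X]mul1r.
  exact: (jet_comb n al be (Fs i) _ (c i) 1 (hF i) IH j t jn tI).
by apply/funext => u; rewrite big_cons mul1r.
Qed.

Lemma Rintegral_sum {disp : measure_display} {T : measurableType disp} {R : realType}
    (m : {measure set T -> \bar R}) (A : set T) {I : Type} (D : seq I) (F : I -> T -> R) :
  measurable A -> (forall i, m.-integrable A (EFin \o F i)) ->
  \int[m]_(x in A) (\sum_(i <- D) F i x) = \sum_(i <- D) \int[m]_(x in A) F i x.
Proof.
move=> mA iF; elim: D => [|i D IH].
  under eq_Rintegral do rewrite big_nil; rewrite big_nil.
  by rewrite Rintegral_cst // mul0r.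
under eq_Rintegral do rewrite big_cons.
rewrite big_cons RintegralD ?IH //.
have : m.-integrable A (fun x => \sum_(i <- D) (EFin \o F i) x)%E by exact: integrable_sum.
by apply: eq_integrable => // x _; rewrite /= sumEFin.
Qed.

Section profile.
Context {R : realType} {d : nat}.
Variable S : {measure set (borel_rV R d) -> \bar R}.
Hypothesis SC : concentrated S usphere.
Variables (rho r : R).
Hypotheses (rho0 : 0 <= rho) (rho_r : rho < r).
Local Notation A := (@annulus R d rho r).
Local Notation U := (interior A).
Local Notation D i g := (fun x => 'D_(delta_mx 0 i) g x).
Implicit Types (g : 'rV[R]_d -> R) (x : 'rV[R]_d) (t al be e : R) (y : {mpoly R[d]}).

Lemma annulus_interior (x : 'rV[R]_d) : rho < enorm x < r -> U x.
Proof.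
move=> xr; have oV : open [set z : 'rV[R]_d | enorm z \in `]rho, r[].
  apply: (@open_comp _ _ _ (fun t : R => t \in `]rho, r[)).
    by move=> z _; exact: continuous_enorm.
  exact: interval_open.
suff VU : [set z : 'rV[R]_d | enorm z \in `]rho, r[] `<=` U by apply: VU; rewrite /= in_itv.
rewrite -open_subsetE // => z; rewrite /= in_itv /= => /andP[a b].
by rewrite /annulus /= !ltW.
Qed.

Lemma subannulus_interior al be (x : 'rV[R]_d) : rho < al -> be < r ->
  annulus al be x -> U x.
Proof.
move=> h1 h2 /andP[a b]; apply: annulus_interior.
by rewrite (lt_le_trans h1 a) (le_lt_trans b h2).
Qed.

Lemma Cn_on_within al be n g : rho < al -> be < r -> Cn_on n U g ->
  {within annulus al be, continuous g}.
Proof.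
move=> h1 h2 cg; apply: continuous_in_subspaceT => x; rewrite inE => Ax.
by apply: (Cn_on_continuous _ _ _ _ cg); exact: subannulus_interior Ax.
Qed.

Lemma lf_int_integrable y g al be t : 0 <= al -> {within annulus al be, continuous g} ->
  al <= t <= be ->
  S.-integrable usphere (EFin \o (fun x : borel_rV R d => g (t *: (x : 'rV[R]_d)) * rpeval y x)).
Proof.
move=> al0 cg tI; have [_ i] := lf_intE S SC al be al0 y g t cg tI.
have mu : measurable (usphere : set (borel_rV R d)) by exact: measurable_usphere.
move: (integrableS measurableT mu (@subsetT _ _) i); apply: eq_integrable => // x.
rewrite inE => xs /=; rewrite patchE mem_set //.
rewrite /annulus /= enormZ xs mulr1 ger0_norm //.
by case/andP: tI => a _; exact: le_trans a.
Qed.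

(** Differentiation under the integral along rays. The factor x_i is absorbed into the polynomial,
    so the derivative is again a sum of integrals of the same form and the formula can be
    iterated. *)
Lemma lf_int_is_derive n y g t : Cn_on n.+1 U g -> t \in `]rho, r[ ->
  is_derive t 1 (lf_int S y g) (\sum_i lf_int S ('X_i * y) (D i g) t).
Proof.
move=> cg; rewrite in_itv /= => /andP[rt tr].
(* The derivatives of g need not be bounded up to the boundary; a smaller closed annulus around
   radius t provides the dominating constant. *)
pose al := (rho + t) / 2; pose be := (t + r) / 2.
have h1 : rho < al by rewrite /al; lra.
have h2 : be < r by rewrite /be; lra.
have al0 : 0 <= al by rewrite (le_trans rho0) // ltW.
have alt : al < t by rewrite /al; lra.
have tbe : t < be by rewrite /be; lra.
have inU u x : u \in `]al, be[ -> usphere x -> annulus al be (u *: x).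
  rewrite in_itv /= => /andP[a b] xs; rewrite /annulus /= enormZ xs mulr1.
  by rewrite ger0_norm ?(ltW a) ?(ltW b) // (le_trans al0) // ltW.
have cD i : Cn_on n U (D i g) by case: cg => _ /(_ i)[].
have [Bd hBd] : exists B : 'I_d -> R, forall i x, annulus al be x -> `|D i g x| <= B i.
  have hex i : exists B, forall x, annulus al be x -> `|D i g x| <= B.
    have [B _ hB] := within_annulus_bounded al be (D i g)
      (Cn_on_within al be n _ h1 h2 (cD i)).
    by exists B.
  by have [B hB] := choice hex; exists B.
have [M M0 hM] := rpeval_bounded_on _ (compact_annulus d 1 1) y.
have ray u x : u \in `]al, be[ -> usphere x ->
    is_derive u 1 (fun u => g (u *: x) * rpeval y x)
      ((\sum_i x 0 i * D i g (u *: x)) * rpeval y x).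
  move=> uI xs; have Ax := inU u x uI xs.
  have Ux : U (u *: x) by exact: subannulus_interior Ax.
  have dr : is_derive u 1 (fun u => g (u *: x)) (\sum_i x 0 i * D i g (u *: x)).
    apply: (is_derive_ray g (fun i => D i g)) => i; last exact: Cn_on_continuous (cD i) Ux.
    have : \forall z \near u *: x, U z by apply: open_nbhs_nbhs; split => //; exact: open_interior.
    apply: filterS => z Uz; apply: DeriveDef => //.
    by case: cg => _ /(_ i)[+ _]; exact.
  rewrite (_ : (fun u => _) = rpeval y x \*: (fun u => g (u *: x))).
    by apply: is_derive_eq (is_deriveZ (rpeval y x) dr) _; rewrite /GRing.scale /= mulrC.
  by apply/funext => w; rewrite /= /GRing.scale /= mulrC.
pose f u (x : borel_rV R d) := g (u *: (x : 'rV[R]_d)) * rpeval y x.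
pose G (x : borel_rV R d) := `|(\sum_i Bd i) * M|.
have mu : measurable (usphere : set (borel_rV R d)) by exact: measurable_usphere.
have d1E u x : u \in `]al, be[ -> usphere x ->
    (partial1of2 f) u x = (\sum_i x 0 i * D i g (u *: x)) * rpeval y x.
  by move=> uI xs; rewrite partial1of2E; have := ray u x uI xs => -[_].
have Ia : `]al, be[%classic t by rewrite /= in_itv /= alt tbe.
have intf u : `]al, be[%classic u -> S.-integrable usphere (EFin \o f u).
  rewrite /= in_itv /= => /andP[a b]; apply: (lf_int_integrable y g al be) => //.
    exact: Cn_on_within cg.
  by rewrite !ltW.
have df u x : `]al, be[%classic u -> usphere x -> derivable (f ^~ x) u 1.
  by move=> uI xs; have := ray u x uI xs => -[].
have iG : S.-integrable usphere (EFin \o G).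
  exact: (integrableS measurableT mu (@subsetT _ _) (integrable_cst_concentrated S _ SC _)).
have Gub u x : `]al, be[%classic u -> usphere x -> `|(partial1of2 f) u x| <= G x.
  move=> uI xs; rewrite d1E // /G normrM [X in _ <= X]normrM ler_pM //; last first.
    rewrite (ger0_norm (ltW M0)); apply: hM; rewrite /annulus /= xs.
    by rewrite lexx.
  rewrite (le_trans (ler_norm_sum _ _ _)) // (le_trans _ (ler_norm _)) //.
  apply: ler_sum => i _; rewrite normrM (le_trans _ (hBd i _ (inU u x uI xs))) //.
  by rewrite ler_piMl // usphere_coord.
have dF := derivable_under_integral mu Ia intf df
  (fun=> normr_ge0 _) iG Gub.
have vF := differentiation_under_integral mu Ia intf df
  (fun=> normr_ge0 _) iG Gub.
split; first exact: dF.
rewrite -derive1E.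
rewrite [LHS]vF.
have -> : \int[S]_(x in usphere) (partial1of2 f) t x =
    \int[S]_(x in usphere) (\sum_i D i g (t *: x) * rpeval ('X_i * y) x).
  apply: eq_Rintegral => x; rewrite inE => xs; rewrite d1E // mulr_suml.
  by apply: eq_bigr => i _; rewrite rpevalM rpevalX; ring.
have ii i : S.-integrable usphere (EFin \o
    (fun x : borel_rV R d => D i g (t *: (x : 'rV[R]_d)) * rpeval ('X_i * y) x)).
  apply: (lf_int_integrable _ (D i g) al be t al0); last by rewrite !ltW.
  exact: (Cn_on_within _ _ n).
by rewrite Rintegral_sum.
Qed.

(** The derivative of phi(sqrt t) t^e is e phi(sqrt t) t^(e-1) plus half of phi'(sqrt t) t^(e-1/2),
    where phi' is a sum of coefficients again. Functions of this shape are thus closed under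
    differentiation, hence the induction over all y, g and e. *)
Lemma profile_jet n y g (e : R) : Cn_on n U g -> exists2 Fs,
  jet n (rho ^+ 2) (r ^+ 2) Fs & forall t, Fs 0%N t = lf_int S y g (Num.sqrt t) * t `^ e.
Proof.
elim: n y g e => [|n IH] y g e cg.
  by exists (fun _ t => lf_int S y g (Num.sqrt t) * t `^ e).
have [G hG G0] := IH y g (e - 1) (Cn_onS _ _ _ cg).
have hex (i : 'I_d) : exists Gi : nat -> R -> R, jet n (rho ^+ 2) (r ^+ 2) Gi /\
    forall t, Gi 0%N t = lf_int S ('X_i * y) (D i g) (Num.sqrt t) * t `^ (e - 2^-1).
  by case: cg => _ /(_ i)[_ /IH h]; have [Gi] := h ('X_i * y) (e - 2^-1); exists Gi.
have [Gs hGs] := choice hex.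
pose Fs j t : R := if j is j'.+1
  then e * G j' t + 1 * \sum_(i <- enum 'I_d) 2^-1 * Gs i j' t
  else lf_int S y g (Num.sqrt t) * t `^ e.
exists Fs => // j t jn tI; case: j jn => [|j] jn; last first.
  rewrite /Fs; apply: (jet_comb n (rho ^+ 2) (r ^+ 2) G
    (fun j t => \sum_(i <- enum 'I_d) 2^-1 * Gs i j t)) => //.
  by apply: jet_sum => i; have [] := hGs i.
have /andP[t1 t2] : rho ^+ 2 < t < r ^+ 2 by rewrite in_itv in tI.
have t0 : 0 < t by rewrite (le_lt_trans _ t1) // sqr_ge0.
have st : Num.sqrt t \in `]rho, r[.
  rewrite in_itv /=; apply/andP; split.
    by rewrite -[rho]ger0_norm // -sqrtr_sqr ltr_sqrt.
  have r0 : 0 < r by exact: le_lt_trans rho_r.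
  by rewrite -[r]gtr0_norm // -sqrtr_sqr ltr_sqrt // exprn_gt0.
have h1 := is_derive1_comp (lf_int_is_derive n y g (Num.sqrt t) cg st) (is_derive1_sqrt t0).
have h2 := is_deriveM h1 (is_derive1_powR e t0).
apply: (is_derive_eq h2); rewrite /Fs G0 mul1r.
rewrite /GRing.scale /=; congr (_ + _); first by ring.
have tE : t `^ e / Num.sqrt t = t `^ (e - 2^-1).
  rewrite powRB // ?(implybT,gt_eqF t0) ?implyTb //.
  by rewrite -powR12_sqrt // ltW.
rewrite mulr_suml mulr_sumr -[index_enum _]enumT.
apply: eq_bigr => i _; have [_ ->] := hGs i; rewrite -tE.
by rewrite invfM; ring.
Qed.

End profile.

(** * The error of one component *)

Section component_error.
Context {R : realType} {d : nat}.
Variable S : {measure set (borel_rV R d) -> \bar R}.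
Hypothesis SC : concentrated S usphere.
Variables (P N P' N' : {measure set (borel_rV R d) -> \bar R}) (rho r : R) (s : nat).
Hypotheses (PC : concentrated P (annulus rho r)) (NC : concentrated N (annulus rho r)).
Hypotheses (PC' : concentrated P' (annulus rho r)) (NC' : concentrated N' (annulus rho r)).
Hypotheses (rho0 : 0 <= rho) (rho_r : rho < r) (s0 : (0 < s)%N).
Variables (k : nat) (y : {mpoly R[d]}) (nu nu' : {measure set R -> \bar R}).
Hypothesis yk : y \is k.-homog.
Hypothesis y1 : sphere_int S (y * y) = 1.
Hypothesis nu0 : nu `]-oo, 0[%classic = 0%E.
Hypothesis nuE : signed_component P N y nu.
Hypothesis nu0' : nu' `]-oo, 0[%classic = 0%E.
Hypothesis nuE' : signed_component P' N' y nu'.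
Hypothesis exact : forall j, (j < 2 * s)%N ->
  signed_int P N (rpeval (sqnorm ^+ j * y)) = signed_int P' N' (rpeval (sqnorm ^+ j * y)).
Hypothesis nodes : (msupport nu' #<= `I_s)%card.
Local Notation A := (@annulus R d rho r).
Local Notation U := (interior A).
Local Notation term nu := (lf_term S rho r k y nu).
Local Notation e := (- (k%:R / 2) : R).

(** It equals the profile on [rho^2, r^2] and is measurable on the whole line when g is continuous
    on the annulus. *)
Definition clamped_profile (g : 'rV[R]_d -> R) (t : R) : R :=
  lf_int S y g (clamp rho r (Num.sqrt t)) * t `^ e.

Lemma continuous_clamped_profile g t : {within A, continuous g} ->
  (0 < t) || (k == 0)%N -> {for t, continuous (clamped_profile g)}.
Proof.
move=> cg t0; apply: cvgM.
  apply: (@continuous_comp _ _ _ Num.sqrt (fun u => lf_int S y g (clamp rho r u))).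
    exact: sqrt_continuous.
  exact: (continuous_lf_int S SC rho r).
case/orP: t0 => [t0|/eqP ->]; last first.
  rewrite mul0r oppr0; under eq_fun do rewrite powRr0.
  by rewrite powRr0; exact: cvg_cst.
have : {for t, continuous (fun u : R => u `^ e)}; last exact.
apply: differentiable_continuous; apply/derivable1_diffP.
by apply: derivable_powR; rewrite in_itv /= t0.
Qed.

Lemma measurable_clamped_profile g : {within A, continuous g} ->
  measurable_fun setT (clamped_profile g).
Proof.
move=> cg; apply: measurable_funM; last exact: measurable_powR.
apply: continuous_measurable_fun => t.
apply: (@continuous_comp _ _ _ Num.sqrt (fun u => lf_int S y g (clamp rho r u))).
  exact: sqrt_continuous.
exact: (continuous_lf_int S SC rho r).
Qed.

Lemma clamped_profile_term
    (m : {measure set R -> \bar R}) g : concentrated m `[rho, r] ->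
  {within A, continuous g} ->
  \int[m]_t clamped_profile g (t ^+ 2) = term m g.
Proof.
move=> mC cg; apply: (eq_Rintegral_concentrated m _ mC).
- by apply: measurableT_comp; [exact: measurable_clamped_profile|exact: measurable_funX].
- exact: (measurable_lf_term S SC rho r).
move=> t /=; rewrite in_itv /= => /andP[a _]; rewrite /clamped_profile sqrtr_sqr.
by rewrite ger0_norm // (le_trans rho0).
Qed.

Variables (f1 f2 : 'rV[R]_d -> R) (c1 c2 : R).
Hypothesis c12 : c1 ^+ 2 + c2 ^+ 2 <= 1.
Hypotheses (cf1 : {within A, continuous f1}) (cf2 : {within A, continuous f2}).
Variables (Fs1 Fs2 : nat -> R -> R).
Hypotheses (hj1 : jet (2 * s) (rho ^+ 2) (r ^+ 2) Fs1) (hj2 : jet (2 * s) (rho ^+ 2) (r ^+ 2) Fs2).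
Hypothesis F1 : forall t, Fs1 0%N t = lf_int S y f1 (Num.sqrt t) * t `^ e.
Hypothesis F2 : forall t, Fs2 0%N t = lf_int S y f2 (Num.sqrt t) * t `^ e.

Let F t := c1 * clamped_profile f1 t + c2 * clamped_profile f2 t.
Let Fs i t := c1 * Fs1 i t + c2 * Fs2 i t.

Let F_integral (Q Q' : {measure set (borel_rV R d) -> \bar R}) (m : {measure set R -> \bar R}) :
  concentrated Q A -> concentrated Q' A ->
  m `]-oo, 0[%classic = 0%E ->
  (signed_component Q Q' y m) ->
  \int[m]_t F (t ^+ 2) = c1 * term m f1 + c2 * term m f2.
Proof.
move=> QC QC' m0 mE.
have mC := component_concentrated Q Q' rho r QC QC' rho0 rho_r y m m0 mE.
have i g : {within A, continuous g} ->
    m.-integrable setT (EFin \o (fun t => clamped_profile g (t ^+ 2))).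
  move=> cg; apply: (eq_integrable_concentrated m _ mC _
    (fun t => lf_int S y g (clamp rho r t) * weight k t)).
  - by apply: measurableT_comp; [exact: measurable_clamped_profile|exact: measurable_funX].
  - move=> t /=; rewrite in_itv /= => /andP[a _]; rewrite /clamped_profile sqrtr_sqr.
    by rewrite ger0_norm // (le_trans rho0).
  - exact: (integrable_lf_term S SC Q Q' rho r QC QC' rho0 rho_r k y m yk y1 m0 mE).
rewrite RintegralD //; first by rewrite !RintegralZl ?clamped_profile_term // i.
- exact: (integrableZl measurableT c1 (i f1 cf1)).
- exact: (integrableZl measurableT c2 (i f2 cf2)).
Qed.

(** The real and imaginary parts are combined with real coefficients before the quadrature estimate:
    by Cauchy-Schwarz the derivative of the combination is at most the modulus of the complex
    derivative, so the supremum of the modulus is not split into two suprema. *)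
Lemma component_error (Q : {poly R}) : gauss_polynomial nu s Q ->
  ((`|c1 * (term nu f1 - term nu' f1) + c2 * (term nu f2 - term nu' f2)|)%:E <=
   ((((2 * s)`!)%N%:R : R)^-1)%:E *
    (ereal_sup [set (Num.sqrt (Fs1 (2 * s)%N xi ^+ 2 + Fs2 (2 * s)%N xi ^+ 2))%:E
               | xi in [set` `](rho ^+ 2)%R, (r ^+ 2)%R[]] *
      \int[image_sq nu]_(t in [set` `[(rho ^+ 2)%R, (r ^+ 2)%R]]) (Q.[t] ^+ 2)%:E))%E.
Proof.
move=> hQ; have msq : measurable_fun setT (@sq_map R) by exact: measurable_funX.
have nuC := component_concentrated P N rho r PC NC rho0 rho_r y nu nu0 nuE.
pose m := image_measure nu msq.
have mC : concentrated m `[rho ^+ 2, r ^+ 2] := image_sq_concentrated rho r rho0 nu nuC.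
have F_E : c1 * (term nu f1 - term nu' f1) + c2 * (term nu f2 - term nu' f2) =
    \int[nu]_t F (t ^+ 2) - \int[nu']_t F (t ^+ 2).
  have E1 := F_integral P N nu PC NC nu0 nuE.
  have E2 := F_integral P' N' nu' PC' NC' nu0' nuE'.
  have alg (x1 x2 x3 x4 : R) :
      c1 * (x1 - x2) + c2 * (x3 - x4) = (c1 * x1 + c2 * x3) - (c1 * x2 + c2 * x4) by ring.
  exact: (etrans (alg _ _ _ _) (congr2 (fun a b => a - b) (esym E1) (esym E2))).
have mF : measurable_fun setT F.
  by apply: measurable_funD; apply: measurable_funM => //; exact: measurable_clamped_profile.
have Q2E : (\int[image_sq nu]_(t in `[(rho ^+ 2)%R, (r ^+ 2)%R]) (Q.[t] ^+ 2)%:E =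
    (\int[m]_t (Q ^+ 2).[t])%:E)%E.
  have [_ mI _] := mC; have iQ := integrable_horner _ _ m (Q ^+ 2) mC.
  rewrite -[LHS]fineK; last first.
    apply: integrable_fin_num => //; move: (integrableS measurableT mI (@subsetT _ _) iQ).
    by apply: eq_integrable => // t _; rewrite /= horner_exp.
  congr _%:E; change (\int[m]_(t in `[rho ^+ 2, r ^+ 2]) (Q.[t] ^+ 2) = \int[m]_t (Q ^+ 2).[t]).
  rewrite Rintegral_mkcond; apply: (eq_Rintegral_concentrated m _ mC).
  - apply: measurable_patch => //.
    by apply: measurable_funX; exact: measurable_horner.
  - exact: measurable_horner.
  - by move=> t tI; rewrite patchE mem_set // horner_exp.
have cF t : (0 < t) || (k == 0)%N -> {for t, continuous F}.
  move=> t0; apply: cvgD; apply: cvgM; try exact: cvg_cst.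
    exact: (continuous_clamped_profile f1 t cf1 t0).
  exact: (continuous_clamped_profile f2 t cf2 t0).
rewrite Q2E F_E; set I := \int[m]_t _.
(* Here the right side is 0 even if the supremum is infinite, so exact equality of the two integrals
   is needed. *)
have [I0|I0] := eqVneq I 0.
  rewrite I0 mule0 mule0 (radial_quadrature_eq P N P' N' rho r s PC NC PC' NC' rho0 rho_r y nu nu'
    nu0 nuE nu0' nuE' exact nodes F mF Q hQ) //.
  by rewrite subrr normr0.
have {I0}I0 : 0 < I.
  rewrite lt_def I0 /=; apply: Rintegral_ge0 => t _.
  by rewrite horner_exp sqr_ge0.
set D := ereal_sup _.
have D_ub xi : xi \in `]rho ^+ 2, r ^+ 2[ ->
    ((Num.sqrt (Fs1 (2 * s)%N xi ^+ 2 + Fs2 (2 * s)%N xi ^+ 2))%:E <= D)%E.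
  by move=> xiI; apply: ereal_sup_ubound; exists xi.
have albe : rho ^+ 2 < r ^+ 2.
  by rewrite ltrXn2r // ?nnegrE // ltW // (le_lt_trans rho0).
have D0 : (0 <= D)%E.
  apply: le_trans (D_ub ((rho ^+ 2 + r ^+ 2) / 2) _); first by rewrite lee_fin sqrtr_ge0.
  exact: mid_in_itvoo.
(* An infinite supremum times a positive integral makes the bound trivial. *)
have [Dfin|Dinf] := boolP (D \is a fin_num); last first.
  have -> : D = +oo%E by move: Dinf D0; case: (D).
  by rewrite gt0_mulye ?lte_fin // gt0_muley ?leey // lte_fin invr_gt0.
rewrite -(fineK Dfin) -!EFinM lee_fin mulrA [_^-1 * _]mulrC.
apply: (radial_quadrature_error P N P' N' rho r s PC NC PC' NC' rho0 rho_r s0 k y nu nu'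
    yk nu0 nuE nu0' nuE' exact nodes F Fs) => //.
- exact: jet_comb.
- move=> x; rewrite in_itv /= => /andP[x1 x2]; rewrite /F /Fs F1 F2 /clamped_profile.
  rewrite clamp_id //; apply/andP; split.
    by rewrite -[rho]ger0_norm // -sqrtr_sqr ler_sqrt ?ltW // (le_lt_trans _ x1) // sqr_ge0.
  have r0 : 0 < r by exact: le_lt_trans rho_r.
  by rewrite -[r]gtr0_norm // -sqrtr_sqr ler_sqrt ?ltW // exprn_gt0.
- have [rhoE|rho1] := eqVneq rho 0; last first.
    right; apply: cvg_at_right_filter; apply: cF.
    by rewrite exprn_gt0 // lt_def rho1.
  have [k0|k0] := posnP k; last by left.
  by right; apply: cvg_at_right_filter; apply: cF; rewrite k0 orbT.
- by apply: cvg_at_left_filter; apply: cF; rewrite exprn_gt0 // (le_lt_trans rho0).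
- move=> x xI; rewrite -lee_fin (fineK Dfin).
  apply: le_trans (D_ub x xI); rewrite lee_fin /Fs.
  rewrite -sqrtr_sqr ler_wsqrtr //; set u := Fs1 _ x; set v := Fs2 _ x.
  (* Lagrange's identity, which gives Cauchy-Schwarz in the plane. *)
  have -> : (c1 * u + c2 * v) ^+ 2 =
      (c1 ^+ 2 + c2 ^+ 2) * (u ^+ 2 + v ^+ 2) - (c1 * v - c2 * u) ^+ 2 by ring.
  rewrite lerBlDr (le_trans (ler_wpM2r _ c12)) ?addr_ge0 ?sqr_ge0 // mul1r.
  by rewrite lerDl sqr_ge0.
Qed.

End component_error.

(** * From charges and complex integrals to pairs of measures and real integrals *)

Section charge_parts.
Context {disp} {T : measurableType disp} {R : realType}.
Variable mu : {charge set T -> \bar R}.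

Definition posm : {measure set T -> \bar R} := jordan_pos (hahn mu).

Definition negm : {measure set T -> \bar R} := jordan_neg (hahn mu).

Lemma posm_finite : (posm setT < +oo)%E.
Proof. by apply: fin_num_fun_lty; exact: fin_num_measure. Qed.

Lemma negm_finite : (negm setT < +oo)%E.
Proof. by apply: fin_num_fun_lty; exact: fin_num_measure. Qed.

Lemma charge_absE B : charge_abs mu B = (posm B + negm B)%E.
Proof. by []. Qed.

End charge_parts.

(** The total variation is null off its support, and it is the sum of the two Jordan parts. *)
Lemma charge_parts_concentrated {R : realType} {d : nat}
    (mu : {charge set (borel_rV R d) -> \bar R}) (rho r : R) :
  msupport (charge_abs mu) `<=` annulus rho r ->
  concentrated (posm mu) (annulus rho r) /\ concentrated (negm mu) (annulus rho r).
Proof.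
move=> sA; pose V : {measure set (borel_rV R d) -> \bar R} := charge_variation (hahn mu).
have [_ mA V0] : concentrated V (annulus rho r).
  apply: concentrated_msupport_rV => //; last exact: closed_annulus.
  by rewrite [V _]charge_absE lte_add_pinfty ?posm_finite ?negm_finite.
have := V0; rewrite [V _]charge_absE => /eqP; rewrite padde_eq0 // => /andP[/eqP p0 /eqP n0].
by split; split => //; [exact: posm_finite|exact: negm_finite].
Qed.

Section charge_translation.
Context {R : realType} {d : nat}.
Implicit Types (mu : {charge set (borel_rV R d) -> \bar R}) (g : 'rV[R]_d -> R).

Lemma charge_integralE mu g :
  charge_integral mu setT (g : borel_rV R d -> R) = signed_int (posm mu) (negm mu) g.
Proof. by []. Qed.

Lemma Re_charge_cintegral mu A (f : 'rV[R]_d -> R[i]) :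
  complex.Re (charge_cintegral mu A (f : borel_rV R d -> R[i])) =
  signed_int (posm mu) (negm mu) ((@complex.Re _ \o f) \_ A).
Proof. by rewrite /signed_int /= -!Rintegral_mkcond. Qed.

Lemma Im_charge_cintegral mu A (f : 'rV[R]_d -> R[i]) :
  complex.Im (charge_cintegral mu A (f : borel_rV R d -> R[i])) =
  signed_int (posm mu) (negm mu) ((@complex.Im _ \o f) \_ A).
Proof. by rewrite /signed_int /= -!Rintegral_mkcond. Qed.

Lemma ReM_real (z : R[i]) (c : R) : complex.Re (z * c%:C%C) = complex.Re z * c.
Proof. by case: z => u v; rewrite /= mulr0 subr0. Qed.

Lemma ImM_real (z : R[i]) (c : R) : complex.Im (z * c%:C%C) = complex.Im z * c.
Proof. by case: z => u v; rewrite /= mulr0 add0r. Qed.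

Lemma component_measure_real (a : nat -> nat) (Y : forall k, 'I_(a k) -> {mpoly R[d]})
    mu k (l : 'I_(a k)) (nu : {measure set R -> \bar R}) : component_measure Y mu l nu ->
  nu `]-oo, 0[%classic = 0%E /\
  signed_component (posm mu) (negm mu) (Y k l) nu.
Proof.
move=> [nu0 nuE]; split => // h ch [c [n hb]].
have [||i1 _ e] := nuE (fun t => (h t)%:C%C).
- split; first by apply: continuous_subspaceT; exact: ch.
  by apply: continuous_subspaceT; exact: cst_continuous.
- exists c, n => t t0; rewrite (le_trans _ (hb t t0)) //.
  by rewrite /cmod /= expr0n /= addr0 sqrtr_sqr.
split; first exact: i1.
have := congr1 (@complex.Re R) e; rewrite Re_charge_cintegral patch_setT.
move=> h1; apply: (etrans h1); congr signed_int; apply/funext => x.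
by rewrite /= mulr0 subr0.
Qed.

Lemma map_mpoly_laplacian (p : {mpoly R[d]}) n :
  iter n laplacian (map_mpoly (real_complex R) p) =
  map_mpoly (real_complex R) (iter n laplacian p).
Proof.
elim: n => [//|n IH]; rewrite !iterS IH; move: (iter n laplacian p) => q.
rewrite /laplacian raddf_sum; apply: eq_bigr => i _.
by apply/mpolyP => m; rewrite !(mcoeff_deriv, mcoeff_map_mpoly) !raddfMn.
Qed.

Lemma cpeval_map (p : {mpoly R[d]}) x :
  cpeval (map_mpoly (real_complex R) p) x = (rpeval p x)%:C%C.
Proof.
rewrite /cpeval /rpeval !mevalE.
rewrite (perm_big _ (msupp_map_mpoly _ (@complexI R))) /= rmorph_sum /=.
apply: eq_bigr => m _; rewrite mcoeff_map_mpoly rmorphM rmorph_prod /=.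
by congr (_ * _); apply: eq_bigr => i _; rewrite rmorphXn.
Qed.

End charge_translation.

Lemma cmod_sqr {R : realType} (z : R[i]) :
  cmod z ^+ 2 = complex.Re z ^+ 2 + complex.Im z ^+ 2.
Proof. by case: z => u v; rewrite sqr_sqrtr // addr_ge0 ?sqr_ge0. Qed.

Lemma cmod_ge0 {R : realType} (z : R[i]) : 0 <= cmod z.
Proof. by case: z => u v; exact: sqrtr_ge0. Qed.

(** * Summation over all components *)

Section polyharmonic_quadrature.
Context {R : realType} {d : nat} {a : nat -> nat} {Y : forall k, 'I_(a k) -> {mpoly R[d]}}.
Hypotheses (d2 : (2 <= d)%N) (hY : harmonic_basis Y).
Variables (rho r : R) (s : nat).
Hypotheses (rho0 : 0 <= rho) (rho_r : rho < r) (s0 : (0 < s)%N).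
Variables (mu sigma : {charge set (borel_rV R d) -> \bar R}).
Hypotheses (mu_supp : msupport (charge_abs mu) `<=` annulus rho r)
  (hsigma : gauss_jacobi Y rho r s mu sigma).

(** Exactness is postulated for complex polynomials; the real polynomial |x|^(2j) Y_{k,l} is
    embedded among them, and the embedding commutes with the Laplacian. *)
Lemma gauss_jacobi_exact k (l : 'I_(a k)) j : (j < 2 * s)%N ->
  signed_int (posm mu) (negm mu) (rpeval (sqnorm ^+ j * Y k l)) =
  signed_int (posm sigma) (negm sigma) (rpeval (sqnorm ^+ j * Y k l)).
Proof.
move=> js; have [_ _ _ hP] := hsigma; have [Yh _ _] := hY k; have [Yl Yk] := Yh l.
have L0 : iter (2 * s) laplacian (map_mpoly (real_complex R) (sqnorm ^+ j * Y k l)) = 0.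
  rewrite map_mpoly_laplacian (iter_laplacian_sqnormX k) //; last exact: ltnW.
  exact: raddf0.
have /(congr1 (@complex.Re R)) := hP _ L0.
rewrite !Re_charge_cintegral !patch_setT.
rewrite (_ : _ \o _ = rpeval (sqnorm ^+ j * Y k l)) //.
by apply/funext => x; rewrite /= cpeval_map.
Qed.

Lemma gauss_jacobi_component k (l : 'I_(a k)) :
  {nu : {measure set R -> \bar R} | component_measure Y sigma l nu & (msupport nu #<= `I_s)%card}.
Proof. by apply: cid2; have [_ _ + _] := hsigma; exact. Qed.

Definition sigma_component k (l : 'I_(a k)) := s2val (gauss_jacobi_component k l).

Variable mu_ : forall k : nat, 'I_(a k) -> {measure set R -> \bar R}.
Hypothesis hmu_ : forall (k : nat) (l : 'I_(a k)), component_measure Y mu l (mu_ k l).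

Let PC := (charge_parts_concentrated mu rho r mu_supp).1.
Let NC := (charge_parts_concentrated mu rho r mu_supp).2.
Let sigma_supp : msupport (charge_abs sigma) `<=` annulus rho r.
Proof. by case: hsigma. Qed.
Let PC' := (charge_parts_concentrated sigma rho r sigma_supp).1.
Let NC' := (charge_parts_concentrated sigma rho r sigma_supp).2.
Let mu0 k l := (component_measure_real a Y mu k l (mu_ k l) (hmu_ k l)).1.
Let muE k l := (component_measure_real a Y mu k l (mu_ k l) (hmu_ k l)).2.
Let hsigma_ k l : component_measure Y sigma l (sigma_component k l).
Proof. exact: (s2valP (gauss_jacobi_component k l)). Qed.
Let nodes k l : (msupport (sigma_component k l) #<= `I_s)%card.
Proof. exact: (s2valP' (gauss_jacobi_component k l)). Qed.
Let sigma0 k l := (component_measure_real a Y sigma k l _ (hsigma_ k l)).1.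
Let sigmaE k l := (component_measure_real a Y sigma k l _ (hsigma_ k l)).2.
Let Yhomog k l : Y k l \is k.-homog.
Proof. by have [Yh _ _] := hY k; have [] := Yh l. Qed.
Let Yharm k l : laplacian (Y k l) = 0.
Proof. by have [Yh _ _] := hY k; have [] := Yh l. Qed.
Let Yspan k (p : {mpoly R[d]}) : p \is k.-homog -> laplacian p = 0 ->
  exists c : 'I_(a k) -> R, p = \sum_l c l *: Y k l.
Proof.
by move=> pk lp; have [_ _ /(_ p lp pk)[c [-> _]]] := hY k; exists (fun l => c 0 l).
Qed.

Lemma sigma_weight_le k (l : 'I_(a k)) :
  \int[sigma_component k l]_t weight k t <= \int[mu_ k l]_t weight k t.
Proof.
exact: (component_weight_le _ _ _ _ rho r s PC NC PC' NC' rho0 rho_r s0 k (Y k l)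
  (mu_ k l) (sigma_component k l) (Yhomog k l) (mu0 k l) (muE k l) (sigma0 k l) (sigmaE k l)
  (gauss_jacobi_exact k l) (nodes k l)).
Qed.

Hypothesis mu_sum : (\sum_(0 <= k <oo) \sum_(l < a k)
      (charge_integral mu setT (fun x => rpeval (Y k l) (direction x)))%:E
        < +oo)%E.

Let weight_ge0 (m : {measure set R -> \bar R}) k : 0 <= \int[m]_t weight k t.
Proof. by apply: Rintegral_ge0 => t _; exact: powR_ge0. Qed.

(** By [component_weight] the terms of the summability hypothesis are integrals of the weights,
    hence nonnegative, and the partial sums stay below the finite sum of the series. *)
Lemma mu_weight_sum : exists Sg : R, forall n,
  \sum_(k < n) \sum_(l < a k) \int[mu_ k l]_t weight k t <= Sg.
Proof.
pose u k : \bar R := (\sum_(l < a k)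
  (charge_integral mu setT (fun x : borel_rV R d => rpeval (Y k l) (direction x)))%:E)%E.
have uE k : u k = (\sum_(l < a k) \int[mu_ k l]_t weight k t)%:E.
  rewrite /u sumEFin; congr _%:E; apply: eq_bigr => l _; rewrite charge_integralE.
  by rewrite -(component_weight _ _ rho r PC NC rho0 rho_r k (Y k l) (mu_ k l) (Yhomog k l)
    (mu0 k l) (muE k l)).2.
have u0 k : (0 <= u k)%E by rewrite uE lee_fin sumr_ge0.
have s0' : (0 <= \sum_(0 <= k <oo) u k)%E by apply: nneseries_ge0.
have sfin : (\sum_(0 <= k <oo) u k)%E \is a fin_num by rewrite ge0_fin_numE.
exists (fine (\sum_(0 <= k <oo) u k)%E) => n.
rewrite -lee_fin (fineK sfin); apply: le_trans (nneseries_lim_ge n _) => //.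
rewrite big_mkord -sumEFin; apply: lee_sum => k _; by rewrite uE.
Qed.

Variables (S : {measure set (borel_rV R d) -> \bar R}).
Hypotheses (SE : forall B, surface_measure B = S B) (SC : concentrated S usphere).

Let Yorth k (l l' : 'I_(a k)) : sphere_int S (Y k l * Y k l') = (l == l')%:R.
Proof.
have [_ Yo _] := hY k; rewrite -(Yo l l').
have -> : @surface_measure R d = S by apply/funext => B; exact: SE.
change (sphere_int S (Y k l * Y k l') =
  \int[S]_(x in usphere) (rpeval (Y k l) x * rpeval (Y k l') x)).
rewrite (Rintegral_usphere S SC).
  by apply: eq_Rintegral => x _; rewrite rpevalM.
by apply: measurable_funM; exact: measurable_rpeval.
Qed.

(** The same bound serves both measures, since the weights integrate to less under the components of
    sigma. *)
Lemma quadrature_sums_cvg (g : 'rV[R]_d -> R) : {within annulus rho r, continuous g} ->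
  (lf_sum S rho r a Y mu_ n g @[n --> \oo]
    --> signed_int (posm mu) (negm mu) (g \_ (annulus rho r))) /\
  (lf_sum S rho r a Y sigma_component n g @[n --> \oo]
    --> signed_int (posm sigma) (negm sigma) (g \_ (annulus rho r))).
Proof.
move=> cg; have [Sg hSg] := mu_weight_sum; split.
  exact: (lf_sum_cvg d2 S SE SC _ _ rho r PC NC rho0 rho_r a Y Yhomog Yharm Yorth Yspan
    mu_ mu0 muE Sg hSg g cg).
apply: (lf_sum_cvg d2 S SE SC _ _ rho r PC' NC' rho0 rho_r a Y Yhomog Yharm Yorth Yspan
    sigma_component sigma0 sigmaE Sg _ g cg) => n.
apply: le_trans (hSg n); apply: ler_sum => k _; apply: ler_sum => l _.
exact: sigma_weight_le.
Qed.

Variable Q : forall k : nat, 'I_(a k) -> {poly R}.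
Hypothesis hQ : forall (k : nat) (l : 'I_(a k)), gauss_polynomial (mu_ k l) s (Q k l).
Variable f : 'rV[R]_d -> R[i].
Hypotheses (f_cont : ccontinuous_on (annulus rho r) f)
    (f_smooth : cCn_on (2 * s) (interior (annulus rho r)) f).

Let T k (l : 'I_(a k)) : \bar R :=
  (ereal_sup [set (cmod (cderive1n (2 * s) (lf_profile Y f l) xi))%:E
                | xi in [set` `](rho ^+ 2)%R, (r ^+ 2)%R[]] *
      \int[image_sq (mu_ k l)]_(t in [set` `[(rho ^+ 2)%R, (r ^+ 2)%R]])
        ((Q k l).[t] ^+ 2)%:E)%E.

Local Notation term nu k l g := (lf_term S rho r k (Y k l) (nu k l) g).
Local Notation f1 := (@complex.Re R \o f).
Local Notation f2 := (@complex.Im R \o f).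

Lemma component_error_profile k (l : 'I_(a k)) (c1 c2 : R) : c1 ^+ 2 + c2 ^+ 2 <= 1 ->
  ((`|c1 * (term mu_ k l f1 - term sigma_component k l f1) +
      c2 * (term mu_ k l f2 - term sigma_component k l f2)|)%:E <=
   ((((2 * s)`!)%N%:R : R)^-1)%:E * T k l)%E.
Proof.
move=> c12; have [cf1 cf2] := f_cont; have [sf1 sf2] := f_smooth.
have [Fs1 j1 E1] := profile_jet S SC rho r rho0 rho_r _ (Y k l) _ (- (k%:R / 2)) sf1.
have [Fs2 j2 E2] := profile_jet S SC rho r rho0 rho_r _ (Y k l) _ (- (k%:R / 2)) sf2.
have SEf : @surface_measure R d = S by apply/funext => B; exact: SE.
have P1 : (@complex.Re R \o lf_profile Y f l) = Fs1 0%N.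
  apply/funext => t; rewrite E1 [LHS](ReM_real (lf_coeff Y f l (Num.sqrt t))); congr (_ * _).
  rewrite /lf_coeff /cintegral /= SEf /lf_int /Rintegral; congr fine.
  by apply: eq_integral => x _; rewrite ReM_real.
have P2 : (@complex.Im R \o lf_profile Y f l) = Fs2 0%N.
  apply/funext => t; rewrite E2 [LHS](ImM_real (lf_coeff Y f l (Num.sqrt t))); congr (_ * _).
  rewrite /lf_coeff /cintegral /= SEf /lf_int /Rintegral; congr fine.
  by apply: eq_integral => x _; rewrite ImM_real.
have := component_error S SC _ _ _ _ rho r s PC NC PC' NC' rho0 rho_r s0 k (Y k l)
  (mu_ k l) (sigma_component k l) (Yhomog k l) _ (mu0 k l) (muE k l) (sigma0 k l) (sigmaE k l)
  (gauss_jacobi_exact k l) (nodes k l) f1 f2 c1 c2 c12 cf1 cf2 Fs1 Fs2 j1 j2 E1 E2 (Q k l) (hQ k l).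
rewrite Yorth eqxx => /(_ erefl) /le_trans; apply.
rewrite /T (_ : [set _ | xi in _] = [set (cmod (cderive1n (2 * s) (lf_profile Y f l) xi))%:E
                | xi in [set` `](rho ^+ 2)%R, (r ^+ 2)%R[]]) //.
apply: eq_imagel => xi /= xiI.
rewrite /cderive1n P1 P2 /cmod /=.
by rewrite (jet_derive1n _ _ _ Fs1 _ j1) // (jet_derive1n _ _ _ Fs2 _ j2).
Qed.

Let T_ge0 k (l : 'I_(a k)) : (0 <= T k l)%E.
Proof.
apply: mule_ge0; last first.
  have msq : measurable_fun setT (@sq_map R) by exact: measurable_funX.
  apply: (@integral_ge0 _ _ _ (image_measure (mu_ k l) msq)) => t tI.
  by rewrite lee_fin sqr_ge0.
apply: le_trans (ereal_sup_ubound _); last first.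
  exists ((rho ^+ 2 + r ^+ 2) / 2); last by [].
  by apply: mid_in_itvoo; rewrite ltrXn2r // ?nnegrE // ltW // (le_lt_trans rho0).
by rewrite lee_fin cmod_ge0.
Qed.

(** The modulus of the error is the limit of real combinations [L n] of partial sums, each of which
    is bounded term by term through [component_error_profile]. *)
Lemma polyharmonic_quadrature_error :
  ((cmod (charge_cintegral mu (annulus rho r) f -
          charge_cintegral sigma (annulus rho r) f))%:E <=
   ((((2 * s)`!)%N%:R : R)^-1)%:E * \sum_(0 <= k <oo) \sum_(l < a k) T k l)%E.
Proof.
have [cf1 cf2] := f_cont.
set C : \bar R := ((((2 * s)`!)%N%:R : R)^-1)%:E.
have C0 : (0 <= C)%E by rewrite lee_fin invr_ge0 ler0n.
set E := charge_cintegral mu _ f - _.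
pose E1 := complex.Re E; pose E2 := complex.Im E; pose c := cmod E.
have c2E : c ^+ 2 = E1 ^+ 2 + E2 ^+ 2 by exact: cmod_sqr.
(* The unit vector in the direction of the error; division by 0 gives the zero vector if the error
   is 0, hence the inequality in [c12]. *)
pose c1 := E1 / c; pose c2 := E2 / c.
have c12 : c1 ^+ 2 + c2 ^+ 2 <= 1.
  rewrite /c1 /c2 !expr_div_n -mulrDl -c2E.
  have [->|cn0] := eqVneq c 0; first by rewrite expr0n mul0r.
  by rewrite divff // expf_neq0.
have cEE : c = c1 * E1 + c2 * E2.
  rewrite /c1 /c2 mulrAC [E2 / c * _]mulrAC -mulrDl -!expr2 -c2E.
  have [->|cn0] := eqVneq c 0; first by rewrite expr0n mul0r.
  by rewrite expr2 mulfK.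
pose L n := c1 * (lf_sum S rho r a Y mu_ n f1 - lf_sum S rho r a Y sigma_component n f1) +
            c2 * (lf_sum S rho r a Y mu_ n f2 - lf_sum S rho r a Y sigma_component n f2).
have L_cvg : L n @[n --> \oo] --> c.
  have [m1 g1] := quadrature_sums_cvg f1 cf1; have [m2 g2] := quadrature_sums_cvg f2 cf2.
  have -> : c = c1 * (signed_int (posm mu) (negm mu) (f1 \_ (annulus rho r)) -
      signed_int (posm sigma) (negm sigma) (f1 \_ (annulus rho r))) +
      c2 * (signed_int (posm mu) (negm mu) (f2 \_ (annulus rho r)) -
      signed_int (posm sigma) (negm sigma) (f2 \_ (annulus rho r))).
    rewrite cEE -!Re_charge_cintegral -!Im_charge_cintegral /E1 /E2 /E.
    by rewrite !raddfB.
  by apply: cvgD; apply: cvgM; (try exact: cvg_cst); apply: cvgB.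
have L_le n : ((L n)%:E <= C * \sum_(0 <= k <oo) \sum_(l < a k) T k l)%E.
  apply: (@le_trans _ _ (C * \sum_(0 <= k < n) \sum_(l < a k) T k l)%E); last first.
    rewrite lee_pmul2l // ?lte_fin ?invr_gt0 ?ltr0n ?fact_gt0 //.
    by apply: nneseries_lim_ge => k _ _; exact: sume_ge0.
  rewrite ge0_sume_distrr; last by move=> k _; exact: sume_ge0.
  rewrite big_mkord.
  have -> : L n = \sum_(k < n) \sum_(l < a k)
     (c1 * (term mu_ k l f1 - term sigma_component k l f1) +
      c2 * (term mu_ k l f2 - term sigma_component k l f2)).
    rewrite /L /lf_sum -!sumrB !mulr_sumr -big_split; apply: eq_bigr => k _ /=.
    by rewrite -!sumrB !mulr_sumr -big_split.
  rewrite -sumEFin; apply: lee_sum => k _; rewrite -sumEFin ge0_sume_distrr //.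
  apply: lee_sum => l _; apply: le_trans (component_error_profile k l c1 c2 c12).
  by rewrite lee_fin ler_norm.
have RHS0 : (0 <= C * \sum_(0 <= k <oo) \sum_(l < a k) T k l)%E.
  by apply: mule_ge0 => //; apply: nneseries_ge0 => k _ _; exact: sume_ge0.
(* For a finite bound the inequality passes to the limit; an infinite one is trivial, and
   nonnegativity excludes minus infinity. *)
move: L_le RHS0; case: (C * _)%E => [b| |] // L_le _; last by rewrite leey.
rewrite lee_fin -/c; apply: (@closed_cvg _ _ _ _ L [set z | z <= b] _ _ _ L_cvg).
  exact: closed_le.
by apply: nearW => n; rewrite /= -lee_fin.
Qed.

End polyharmonic_quadrature.

Theorem theorem26 (R : realType) (d : nat) (hd : (2 <= d)%N)
    (a : nat -> nat) (Y : forall k : nat, 'I_(a k) -> {mpoly R[d]})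
    (hY : harmonic_basis Y)
    (rho r : R) (hrho : 0 <= rho) (hr : rho < r)
    (s : nat) (hs : (1 <= s)%N)
    (mu : {charge set (borel_rV R d) -> \bar R})
    (mu_pp : pseudo_positive Y mu)
    (mu_supp : msupport (charge_abs mu) `<=` annulus rho r)
    (mu_sum : (\sum_(0 <= k <oo) \sum_(l < a k)
      (charge_integral mu setT (fun x => rpeval (Y k l) (direction x)))%:E
        < +oo)%E)
    (sigma : {charge set (borel_rV R d) -> \bar R})
    (hsigma : gauss_jacobi Y rho r s mu sigma)
    (mu_ : forall k : nat, 'I_(a k) -> {measure set R -> \bar R})
    (hmu_ : forall (k : nat) (l : 'I_(a k)),
      component_measure Y mu l (mu_ k l))
    (Q : forall k : nat, 'I_(a k) -> {poly R})
    (hQ : forall (k : nat) (l : 'I_(a k)),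
      gauss_polynomial (mu_ k l) s (Q k l))
    (f : 'rV[R]_d -> R[i])
    (f_cont : ccontinuous_on (annulus rho r) f)
    (f_smooth : cCn_on (2 * s) (interior (annulus rho r)) f) :
  ((cmod (charge_cintegral mu (annulus rho r) f -
          charge_cintegral sigma (annulus rho r) f))%:E <=
   ((((2 * s)`!)%N%:R : R)^-1)%:E *
   \sum_(0 <= k <oo) \sum_(l < a k)
     (ereal_sup [set (cmod (cderive1n (2 * s) (lf_profile Y f l) xi))%:E
                | xi in [set` `](rho ^+ 2)%R, (r ^+ 2)%R[]] *
      \int[image_sq (mu_ k l)]_(t in [set` `[(rho ^+ 2)%R, (r ^+ 2)%R]])
        ((Q k l).[t] ^+ 2)%:E))%E.
Proof.
have [S [SE _ SC]] := @surface_measureE R d.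
exact: (polyharmonic_quadrature_error hd hY rho r s hrho hr hs mu sigma mu_supp hsigma
  mu_ hmu_ mu_sum S SE SC Q hQ f f_cont f_smooth).
Qed.
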